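(* Let $s=a+ib$ with $a\ge1$, $b\in\mathbb{R}$, and let $k\in[0,1)$ satisfy $|b/s|\le k$. Let $g$ be analytic in $\mathbb{D}^*$ with expansion $g(\zeta)=\zeta+\frac{d}{\zeta}+\cdots$ near $\infty$, and suppose that for all $\zeta\in\mathbb{D}^*$ (with $\zeta\neq\infty$; the expression being defined and finite there) $$\left|ib+(1-|\zeta|^2)a\left\{(1-s)\left(1-\frac{\zeta g'(\zeta)}{g(\zeta)}\right)-s\frac{\zeta g''(\zeta)}{g'(\zeta)}\right\}\right|\le ak|s|-|b|(a-1).$$ Then $g$ extends to an $l$-quasiconformal automorphism of $\widehat{\mathbb{C}}$, where $$l=\frac{2ka+(1-k^2)|b|}{(1+k^2)a+(1-k^2)|s|}.$$
   Context: $\widehat{\mathbb{C}}=\mathbb{C}\cup\{\infty\}$ is the Riemann sphere and $\mathbb{D}^*=\{\zeta\in\widehat{\mathbb{C}}:|\zeta|>1\}$ (including $\infty$). A sense-preserving homeomorphism $F$ of a domain $G$ is $k$-quasiconformal ($0\le k<1$) if $F$ is absolutely continuous on almost all lines parallel to the coordinate axes and $|F_{\bar z}|\le k|F_z|$ almost everywhere in $G$ (in local coordinates near $\infty$). An $l$-quasiconformal automorphism of $\widehat{\mathbb{C}}$ extending $g$ is such a homeomorphism of $\widehat{\mathbb{C}}$ onto itself whose restriction to $\mathbb{D}^*$ is $g$. *)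

(* Defs.v *)
From Stdlib Require Import Reals List.
Open Scope R_scope.

Definition Cplx : Type := (R * R)%type.
Definition Czero : Cplx := (0, 0).
Definition Cone : Cplx := (1, 0).
Definition Ci : Cplx := (0, 1).
Definition RtoC (r : R) : Cplx := (r, 0).
Definition Cadd (z w : Cplx) : Cplx := (fst z + fst w, snd z + snd w).
Definition Copp (z : Cplx) : Cplx := (- fst z, - snd z).
Definition Csub (z w : Cplx) : Cplx := Cadd z (Copp w).
Definition Cmul (z w : Cplx) : Cplx :=
  (fst z * fst w - snd z * snd w, fst z * snd w + snd z * fst w).
Definition Cinv (z : Cplx) : Cplx :=
  (fst z / (fst z ^ 2 + snd z ^ 2), - snd z / (fst z ^ 2 + snd z ^ 2)).
Definition Cdiv (z w : Cplx) : Cplx := Cmul z (Cinv w).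
Definition Cscale (r : R) (z : Cplx) : Cplx := (r * fst z, r * snd z).
Definition Cnorm (z : Cplx) : R := sqrt (fst z ^ 2 + snd z ^ 2).

Definition has_cderiv (f : Cplx -> Cplx) (z l : Cplx) : Prop :=
  forall eps, 0 < eps -> exists delta, 0 < delta /\
    forall h, 0 < Cnorm h < delta ->
      Cnorm (Csub (Cdiv (Csub (f (Cadd z h)) (f z)) h) l) < eps.

Definition null1 (E : R -> Prop) : Prop :=
  forall eps, 0 < eps -> exists I : nat -> (R * R),
    (forall n, fst (I n) <= snd (I n)) /\
    (forall x, E x -> exists n, fst (I n) <= x <= snd (I n)) /\
    (forall N, sum_f_R0 (fun n => snd (I n) - fst (I n)) N < eps).

(* rectangle ((x1,x2),(y1,y2)) = [x1,x2] x [y1,y2] *)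
Definition null2 (E : Cplx -> Prop) : Prop :=
  forall eps, 0 < eps -> exists Q : nat -> ((R * R) * (R * R)),
    (forall n, fst (fst (Q n)) <= snd (fst (Q n)) /\
               fst (snd (Q n)) <= snd (snd (Q n))) /\
    (forall p, E p -> exists n,
        fst (fst (Q n)) <= fst p <= snd (fst (Q n)) /\
        fst (snd (Q n)) <= snd p <= snd (snd (Q n))) /\
    (forall N, sum_f_R0 (fun n => (snd (fst (Q n)) - fst (fst (Q n))) *
                                  (snd (snd (Q n)) - fst (snd (Q n)))) N < eps).

Fixpoint intervals_in (a b : R) (l : list (R * R)) : Prop :=
  match l with
  | nil => a <= b
  | (s, t) :: l' => a <= s /\ s <= t /\ intervals_in t b l'
  end.
Definition total_length (l : list (R * R)) : R :=
  fold_right (fun st acc => (snd st - fst st) + acc) 0 l.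
Definition variation (u : R -> Cplx) (l : list (R * R)) : R :=
  fold_right (fun st acc => Cnorm (Csub (u (snd st)) (u (fst st))) + acc) 0 l.
Definition abs_cont (u : R -> Cplx) (a b : R) : Prop :=
  forall eps, 0 < eps -> exists delta, 0 < delta /\
    forall l, intervals_in a b l -> total_length l < delta -> variation u l < eps.

Definition ACL (f : Cplx -> Cplx) (G : Cplx -> Prop) : Prop :=
  forall x1 x2 y1 y2, x1 < x2 -> y1 < y2 ->
    (forall x y, x1 <= x <= x2 -> y1 <= y <= y2 -> G (x, y)) ->
    null1 (fun y => y1 <= y <= y2 /\ ~ abs_cont (fun x => f (x, y)) x1 x2) /\
    null1 (fun x => x1 <= x <= x2 /\ ~ abs_cont (fun y => f (x, y)) y1 y2).

Definition has_dx (f : Cplx -> Cplx) (p v : Cplx) : Prop :=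
  forall eps, 0 < eps -> exists delta, 0 < delta /\
    forall h, 0 < Rabs h < delta ->
      Cnorm (Csub (Cscale (/ h) (Csub (f (fst p + h, snd p)) (f p))) v) < eps.
Definition has_dy (f : Cplx -> Cplx) (p v : Cplx) : Prop :=
  forall eps, 0 < eps -> exists delta, 0 < delta /\
    forall h, 0 < Rabs h < delta ->
      Cnorm (Csub (Cscale (/ h) (Csub (f (fst p, snd p + h)) (f p))) v) < eps.

Definition dz (fx fy : Cplx) : Cplx := Cscale (/ 2) (Csub fx (Cmul Ci fy)).
Definition dzbar (fx fy : Cplx) : Cplx := Cscale (/ 2) (Cadd fx (Cmul Ci fy)).

Definition dilat_ok (k : R) (f : Cplx -> Cplx) (p : Cplx) : Prop :=
  exists fx fy, has_dx f p fx /\ has_dy f p fy /\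
    Cnorm (dzbar fx fy) <= k * Cnorm (dz fx fy).

(** planar k-quasiconformality conditions on G (for a map that is already
    known to be a homeomorphism) *)
Definition planar_qc (k : R) (G : Cplx -> Prop) (f : Cplx -> Cplx) : Prop :=
  ACL f G /\ null2 (fun p => G p /\ ~ dilat_ok k f p).

(** * The Riemann sphere  Ĉ = option Cplx  (None = ∞) *)
Definition sphere : Type := option Cplx.

Definition chordal (p q : sphere) : R :=
  match p, q with
  | Some z, Some w =>
      2 * Cnorm (Csub z w) / sqrt ((1 + Cnorm z ^ 2) * (1 + Cnorm w ^ 2))
  | Some z, None | None, Some z => 2 / sqrt (1 + Cnorm z ^ 2)
  | None, None => 0
  end.

Definition sphere_continuous (F : sphere -> sphere) : Prop :=
  forall p eps, 0 < eps -> exists delta, 0 < delta /\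
    forall q, chordal p q < delta -> chordal (F p) (F q) < eps.

Definition sphere_homeo (F : sphere -> sphere) : Prop :=
  exists H : sphere -> sphere,
    (forall p, H (F p) = p) /\ (forall p, F (H p) = p) /\
    sphere_continuous F /\ sphere_continuous H.

Definition C_eq_dec (z w : Cplx) : {z = w} + {z <> w}.
Proof. decide equality; apply Req_EM_T. Defined.

(** the two standard charts: chart false = z (on Cplx), chart true = 1/z
    (on Ĉ \ {0}, with ∞ ↦ 0) *)
Definition chart_inv (i : bool) (w : Cplx) : sphere :=
  if i then (if C_eq_dec w Czero then None else Some (Cinv w)) else Some w.
Definition chart (j : bool) (p : sphere) : option Cplx :=
  match j, p with
  | false, Some z => Some z
  | false, None => None
  | true, None => Some Czero
  | true, Some z => if C_eq_dec z Czero then None else Some (Cinv z)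
  end.

Definition loc_dom (F : sphere -> sphere) (i j : bool) (w : Cplx) : Prop :=
  exists v, chart j (F (chart_inv i w)) = Some v.
Definition loc_fun (F : sphere -> sphere) (i j : bool) (w : Cplx) : Cplx :=
  match chart j (F (chart_inv i w)) with Some v => v | None => Czero end.

Definition qc_sphere (l : R) (F : sphere -> sphere) : Prop :=
  sphere_homeo F /\ forall i j : bool, planar_qc l (loc_dom F i j) (loc_fun F i j).

(* Main.v *)
(** Let [s = a + ib] and, for [t >= 0] and [|w| >= exp(a t)],
    [Psi_t(w) = g(w) (1 - (1 - exp(-2t)) w g'(w)/g(w))^s].
    In the coordinate [w = exp W] one has [d(log Psi)/dt = - 2 a A] and [d(log Psi)/dW = A (1 - x)] with
    [s x = ib + a (1 - exp(2t)) E(w)], where [E] is the expression in braces; since [a >= 1], the hypothesis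
    gives [|x| <= k].  Hence a level curve of [log Psi] moves with velocity [2a/(1 - x)], whose real part
    exceeds [a]: level curves run into the interior of the region [Re W >= a t].  Following two of them up to
    a large time, where [log Psi_t(exp W)] is close to [W - 2 t s], shows that every [Psi_t] is univalent;
    applied to the bracket itself, the same argument shows that it does not vanish.
    The extension is [F(exp(- conj W)) = Psi_t(exp W)] with [t = Re W / a]; its Beltrami coefficient has
    modulus [|x| <= k], and [k] is at most the bound of the theorem.  Following level curves for a short time
    from the unit circle gives injectivity there, and following them up to time [1] bounds [log g] near the
    circle; then [g'(w)/g(w) = O((|w| - 1)^(-k))], which yields continuity and absolute continuity on lines
    across the circle.  Following level curves backwards in time gives surjectivity. *)

From Stdlib Require Import Reals Lra Lia Psatz Classical ClassicalEpsilon List.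
From Coquelicot Require Import Coquelicot.
Require Defs.
Open Scope R_scope.
Set Bullet Behavior "Strict Subproofs".

(** The shape of the hypothesis comes from the role of time. Since [E] does not depend on t, s x is
    affine in exp(2t): it is i b at t = 0 and the given expression at t = Re W. For a t <= Re W,
    convexity and a >= 1 put it at a fraction theta <= 1/a of the way, and theta (a k |s| - |b| (a -
    1)) + (1 - theta) |b| = |b| + a theta (k |s| - |b|) <= k |s|. The obstacle is that little is
    known beforehand: not that g is univalent, nor that the bracket has a logarithm, nor that g
    extends continuously to the circle, nor that [E] is continuous. So level curves are not obtained
    from a differential equation. They are built from short steps of a quantitative open mapping
    argument with uniform step length, and continued by a supremum. In logarithmic coordinates the
    circle becomes the imaginary axis, the multivaluedness becomes a period, and the inversion
    between the two charts of the sphere becomes a sign change, so that all four chart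
    representations are covered by one local statement. Absolute continuity rests on k < 1: the
    derivatives grow at most like |Re Z|^(-k), and this is integrable across the axis. *)

(** * Elementary inequalities and the complex modulus *)

Lemma half_pos (e : R) : 0 < e -> 0 < e / 2.
Proof. lra. Qed.

Lemma choice {A B : Type} (R : A -> B -> Prop) :
  (forall x, exists y, R x y) -> exists f, forall x, R x (f x).
Proof.
  intros H. exists (fun x => proj1_sig (constructive_indefinite_description _ (H x))).
  intros x. apply proj2_sig.
Qed.

Lemma exp_le x y : x <= y -> exp x <= exp y.
Proof. intros [H|<-]; [left; now apply exp_increasing|lra]. Qed.

Lemma C_ext (z w : C) : Re z = Re w -> Im z = Im w -> z = w.
Proof. destruct z, w; simpl; intros; subst; reflexivity. Qed.

Lemma Cmod_sub_sym (z w : C) : Cmod (z - w) = Cmod (w - z).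
Proof. rewrite <- Cmod_opp. f_equal. ring. Qed.

Lemma Cmod_tri3 (x y z : C) : Cmod (x - z) <= Cmod (x - y) + Cmod (y - z).
Proof. replace (x - z)%C with ((x - y) + (y - z))%C by ring. apply Cmod_triangle. Qed.

Lemma Cmod_rev (x y : C) : Cmod x - Cmod y <= Cmod (x - y).
Proof.
  replace x with ((x - y) + y)%C at 1 by ring.
  generalize (Cmod_triangle (x - y) y); lra.
Qed.

Lemma im_le_Cmod (z : C) : Rabs (Im z) <= Cmod z.
Proof.
  replace (Im z) with (Re (- Ci * z)%C) by (destruct z; simpl; ring).
  apply Rle_trans with (Cmod (- Ci * z)); [apply re_le_Cmod|].
  rewrite Cmod_mult, Cmod_opp, Cmod_Ci. lra.
Qed.

Lemma Cmod_le_re_im (z : C) : Cmod z <= Rabs (Re z) + Rabs (Im z).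
Proof.
  replace z with (RtoC (Re z) + Ci * RtoC (Im z))%C at 1
    by (apply C_ext; destruct z; simpl; ring).
  eapply Rle_trans; [apply Cmod_triangle|].
  rewrite Cmod_mult, Cmod_Ci, !Cmod_R. lra.
Qed.

Lemma Cmod_sq (z : C) : Cmod z ^ 2 = Re z ^ 2 + Im z ^ 2.
Proof. apply Cmod2_alt. Qed.

Lemma Cmod_pos (z : C) : z <> 0 -> 0 < Cmod z.
Proof. apply Cmod_gt_0. Qed.

Lemma Cmod_eq0_sub (z w : C) : Cmod (z - w) = 0 -> z = w.
Proof.
  intros H. apply Cmod_eq_0 in H.
  replace z with ((z - w) + w)%C by ring. rewrite H. ring.
Qed.

Lemma Cmod_eps (z w : C) : (forall eps, 0 < eps -> Cmod (z - w) <= eps) -> z = w.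
Proof.
  intros H. apply Cmod_eq0_sub. apply Rle_antisym; [|apply Cmod_ge_0].
  apply le_epsilon. intros e He. rewrite Rplus_0_l. auto.
Qed.

Lemma Cmult_nz (z w : C) : z <> 0 -> w <> 0 -> (z * w)%C <> 0.
Proof. apply Cmult_neq_0. Qed.

Lemma Cinv_nz (z : C) : z <> 0 -> (/ z)%C <> 0.
Proof.
  intros Hz H. apply C1_nz. rewrite <- (Cinv_r z Hz), H. ring.
Qed.

(** * Limits along a filter and continuity *)

(** Taken along an arbitrary filter, so that the algebra of limits is proved once for points ([nb]),
    for pairs of a point and a time ([nb2]) and for sequences ([eventually]). *)
Definition limC {T : Type} (F : (T -> Prop) -> Prop) (f : T -> C) (l : C) : Prop :=
  forall eps, 0 < eps -> F (fun x => Cmod (f x - l) < eps).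

Section Limits.
Context {T : Type} {F : (T -> Prop) -> Prop} {FF : Filter F}.

Lemma limC_ext (f g : T -> C) l : F (fun x => f x = g x) -> limC F f l -> limC F g l.
Proof.
  intros H1 H2 eps He. generalize (filter_and _ _ H1 (H2 eps He)).
  apply filter_imp. intros x [E H]. rewrite <- E. exact H.
Qed.

Lemma limC_const (c : C) : limC F (fun _ => c) c.
Proof.
  intros eps He. apply filter_forall. intros x.
  replace (c - c)%C with (RtoC 0) by ring. rewrite Cmod_0. exact He.
Qed.

Lemma limC_plus (f g : T -> C) l m :
  limC F f l -> limC F g m -> limC F (fun x => f x + g x)%C (l + m)%C.
Proof.
  intros H1 H2 eps He.
  generalize (filter_and _ _ (H1 _ (half_pos _ He)) (H2 _ (half_pos _ He))).
  apply filter_imp. intros x [A B].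
  replace (f x + g x - (l + m))%C with ((f x - l) + (g x - m))%C by ring.
  eapply Rle_lt_trans; [apply Cmod_triangle|lra].
Qed.

Lemma limC_bounded (f : T -> C) l : limC F f l -> F (fun x => Cmod (f x) < Cmod l + 1).
Proof.
  intros H. generalize (H 1 Rlt_0_1). apply filter_imp. intros x Hx.
  generalize (Cmod_rev (f x) l); lra.
Qed.

Lemma limC_mult (f g : T -> C) l m :
  limC F f l -> limC F g m -> limC F (fun x => f x * g x)%C (l * m)%C.
Proof.
  intros H1 H2 eps He.
  generalize (Cmod_ge_0 l) (Cmod_ge_0 m); intros Hl Hm.
  set (d := eps / (2 * (Cmod l + Cmod m + 1))).
  assert (Hd : 0 < d) by (apply Rdiv_lt_0_compat; lra).
  assert (Ed : d * (Cmod l + Cmod m + 1) = eps / 2) by (unfold d; field; lra).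
  generalize (filter_and _ _ (limC_bounded g m H2) (filter_and _ _ (H1 d Hd) (H2 d Hd))).
  apply filter_imp. intros x (B & A1 & A2).
  replace (f x * g x - l * m)%C with ((f x - l) * g x + l * (g x - m))%C by ring.
  eapply Rle_lt_trans; [apply Cmod_triangle|]. rewrite !Cmod_mult.
  generalize (Cmod_ge_0 (f x - l)) (Cmod_ge_0 (g x)) (Cmod_ge_0 (g x - m)). nra.
Qed.

Lemma limC_opp (f : T -> C) l : limC F f l -> limC F (fun x => - f x)%C (- l)%C.
Proof.
  intros H eps He. generalize (H eps He). apply filter_imp. intros x.
  replace (- f x - - l)%C with (- (f x - l))%C by ring. now rewrite Cmod_opp.
Qed.

Lemma limC_minus (f g : T -> C) l m :
  limC F f l -> limC F g m -> limC F (fun x => f x - g x)%C (l - m)%C.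
Proof. intros. apply limC_plus; auto using limC_opp. Qed.

Lemma limC_away (f : T -> C) l : limC F f l -> l <> 0 -> F (fun x => Cmod l / 2 < Cmod (f x)).
Proof.
  intros H Hl. apply Cmod_pos in Hl. generalize (H _ (half_pos _ Hl)).
  apply filter_imp. intros x. rewrite Cmod_sub_sym.
  generalize (Cmod_rev l (f x)). lra.
Qed.

Lemma limC_inv (f : T -> C) l : limC F f l -> l <> 0 -> limC F (fun x => / f x)%C (/ l)%C.
Proof.
  intros H Hl eps He. generalize (Cmod_pos l Hl); intros Hp.
  set (d := eps * Cmod l * Cmod l / 2).
  assert (Hd : 0 < d) by (unfold d; apply Rdiv_lt_0_compat; [|lra]; repeat apply Rmult_lt_0_compat; lra).
  generalize (filter_and _ _ (limC_away f l H Hl) (H d Hd)).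
  apply filter_imp. intros x (A & B).
  assert (Hf : f x <> 0) by (intros E; rewrite E, Cmod_0 in A; lra).
  replace (/ f x - / l)%C with ((l - f x) / (f x * l))%C by (field; auto).
  rewrite Cmod_div by (apply Cmult_nz; auto). rewrite Cmod_mult.
  rewrite Cmod_sub_sym. apply Rmult_lt_reg_r with (Cmod (f x) * Cmod l).
  - apply Rmult_lt_0_compat; lra.
  - unfold Rdiv. rewrite Rmult_assoc, Rinv_l, Rmult_1_r by (apply Rgt_not_eq, Rmult_lt_0_compat; lra).
    eapply Rlt_le_trans; [exact B|]. unfold d.
    assert (0 < eps * Cmod l) by (apply Rmult_lt_0_compat; lra). nra.
Qed.

Lemma limC_div (f g : T -> C) l m :
  limC F f l -> limC F g m -> m <> 0 -> limC F (fun x => f x / g x)%C (l / m)%C.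
Proof. intros. apply limC_mult; auto using limC_inv. Qed.

End Limits.

Lemma limC_le {T : Type} {F : (T -> Prop) -> Prop} {PF : ProperFilter F} (f : T -> C) l c K :
  limC F f l -> F (fun x => Cmod (f x - c) <= K) -> Cmod (l - c) <= K.
Proof.
  intros H1 H2. apply le_epsilon. intros e He.
  destruct (filter_ex _ (filter_and _ _ (H1 e He) H2)) as [x [A B]].
  rewrite Cmod_sub_sym in A. generalize (Cmod_tri3 l (f x) c). lra.
Qed.

Lemma limC_unique {T : Type} {F : (T -> Prop) -> Prop} {PF : ProperFilter F} (f : T -> C) l m :
  limC F f l -> limC F f m -> l = m.
Proof.
  intros H1 H2. apply Cmod_eps. intros e He. apply (limC_le f); auto.
  generalize (H2 e He). apply filter_imp. intros; lra.
Qed.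

(** The centre belongs to the ball, so a property that holds near [p] holds at [p] ([nb_self]). *)
Definition nb (p : C) (P : C -> Prop) : Prop :=
  exists d, 0 < d /\ forall z, Cmod (z - p) < d -> P z.

Global Instance nb_filter p : ProperFilter (nb p).
Proof.
  constructor.
  - intros P (d & Hd & H). exists p. apply H.
    replace (p - p)%C with (RtoC 0) by ring. now rewrite Cmod_0.
  - constructor.
    + exists 1. split; [lra|auto].
    + intros P Q (d & Hd & H) (d' & Hd' & H'). exists (Rmin d d'). split.
      * now apply Rmin_pos.
      * intros z Hz. split; [apply H|apply H']; eapply Rlt_le_trans; eauto using Rmin_l, Rmin_r.
    + intros P Q HI (d & Hd & H). exists d. auto.
Qed.

Definition ccont (f : C -> C) (p : C) : Prop := limC (nb p) f (f p).

Lemma limC_comp {T : Type} {F : (T -> Prop) -> Prop} {FF : Filter F} (f : T -> C) (g : C -> C) l :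
  limC F f l -> ccont g l -> limC F (fun x => g (f x)) (g l).
Proof.
  intros H G eps He. destruct (G eps He) as (d & Hd & Hg).
  generalize (H d Hd). apply filter_imp. auto.
Qed.

Lemma ccont_id p : ccont (fun z => z) p.
Proof. intros eps He. exists eps. auto. Qed.

Lemma nb_self (p : C) (P : C -> Prop) : nb p P -> P p.
Proof.
  intros (d & Hd & H). apply H. replace (p - p)%C with (RtoC 0) by ring. now rewrite Cmod_0.
Qed.

Lemma ccont_ext (f g : C -> C) p : nb p (fun z => f z = g z) -> ccont f p -> ccont g p.
Proof.
  intros H1 H2. unfold ccont. rewrite <- (nb_self p _ H1).
  apply (limC_ext f); auto.
Qed.

Lemma nb_re_gt (p : C) c : c < Re p -> nb p (fun z => c < Re z).
Proof.
  intros H. exists (Re p - c). split; [lra|]. intros z Hz.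
  generalize (re_le_Cmod (z - p)). destruct z, p. simpl in *. intros H1.
  generalize (Rle_abs (-(r + - r1))). rewrite Rabs_Ropp. lra.
Qed.

Lemma nb_re_lt (p : C) c : Re p < c -> nb p (fun z => Re z < c).
Proof.
  intros H. exists (c - Re p). split; [lra|]. intros z Hz.
  generalize (re_le_Cmod (z - p)). destruct z, p. simpl in *. intros H1.
  generalize (Rle_abs (r + - r1)). lra.
Qed.

Lemma nb_open (p : C) (P : C -> Prop) : nb p P -> nb p (fun z => nb z P).
Proof.
  intros (d & Hd & H). exists (d / 2). split; [lra|]. intros z Hz.
  exists (d / 2). split; [lra|]. intros w Hw. apply H.
  generalize (Cmod_tri3 w z p). lra.
Qed.

(** * Wirtinger derivatives *)

(** [lo] is o(h) and [bo] is O(h) as h tends to 0. The case h = 0 is included and forces r 0 = 0. *)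
Definition lo (r : C -> C) : Prop :=
  forall eps, 0 < eps -> nb 0 (fun h => Cmod (r h) <= eps * Cmod h).
Definition bo (r : C -> C) : Prop :=
  exists K, 0 < K /\ nb 0 (fun h => Cmod (r h) <= K * Cmod h).

Lemma lo_ext f g : nb 0 (fun h => f h = g h) -> lo f -> lo g.
Proof.
  intros E H eps He. generalize (filter_and _ _ E (H eps He)). apply filter_imp.
  intros h [A B]. now rewrite <- A.
Qed.

Lemma lo_plus f g : lo f -> lo g -> lo (fun h => f h + g h)%C.
Proof.
  intros H1 H2 eps He.
  generalize (filter_and _ _ (H1 _ (half_pos _ He)) (H2 _ (half_pos _ He))).
  apply filter_imp. intros h [A B].
  eapply Rle_trans; [apply Cmod_triangle|]. lra.
Qed.

Lemma bo_plus f g : bo f -> bo g -> bo (fun h => f h + g h)%C.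
Proof.
  intros (K & HK & H1) (K' & HK' & H2). exists (K + K'). split; [lra|].
  generalize (filter_and _ _ H1 H2). apply filter_imp. intros h [A B].
  eapply Rle_trans; [apply Cmod_triangle|]. lra.
Qed.

Lemma lo_scal c f : lo f -> lo (fun h => c * f h)%C.
Proof.
  intros H eps He. generalize (Cmod_ge_0 c); intros Hc.
  assert (Hd : 0 < eps / (Cmod c + 1)) by (apply Rdiv_lt_0_compat; lra).
  generalize (H _ Hd). apply filter_imp. intros h A. rewrite Cmod_mult.
  assert (E : eps = (Cmod c + 1) * (eps / (Cmod c + 1))) by (field; lra).
  generalize (Cmod_ge_0 (f h)) (Cmod_ge_0 h). intros. rewrite E.
  assert (0 <= eps / (Cmod c + 1) * Cmod h) by nra. nra.
Qed.

Lemma lo_conj f : lo f -> lo (fun h => Cconj (f h)).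
Proof. intros H eps He. generalize (H eps He). apply filter_imp. intros h. now rewrite Cmod_conj. Qed.

Lemma bo_lin (al be : C) : bo (fun h => al * h + be * Cconj h)%C.
Proof.
  exists (Cmod al + Cmod be + 1). generalize (Cmod_ge_0 al) (Cmod_ge_0 be). intros.
  split; [lra|]. apply filter_forall. intros h.
  eapply Rle_trans; [apply Cmod_triangle|]. rewrite !Cmod_mult, Cmod_conj.
  generalize (Cmod_ge_0 h). nra.
Qed.

Lemma bo_lo f : lo f -> bo f.
Proof. intros H. exists 1. split; [lra|]. apply H. lra. Qed.

Lemma bo_small f e : 0 < e -> bo f -> nb 0 (fun h => Cmod (f h) < e).
Proof.
  intros He (K & HK & H).
  assert (nb 0 (fun h => Cmod h < e / K)).
  { exists (e / K). split; [now apply Rdiv_lt_0_compat|]. intros z.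
    now replace (z - 0)%C with z by ring. }
  generalize (filter_and _ _ H H0). apply filter_imp. intros h [A B].
  eapply Rle_lt_trans; [exact A|].
  apply Rmult_lt_compat_l with (r := K) in B; [|lra].
  replace (K * (e / K)) with e in B by (field; lra). exact B.
Qed.

Lemma lo_mult f g : bo f -> bo g -> lo (fun h => f h * g h)%C.
Proof.
  intros Hf (K & HK & Hg) eps He.
  assert (0 < eps / K) by now apply Rdiv_lt_0_compat.
  generalize (filter_and _ _ (bo_small f _ H Hf) Hg). apply filter_imp. intros h [A B].
  rewrite Cmod_mult.
  replace (eps * Cmod h) with (eps / K * (K * Cmod h)) by (field; lra).
  apply Rmult_le_compat; auto using Cmod_ge_0. lra.
Qed.

Lemma lo_comp r d : lo r -> bo d -> lo (fun h => r (d h)).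
Proof.
  intros Hr (K & HK & Hd) eps He.
  assert (Hp : 0 < eps / K) by now apply Rdiv_lt_0_compat.
  destruct (Hr _ Hp) as (e & He' & H).
  assert (Hbo : bo d) by (exists K; auto).
  generalize (filter_and _ _ (bo_small d e He' Hbo) Hd). apply filter_imp. intros h [A B].
  eapply Rle_trans; [apply H; now replace (d h - 0)%C with (d h) by ring|].
  replace (eps * Cmod h) with (eps / K * (K * Cmod h)) by (field; lra).
  apply Rmult_le_compat_l; lra.
Qed.

(* [al] and [be] are the derivatives with respect to [z] and its conjugate;
   complex differentiability is the case [be = 0]. *)
Definition wd (f : C -> C) (p al be : C) : Prop :=
  lo (fun h => f (p + h) - f p - (al * h + be * Cconj h))%C.

Lemma wd_bo f p al be : wd f p al be -> bo (fun h => f (p + h) - f p)%C.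
Proof.
  intros H. destruct (bo_plus _ _ (bo_lo _ H) (bo_lin al be)) as (K & HK & A).
  exists K. split; [exact HK|]. generalize A. apply filter_imp. intros h.
  intros Hh. eapply Rle_trans; [right|exact Hh]. f_equal. ring.
Qed.

Lemma nb_shift (p : C) (P : C -> Prop) : nb p P <-> nb 0 (fun h => P (p + h)%C).
Proof.
  split; intros (d & Hd & H); exists d; split; auto; intros z Hz.
  - apply H. now replace (p + z - p)%C with (z - 0)%C by ring.
  - replace z with (p + (z - p))%C by ring. apply H.
    now replace (z - p - 0)%C with (z - p)%C by ring.
Qed.

Lemma wd_ccont f p al be : wd f p al be -> ccont f p.
Proof.
  intros H eps He. apply nb_shift. apply (bo_small (fun h => f (p + h) - f p)%C); auto.
  eapply wd_bo; eauto.
Qed.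

Lemma wd_ext f g p al be : nb p (fun z => f z = g z) -> wd f p al be -> wd g p al be.
Proof.
  intros E H. apply (lo_ext (fun h => f (p + h) - f p - (al * h + be * Cconj h))%C); auto.
  generalize (proj1 (nb_shift p _) E). apply filter_imp. intros h Hh.
  now rewrite Hh, (nb_self _ _ E).
Qed.

Lemma wd_const c p : wd (fun _ => c) p 0 0.
Proof.
  intros eps He. apply filter_forall. intros h.
  replace (c - c - (0 * h + 0 * Cconj h))%C with (RtoC 0) by ring.
  rewrite Cmod_0. generalize (Cmod_ge_0 h). nra.
Qed.

Lemma wd_id p : wd (fun z => z) p 1 0.
Proof.
  intros eps He. apply filter_forall. intros h.
  replace (p + h - p - (1 * h + 0 * Cconj h))%C with (RtoC 0) by ring.
  rewrite Cmod_0. generalize (Cmod_ge_0 h). nra.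
Qed.

Lemma wd_conj p : wd Cconj p 0 1.
Proof.
  intros eps He. apply filter_forall. intros h. rewrite Cplus_conj.
  replace (Cconj p + Cconj h - Cconj p - (0 * h + 1 * Cconj h))%C with (RtoC 0) by ring.
  rewrite Cmod_0. generalize (Cmod_ge_0 h). nra.
Qed.

Lemma wd_plus f g p al be al' be' :
  wd f p al be -> wd g p al' be' -> wd (fun z => f z + g z)%C p (al + al')%C (be + be')%C.
Proof.
  intros H1 H2. eapply lo_ext; [|apply (lo_plus _ _ H1 H2)].
  apply filter_forall. intros h. ring.
Qed.

Lemma wd_scal c f p al be : wd f p al be -> wd (fun z => c * f z)%C p (c * al)%C (c * be)%C.
Proof.
  intros H. eapply lo_ext; [|apply (lo_scal c _ H)]. apply filter_forall. intros h. ring.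
Qed.

Lemma wd_eq f p al be al' be' : al = al' -> be = be' -> wd f p al be -> wd f p al' be'.
Proof. intros; subst; auto. Qed.

Lemma wd_opp f p al be : wd f p al be -> wd (fun z => - f z)%C p (- al)%C (- be)%C.
Proof.
  intros H. eapply lo_ext; [|apply (lo_scal (-(1)) _ H)]. apply filter_forall. intros h. ring.
Qed.

Lemma wd_minus f g p al be al' be' :
  wd f p al be -> wd g p al' be' -> wd (fun z => f z - g z)%C p (al - al')%C (be - be')%C.
Proof. intros H1 H2. apply wd_plus; auto using wd_opp. Qed.

Lemma wd_mult f g p al be al' be' :
  wd f p al be -> wd g p al' be' ->
  wd (fun z => f z * g z)%C p (al * g p + f p * al')%C (be * g p + f p * be')%C.
Proof.
  intros H1 H2.
  eapply lo_ext; [|apply (lo_plus _ _ (lo_plus _ _ (lo_scal (f p) _ H2) (lo_scal (g p) _ H1))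
    (lo_mult _ _ (wd_bo _ _ _ _ H1) (wd_bo _ _ _ _ H2)))].
  apply filter_forall. intros h. ring.
Qed.

Lemma wd_comp f g p al be al' be' :
  wd f p al be -> wd g (f p) al' be' ->
  wd (fun z => g (f z)) p (al' * al + be' * Cconj be)%C (al' * be + be' * Cconj al)%C.
Proof.
  intros H1 H2.
  eapply lo_ext; [|apply (lo_plus _ _ (lo_comp _ _ H2 (wd_bo _ _ _ _ H1))
     (lo_plus _ _ (lo_scal al' _ H1) (lo_scal be' _ (lo_conj _ H1))))].
  apply filter_forall. intros h. simpl.
  replace (f p + (f (p + h) - f p))%C with (f (p + h))%C by ring.
  rewrite !Cminus_conj, Cplus_conj, !Cmult_conj, Cconj_conj. ring.
Qed.

Lemma wd_comp_hol f g p al be c :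
  wd f p al be -> wd g (f p) c 0 -> wd (fun z => g (f z)) p (c * al)%C (c * be)%C.
Proof.
  intros H1 H2. eapply wd_eq; [| |apply (wd_comp _ _ _ _ _ _ _ H1 H2)]; ring.
Qed.

Lemma wd_inv (p : C) : p <> 0 -> wd (fun z => / z)%C p (- / (p * p))%C 0.
Proof.
  intros Hp eps He. generalize (Cmod_pos p Hp). intros Hm.
  (* The remainder is h^2 / (p^2 (p + h)). The first bound gives |p + h| >= |p| / 2, and then the
     second makes the remainder at most eps |h|. *)
  set (d := Rmin (Cmod p / 2) (eps * Cmod p ^ 3 / 2)).
  assert (Hd : 0 < d).
  { apply Rmin_pos; [lra|]. apply Rdiv_lt_0_compat; [|lra].
    apply Rmult_lt_0_compat; [lra|]. apply pow_lt; lra. }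
  exists d. split; [exact Hd|]. intros h Hh.
  replace (h - 0)%C with h in Hh by ring.
  assert (H1 : Cmod h < Cmod p / 2) by (eapply Rlt_le_trans; [exact Hh|apply Rmin_l]).
  assert (H2 : Cmod h <= eps * Cmod p ^ 3 / 2)
    by (left; eapply Rlt_le_trans; [exact Hh|apply Rmin_r]).
  assert (H3 : Cmod p / 2 <= Cmod (p + h)).
  { generalize (Cmod_rev p (- h)). rewrite Cmod_opp.
    replace (p - - h)%C with (p + h)%C by ring. lra. }
  assert (Hph : (p + h)%C <> 0) by (intros E; rewrite E, Cmod_0 in H3; lra).
  replace (/ (p + h) - / p - (- / (p * p) * h + 0 * Cconj h))%C
    with (h * h / (p * p * (p + h)))%C by (field; auto).
  rewrite Cmod_div by (repeat apply Cmult_nz; auto). rewrite !Cmod_mult.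
  apply Rmult_le_reg_r with (Cmod p * Cmod p * Cmod (p + h)).
  { repeat apply Rmult_lt_0_compat; lra. }
  unfold Rdiv. rewrite Rmult_assoc, Rinv_l, Rmult_1_r
    by (apply Rgt_not_eq; repeat apply Rmult_lt_0_compat; lra).
  generalize (Cmod_ge_0 h); intros H0.
  apply Rle_trans with (eps * Cmod h * (Cmod p * Cmod p * (Cmod p / 2))).
  - simpl in H2. nra.
  - apply Rmult_le_compat_l; [nra|]. apply Rmult_le_compat_l; [nra|exact H3].
Qed.

Lemma wd_invf f (p al be : C) : wd f p al be -> f p <> 0 ->
  wd (fun z => / f z)%C p (- al / (f p * f p))%C (- be / (f p * f p))%C.
Proof.
  intros H Hf. eapply wd_eq; [| |apply (wd_comp_hol f _ p al be _ H (wd_inv _ Hf))]; field; auto.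
Qed.

(** Both derivatives are half of [l] because Re z = (z + conj z) / 2. *)
Lemma wd_RtoC_Re (phi : R -> R) (p : C) (l : R) :
  derivable_pt_lim phi (Re p) l ->
  wd (fun z => RtoC (phi (Re z))) p (RtoC (l / 2)) (RtoC (l / 2)).
Proof.
  intros H eps He. destruct (H eps He) as (d & Hd).
  exists d. split; [apply cond_pos|]. intros h Hh.
  replace (h - 0)%C with h in Hh by ring.
  assert (E : (RtoC (phi (Re (p + h))) - RtoC (phi (Re p)) - (RtoC (l / 2) * h + RtoC (l / 2) * Cconj h))%C
     = RtoC (phi (Re p + Re h) - phi (Re p) - l * Re h)).
  { apply C_ext; destruct p, h; simpl; field. }
  rewrite E, Cmod_R. generalize (re_le_Cmod h). intros Hr.
  destruct (Req_dec (Re h) 0) as [Z|Z].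
  - rewrite Z, Rplus_0_r. replace (phi (Re p) - phi (Re p) - l * 0) with 0 by ring.
    rewrite Rabs_R0. generalize (Cmod_ge_0 h). nra.
  - assert (Hs : Rabs (Re h) < d) by lra.
    generalize (Hd _ Z Hs). intros Hq.
    replace (phi (Re p + Re h) - phi (Re p) - l * Re h)
      with (((phi (Re p + Re h) - phi (Re p)) / Re h - l) * Re h) by (field; auto).
    rewrite Rabs_mult. apply Rmult_le_compat; auto using Rabs_pos. lra.
Qed.

(** * Mean value inequalities *)

Definition rd (u : R -> C) (t : R) (v : C) : Prop :=
  forall eps, 0 < eps -> exists d, 0 < d /\ forall h, Rabs h < d ->
    Cmod (u (t + h) - u t - v * RtoC h) <= eps * Rabs h.

Definition rcont (u : R -> C) (t : R) : Prop :=
  forall eps, 0 < eps -> exists d, 0 < d /\ forall t', Rabs (t' - t) < d ->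
    Cmod (u t' - u t) < eps.

Lemma rd_rcont u t v : rd u t v -> rcont u t.
Proof.
  intros H eps He. destruct (H 1 Rlt_0_1) as (d & Hd & A).
  generalize (Cmod_ge_0 v); intros Hv.
  exists (Rmin d (eps / (Cmod v + 2))). split.
  { apply Rmin_pos; auto. apply Rdiv_lt_0_compat; lra. }
  intros t' Ht.
  assert (H1 : Rabs (t' - t) < d) by (eapply Rlt_le_trans; [exact Ht|apply Rmin_l]).
  assert (H2 : Rabs (t' - t) < eps / (Cmod v + 2)) by (eapply Rlt_le_trans; [exact Ht|apply Rmin_r]).
  specialize (A _ H1). replace (t + (t' - t)) with t' in A by ring.
  replace (u t' - u t)%C with ((u t' - u t - v * RtoC (t' - t)) + v * RtoC (t' - t))%C by ring.
  eapply Rle_lt_trans; [apply Cmod_triangle|]. rewrite Cmod_mult, Cmod_R.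
  apply Rmult_lt_compat_l with (r := Cmod v + 2) in H2; [|lra].
  replace ((Cmod v + 2) * (eps / (Cmod v + 2))) with eps in H2 by (field; lra).
  generalize (Rabs_pos (t' - t)). nra.
Qed.

Lemma rd_of_wd f (p e : C) t al be :
  wd f (p + RtoC t * e) al be ->
  rd (fun t => f (p + RtoC t * e)%C) t (al * e + be * Cconj e)%C.
Proof.
  intros H eps He. generalize (Cmod_ge_0 e); intros Hep.
  assert (Hq : 0 < eps / (Cmod e + 1)) by (apply Rdiv_lt_0_compat; lra).
  destruct (H _ Hq) as (d & Hd & A).
  exists (d / (Cmod e + 1)). split; [apply Rdiv_lt_0_compat; lra|].
  intros h Hh.
  assert (Hs : Cmod (RtoC h * e - 0) < d).
  { replace (RtoC h * e - 0)%C with (RtoC h * e)%C by ring.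
    rewrite Cmod_mult, Cmod_R.
    apply Rmult_lt_compat_r with (r := Cmod e + 1) in Hh; [|lra].
    replace (d / (Cmod e + 1) * (Cmod e + 1)) with d in Hh by (field; lra).
    generalize (Rabs_pos h). nra. }
  specialize (A _ Hs). rewrite Cmod_mult, Cmod_R, Cmult_conj in A.
  replace (p + RtoC (t + h) * e)%C with (p + RtoC t * e + RtoC h * e)%C
    by (rewrite RtoC_plus; ring).
  replace (Cconj (RtoC h)) with (RtoC h) in A by (apply C_ext; simpl; ring).
  replace (f (p + RtoC t * e + RtoC h * e) - f (p + RtoC t * e) - (al * e + be * Cconj e) * RtoC h)%C
    with (f (p + RtoC t * e + RtoC h * e) - f (p + RtoC t * e) - (al * (RtoC h * e) + be * (RtoC h * Cconj e)))%C by ring.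
  eapply Rle_trans; [exact A|].
  generalize (Rabs_pos h); intros.
  replace (eps * Rabs h) with (eps / (Cmod e + 1) * (Rabs h * (Cmod e + 1))) by (field; lra).
  apply Rmult_le_compat_l; [lra|]. nra.
Qed.

Lemma rd_re u t v c : rd u t v -> derivable_pt_lim (fun t => Re (c * u t)) t (Re (c * v)).
Proof.
  intros H eps He. generalize (Cmod_ge_0 c); intros Hc.
  assert (Hq : 0 < eps / (Cmod c + 1)) by (apply Rdiv_lt_0_compat; lra).
  destruct (H _ Hq) as (d & Hd & A).
  exists (mkposreal d Hd). intros h Hh Hs. simpl in Hs. specialize (A h Hs).
  assert (Hp : 0 < Rabs h) by now apply Rabs_pos_lt.
  replace ((Re (c * u (t + h)) - Re (c * u t)) / h - Re (c * v))
    with (Re (c * (u (t + h) - u t - v * RtoC h)) / h)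
    by (destruct c, (u (t+h)), (u t), v; simpl; field; auto).
  unfold Rdiv. rewrite Rabs_mult, Rabs_inv.
  apply Rmult_lt_reg_r with (Rabs h); auto.
  rewrite Rmult_assoc, Rinv_l, Rmult_1_r by lra.
  eapply Rle_lt_trans; [apply re_le_Cmod|]. rewrite Cmod_mult.
  assert (E : eps * Rabs h = (Cmod c + 1) * (eps / (Cmod c + 1) * Rabs h)) by (field; lra).
  rewrite E.
  assert (0 < eps / (Cmod c + 1) * Rabs h) by now apply Rmult_lt_0_compat.
  generalize (Cmod_ge_0 (u (t + h) - u t - v * RtoC h)). nra.
Qed.

Lemma rcont_re u t c : rcont u t -> continuity_pt (fun t => Re (c * u t)) t.
Proof.
  intros H eps He. generalize (Cmod_ge_0 c); intros Hc.
  assert (Hq : 0 < eps / (Cmod c + 1)) by (apply Rdiv_lt_0_compat; lra).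
  destruct (H _ Hq) as (d & Hd & A). exists d. split; [exact Hd|].
  intros x [_ Hx]. change (Rabs (x - t) < d) in Hx.
  change (Rabs (Re (c * u x) - Re (c * u t)) < eps).
  specialize (A x Hx).
  replace (Re (c * u x) - Re (c * u t)) with (Re (c * (u x - u t)))
    by (destruct c, (u x), (u t); simpl; ring).
  eapply Rle_lt_trans; [apply re_le_Cmod|]. rewrite Cmod_mult.
  apply Rmult_lt_compat_l with (r := Cmod c + 1) in A; [|lra].
  replace ((Cmod c + 1) * (eps / (Cmod c + 1))) with eps in A by (field; lra).
  generalize (Cmod_ge_0 (u x - u t)). nra.
Qed.

(** The direction dual to [z]: it turns the estimate of a modulus into that of a real part, to which
    the real mean value theorem applies. *)
Lemma unit_dir (z : C) : exists e : C, Cmod e = 1 /\ Re (e * z) = Cmod z.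
Proof.
  destruct (classic (z = 0)) as [E|E].
  - exists 1%C. rewrite E, Cmod_1, Cmod_0. split; simpl; ring.
  - exists (Cconj z / RtoC (Cmod z))%C.
    generalize (Cmod_pos z E); intros Hp.
    assert (Hn : RtoC (Cmod z) <> 0) by (intros X; apply RtoC_inj in X; lra).
    split.
    + rewrite Cmod_div, Cmod_conj, Cmod_R, Rabs_pos_eq by (auto; lra). field. lra.
    + replace (Cconj z / RtoC (Cmod z) * z)%C with (RtoC (Cmod z)).
      * reflexivity.
      * generalize (Cmod2_conj z). rewrite RtoC_pow. intros H.
        replace (Cconj z / RtoC (Cmod z) * z)%C with (z * Cconj z / RtoC (Cmod z))%C by (field; auto).
        rewrite <- H. field. auto.
Qed.

Lemma deriv_nonpos_le (phi : R -> R) s t :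
  s <= t ->
  (forall x, s <= x <= t -> continuity_pt phi x) ->
  (forall x, s < x < t -> exists l, derivable_pt_lim phi x l /\ l <= 0) ->
  phi t <= phi s.
Proof.
  intros Hst Hc Hd. destruct (Req_dec s t) as [->|N]; [lra|].
  assert (pr1 : forall c : R, s < c < t -> derivable_pt phi c).
  { intros c Hx. destruct (constructive_indefinite_description _ (Hd c Hx)) as (l & Hl & _).
    exists l. exact Hl. }
  destruct (MVT phi id s t pr1 (fun c _ => derivable_pt_id c)) as (c & P & E); auto; try lra.
  - intros. apply derivable_continuous, derivable_id.
  - rewrite derive_pt_id, Rmult_1_r in E. unfold id in E.
    destruct (Hd c P) as (l & Hl & Hn).
    rewrite (derive_pt_eq_0 _ _ _ (pr1 c P) Hl) in E. nra.
Qed.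

(** At the end points only continuity is asked, so the majorant may have an infinite derivative
    there, as a power x^p with p < 1 has at 0. *)
Lemma mvt_maj (u : R -> C) (m : R -> R) s t :
  s <= t ->
  (forall x, s <= x <= t -> rcont u x /\ continuity_pt m x) ->
  (forall x, s < x < t -> exists v m', rd u x v /\ derivable_pt_lim m x m' /\ Cmod v <= m') ->
  Cmod (u t - u s) <= m t - m s.
Proof.
  intros Hst Hc Hd.
  destruct (unit_dir (u t - u s)) as (e & He & Hr).
  assert (H : Re (e * u t) - m t <= Re (e * u s) - m s).
  { apply (deriv_nonpos_le (fun x => Re (e * u x) - m x)); auto.
    - intros x Hx. destruct (Hc x Hx).
      apply continuity_pt_minus; auto. now apply rcont_re.
    - intros x Hx. destruct (Hd x Hx) as (v & m' & Hv & Hm & Hl).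
      exists (Re (e * v) - m'). split.
      + apply derivable_pt_lim_minus; auto. now apply rd_re.
      + generalize (re_le_Cmod (e * v)). rewrite Cmod_mult, He, Rmult_1_l.
        generalize (Rle_abs (Re (e * v))). lra. }
  rewrite <- Hr.
  replace (Re (e * (u t - u s))) with (Re (e * u t) - Re (e * u s))
    by (destruct e, (u t), (u s); simpl; ring).
  lra.
Qed.

Lemma derivable_pt_lim_linear c x : derivable_pt_lim (fun x => c * x) x c.
Proof. apply is_derive_Reals. auto_derive; auto. ring. Qed.

(** The mean value inequality for f - c z, whose Wirtinger derivatives are al - c and be. *)
Lemma mvt_seg (f : C -> C) (a b c : C) kap :
  (forall x, 0 <= x <= 1 -> exists al be, wd f (a + RtoC x * (b - a)) al be /\
     Cmod (al - c) + Cmod be <= kap) ->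
  Cmod (f b - f a - c * (b - a)) <= kap * Cmod (b - a).
Proof.
  intros H.
  set (g := fun z => (f z - c * z)%C).
  assert (G : forall x, 0 <= x <= 1 -> exists v,
     rd (fun x => g (a + RtoC x * (b - a))%C) x v /\ Cmod v <= kap * Cmod (b - a)).
  { intros x Hx. destruct (H x Hx) as (al & be & Hw & Hk).
    eexists. split.
    - apply rd_of_wd. apply wd_minus; [exact Hw|]. apply wd_scal, wd_id.
    - eapply Rle_trans; [apply Cmod_triangle|]. rewrite !Cmod_mult, Cmod_conj.
      replace (al - c * 1)%C with (al - c)%C by ring.
      replace (be - c * 0)%C with be by ring.
      generalize (Cmod_ge_0 (b - a)). nra. }
  assert (M := mvt_maj (fun x => g (a + RtoC x * (b - a))%C)
                 (fun x => kap * Cmod (b - a) * x) 0 1 Rle_0_1).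
  simpl in M.
  replace (a + RtoC 1 * (b - a))%C with b in M by ring.
  replace (a + RtoC 0 * (b - a))%C with a in M by ring.
  unfold g in M at 1 2.
  replace (f b - f a - c * (b - a))%C with (f b - c * b - (f a - c * a))%C by ring.
  eapply Rle_trans; [apply M|lra].
  - intros x Hx. split.
    + destruct (G x Hx) as (v & Hv & _). eapply rd_rcont; eauto.
    + apply derivable_continuous_pt. exists (kap * Cmod (b - a)). apply derivable_pt_lim_linear.
  - intros x Hx. destruct (G x ltac:(lra)) as (v & Hv & Hk).
    exists v, (kap * Cmod (b - a)). repeat split; auto. apply derivable_pt_lim_linear.
Qed.

(** * Bolzano-Weierstrass and a quantitative open mapping lemma *)

(** The condition [n <= phi n] replaces strict monotonicity of the index map: it suffices for
    inheriting limits and composes well. The explicit rate lets real and imaginary parts be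
    extracted one after the other in [bw]. *)
Lemma bw_real (x : nat -> R) M : (forall n, Rabs (x n) <= M) ->
  exists (phi : nat -> nat) l, (forall n, (n <= phi n)%nat) /\
    forall n, Rabs (x (phi n) - l) < / (INR n + 1).
Proof.
  intros H.
  destruct (Bolzano_Weierstrass x (fun t => -M <= t <= M) (compact_P3 (-M) M)) as (l & Hl).
  { intros n. apply Rabs_le_between. apply H. }
  assert (A : forall n, exists m, (n <= m)%nat /\ Rabs (x m - l) < / (INR n + 1)).
  { intros n. assert (Hp : 0 < / (INR n + 1)) by (apply Rinv_0_lt_compat; generalize (pos_INR n); lra).
    destruct (Hl (disc l (mkposreal _ Hp)) n) as (p & Hp1 & Hp2).
    - exists (mkposreal _ Hp). intros y Hy. exact Hy.
    - exists p. split; auto. }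
  destruct (choice _ A) as (phi & Hphi).
  exists phi, l. split; intros n; apply Hphi.
Qed.

Lemma inv_INR_small e : 0 < e -> exists N, forall n, (N <= n)%nat -> / (INR n + 1) < e.
Proof.
  intros He. destruct (archimed_cor1 e He) as (N & HN & Hp). exists N. intros n Hn.
  eapply Rle_lt_trans; [|exact HN]. apply Rinv_le_contravar.
  - now apply lt_0_INR.
  - generalize (le_INR _ _ Hn). lra.
Qed.

Lemma bw (u : nat -> C) M : (forall n, Cmod (u n) <= M) ->
  exists (phi : nat -> nat) z, (forall n, (n <= phi n)%nat) /\
    limC eventually (fun n => u (phi n)) z.
Proof.
  intros H.
  destruct (bw_real (fun n => Re (u n)) M) as (f & x & Hf & Hx).
  { intros n. eapply Rle_trans; [apply re_le_Cmod|apply H]. }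
  destruct (bw_real (fun n => Im (u (f n))) M) as (g & y & Hg & Hy).
  { intros n. eapply Rle_trans; [apply im_le_Cmod|apply H]. }
  exists (fun n => f (g n)), (x, y). split.
  { intros n. etransitivity; [apply Hg|apply Hf]. }
  intros e He. destruct (inv_INR_small (e / 2) (half_pos _ He)) as (N & HN).
  exists N. intros n Hn. eapply Rle_lt_trans; [apply Cmod_le_re_im|].
  generalize (Hx (g n)) (Hy n) (HN n Hn) (HN (g n) (Nat.le_trans _ _ _ Hn (Hg n))).
  destruct (u (f (g n))); simpl. unfold Rminus. lra.
Qed.

Lemma limC_subseq (u : nat -> C) l (phi : nat -> nat) :
  (forall n, (n <= phi n)%nat) -> limC eventually u l -> limC eventually (fun n => u (phi n)) l.
Proof.
  intros Hp H e He. destruct (H e He) as (N & HN). exists N. intros n Hn.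
  apply HN. etransitivity; [exact Hn|apply Hp].
Qed.

(** [f] differs from the linear map A z by a map of Lipschitz constant kap |A|, so a Newton
    iteration with frozen derivative contracts by kap. Its steps are at most kap^n (1 - kap) r, and
    their sum keeps the iterates in the ball. *)
Lemma solve_ball (f : C -> C) (c A p : C) r kap :
  0 <= kap < 1 -> A <> 0 ->
  (forall z w, Cmod (z - c) <= r -> Cmod (w - c) <= r ->
     Cmod (f z - f w - A * (z - w)) <= kap * Cmod A * Cmod (z - w)) ->
  Cmod (p - f c) <= (1 - kap) * Cmod A * r ->
  exists z, Cmod (z - c) <= r /\ f z = p.
Proof.
  intros Hk HA Hf Hp. generalize (Cmod_pos A HA). intros HAp.
  set (it := fix it n := match n with O => c | S m => (it m + (p - f (it m)) / A)%C end).
  assert (E : forall n, Cmod (p - f (it n)) = Cmod A * Cmod (it (S n) - it n)).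
  { intros n. rewrite <- Cmod_mult. f_equal. simpl. field. auto. }
  assert (Hr : 0 <= r).
  { generalize (Cmod_ge_0 (p - f c)). intros. 
    assert (0 < (1 - kap) * Cmod A) by (apply Rmult_lt_0_compat; lra). nra. }
  assert (B : forall n, Cmod (it n - c) <= (1 - kap ^ n) * r /\
                        Cmod (it (S n) - it n) <= kap ^ n * (1 - kap) * r).
  { induction n as [|n [IH1 IH2]].
    - split.
      + change (it O) with c. replace (c - c)%C with (RtoC 0) by ring. rewrite Cmod_0. simpl. lra.
      + apply Rmult_le_reg_l with (Cmod A); auto. rewrite <- E.
        change (it O) with c. simpl. lra.
    - assert (H1 : Cmod (it (S n) - c) <= (1 - kap ^ S n) * r).
      { eapply Rle_trans; [apply (Cmod_tri3 _ (it n))|]. simpl pow. lra. }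
      assert (0 <= kap ^ n <= 1) by (split; [apply pow_le; lra|rewrite <- (pow1 n); apply pow_incr; lra]).
      split; auto.
      apply Rmult_le_reg_l with (Cmod A); auto. rewrite <- E.
      replace (p - f (it (S n)))%C with (- (f (it (S n)) - f (it n) - A * (it (S n) - it n)))%C
        by (simpl; field; auto).
      rewrite Cmod_opp.
      eapply Rle_trans; [apply Hf|].
      + eapply Rle_trans; [exact H1|]. simpl pow.
        assert (0 <= kap * kap ^ n) by (apply Rmult_le_pos; lra). nra.
      + eapply Rle_trans; [exact IH1|]. nra.
      + simpl pow. apply Rle_trans with (kap * Cmod A * (kap ^ n * (1 - kap) * r)); [|right; ring].
        apply Rmult_le_compat_l; [apply Rmult_le_pos; lra|exact IH2]. }
  assert (Bd : forall n, Cmod (it n - c) <= r).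
  { intros n. destruct (B n) as [H1 _].
    assert (0 <= kap ^ n) by (apply pow_le; lra). nra. }
  (* A cluster point of the iterates is enough: by [E] and [B] the error p - f (it n) tends to 0,
     and [f] is Lipschitz on the ball. *)
  destruct (bw it (Cmod c + r)) as (phi & z & Hphi & Hz).
  { intros n. generalize (Cmod_rev (it n) c) (Bd n). lra. }
  exists z. assert (Hzc : Cmod (z - c) <= r).
  { apply (limC_le (F := eventually) (fun n => it (phi n))); auto.
    exists O. intros; apply Bd. }
  split; auto.
  apply Cmod_eps. intros e He.
  destruct (Hz (e / (4 * Cmod A))) as (N1 & HN1); [apply Rdiv_lt_0_compat; lra|].
  assert (Hlim : exists N2, forall n, (N2 <= n)%nat -> kap ^ n * r * Cmod A < e / 2).
  { destruct (Req_dec kap 0) as [K0|K0].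
    - exists 1%nat. intros n Hn. rewrite K0, pow_i by lia. lra.
    - assert (Hk1 : Rabs kap < 1) by (rewrite Rabs_pos_eq; lra).
      destruct (pow_lt_1_zero kap Hk1 (e / 2 / (r * Cmod A + 1))) as (N & HN).
      { apply Rdiv_lt_0_compat; [lra|]. nra. }
      exists N. intros n Hn. specialize (HN n Hn).
      rewrite Rabs_pos_eq in HN by (apply pow_le; lra).
      apply Rmult_lt_compat_r with (r := r * Cmod A + 1) in HN; [|nra].
      replace (e / 2 / (r * Cmod A + 1) * (r * Cmod A + 1)) with (e / 2) in HN by (field; nra).
      assert (0 <= kap ^ n) by (apply pow_le; lra). nra. }
  destruct Hlim as (N2 & HN2).
  set (n := phi (N1 + N2)%nat).
  assert (A1' : Cmod (it n - z) < e / (4 * Cmod A)) by (apply HN1; lia).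
  assert (A2' : kap ^ n * r * Cmod A < e / 2) by (apply HN2; generalize (Hphi (N1 + N2)%nat); unfold n; lia).
  destruct (B n) as [_ B2].
  assert (E1 : Cmod (p - f (it n)) < e / 2).
  { rewrite E. assert (0 <= kap ^ n) by (apply pow_le; lra).
    assert (0 <= kap ^ n * kap * r) by (repeat apply Rmult_le_pos; lra).
    apply Rle_lt_trans with (Cmod A * (kap ^ n * (1 - kap) * r)); [apply Rmult_le_compat_l; lra|].
    nra. }
  assert (E2 : Cmod (f z - f (it n)) <= e / 2).
  { replace (f z - f (it n))%C with ((f z - f (it n) - A * (z - it n)) + A * (z - it n))%C by ring.
    eapply Rle_trans; [apply Cmod_triangle|].
    specialize (Hf z (it n) Hzc (Bd n)). rewrite Cmod_mult. rewrite (Cmod_sub_sym z (it n)) in *.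
    apply Rmult_lt_compat_l with (r := Cmod A) in A1'; auto.
    replace (Cmod A * (e / (4 * Cmod A))) with (e / 4) in A1' by (field; lra).
    assert (P : 0 <= Cmod A * Cmod (it n - z)) by (apply Rmult_le_pos; [lra|apply Cmod_ge_0]).
    assert (kap * (Cmod A * Cmod (it n - z)) <= 1 * (Cmod A * Cmod (it n - z)))
      by (apply Rmult_le_compat_r; lra).
    rewrite Rmult_assoc in Hf. lra. }
  replace (f z - p)%C with ((f z - f (it n)) - (p - f (it n)))%C by ring.
  unfold Cminus at 1. eapply Rle_trans; [apply Cmod_triangle|]. rewrite Cmod_opp. lra.
Qed.

(** * Complex exponential and logarithm *)

Definition cexp (z : C) : C := (exp (Re z) * cos (Im z), exp (Re z) * sin (Im z)).

Lemma cexp_plus z w : cexp (z + w) = (cexp z * cexp w)%C.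
Proof.
  destruct z as [x y], w as [x' y']. unfold cexp; simpl.
  rewrite exp_plus, cos_plus, sin_plus. apply C_ext; simpl; ring.
Qed.

Lemma cexp_0 : cexp 0 = 1%C.
Proof. unfold cexp; simpl. rewrite exp_0, cos_0, sin_0. apply C_ext; simpl; ring. Qed.

Lemma Cmod_cexp z : Cmod (cexp z) = exp (Re z).
Proof.
  unfold cexp, Cmod; simpl.
  replace (_ + _) with (exp (Re z) * exp (Re z) * (Rsqr (sin (Im z)) + Rsqr (cos (Im z))))
    by (unfold Rsqr; ring).
  rewrite sin2_cos2, Rmult_1_r. apply sqrt_square. left; apply exp_pos.
Qed.

Lemma cexp_nz z : cexp z <> 0.
Proof. intros E. generalize (Cmod_cexp z) (exp_pos (Re z)). rewrite E, Cmod_0. lra. Qed.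

Lemma cexp_opp z : cexp (- z) = (/ cexp z)%C.
Proof.
  assert (H : (cexp (- z) * cexp z)%C = 1%C).
  { rewrite <- cexp_plus, <- cexp_0. f_equal. ring. }
  replace (/ cexp z)%C with (cexp (- z) * cexp z * / cexp z)%C by (rewrite H; ring).
  field. apply cexp_nz.
Qed.

Lemma cexp_minus z w : cexp (z - w) = (cexp z / cexp w)%C.
Proof. unfold Cminus. now rewrite cexp_plus, cexp_opp. Qed.

Lemma cexp_real (r : R) : cexp r = RtoC (exp r).
Proof. unfold cexp; simpl. rewrite cos_0, sin_0. apply C_ext; simpl; ring. Qed.

Definition turn (n : Z) : C := (0, 2 * PI * IZR n).

Lemma cexp_eq_1 z : cexp z = 1%C -> exists n : Z, z = turn n.
Proof.
  intros H.
  assert (Hr : Re z = 0).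
  { generalize (Cmod_cexp z). rewrite H, Cmod_1. intros E.
    apply exp_inv. now rewrite exp_0. }
  assert (Hc : cos (Im z) = 1).
  { apply (f_equal Re) in H. unfold cexp in H. simpl in H. rewrite Hr, exp_0 in H. lra. }
  assert (Hs : sin (Im z / 2) = 0).
  { replace (Im z) with (2 * (Im z / 2)) in Hc by field.
    rewrite cos_2a_sin in Hc. nra. }
  destruct (sin_eq_0_0 _ Hs) as (n & Hn). exists n.
  apply C_ext; simpl; lra.
Qed.

Lemma cexp_period (n : Z) : cexp (turn n) = 1%C.
Proof.
  unfold cexp; simpl. rewrite exp_0.
  assert (Hs : sin (IZR n * PI) = 0) by (apply sin_eq_0_1; now exists n).
  replace (2 * PI * IZR n) with (2 * (IZR n * PI)) by ring.
  rewrite cos_2a_sin, sin_2a, Hs. apply C_ext; simpl; ring.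
Qed.

Lemma cexp_inj_mod z w : cexp z = cexp w -> exists n : Z, z = (w + turn n)%C.
Proof.
  intros H. destruct (cexp_eq_1 (z - w)) as (n & Hn).
  { rewrite cexp_minus, H. field. apply cexp_nz. }
  exists n. rewrite <- Hn. ring.
Qed.

Lemma cexp_inj_small z w : cexp z = cexp w -> Rabs (Im (z - w)) < 2 * PI -> z = w.
Proof.
  intros H Hi. destruct (cexp_inj_mod z w H) as (n & Hn).
  replace (z - w)%C with (turn n) in Hi by (rewrite Hn; ring).
  simpl in Hi. generalize PI_RGT_0; intros Hpi.
  rewrite Rabs_mult, (Rabs_pos_eq (2 * PI)) in Hi by lra.
  assert (Hn1 : Rabs (IZR n) < 1) by nra.
  rewrite <- abs_IZR in Hn1. apply lt_IZR in Hn1. assert (n = 0%Z) by lia. subst n.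
  rewrite Hn. destruct w; apply C_ext; simpl; ring.
Qed.

Lemma wd_cexp p : wd cexp p (cexp p) 0.
Proof.
  assert (Him : wd (fun z => - Ci * z)%C p (- Ci * 1)%C (- Ci * 0)%C) by apply wd_scal, wd_id.
  assert (H1 := wd_RtoC_Re exp p _ (derivable_pt_lim_exp (Re p))).
  assert (H2 := wd_comp _ _ _ _ _ _ _ Him (wd_RtoC_Re cos _ _ (derivable_pt_lim_cos _))).
  assert (H3 := wd_comp _ _ _ _ _ _ _ Him (wd_RtoC_Re sin _ _ (derivable_pt_lim_sin _))).
  assert (H := wd_mult _ _ _ _ _ _ _ H1 (wd_plus _ _ _ _ _ _ _ H2 (wd_scal Ci _ _ _ _ H3))).
  eapply wd_ext; [|eapply wd_eq; [| |exact H]].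
  - apply filter_forall. intros [x y]. unfold cexp. cbn.
    replace (- 0 * x - - (1) * y) with y by ring. apply C_ext; cbn; ring.
  - destruct p as [x y]. unfold cexp. cbn.
    replace (- 0 * x - - (1) * y) with y by ring. apply C_ext; cbn; field.
  - destruct p as [x y]. unfold cexp. cbn.
    replace (- 0 * x - - (1) * y) with y by ring. apply C_ext; cbn; field.
Qed.

Lemma wd_cexpf f p al be : wd f p al be ->
  wd (fun z => cexp (f z)) p (cexp (f p) * al)%C (cexp (f p) * be)%C.
Proof. intros H. apply wd_comp_hol; auto. apply wd_cexp. Qed.

(** A continuous logarithm inherits differentiability. The increment [d h] of [f] is small by
    continuity, so |cexp d - 1 - d| <= |d| / 2, and |d| is at most twice the relative increment
    [G h] of [g]. Hence d = O(h), and the remainder cexp d - 1 - d is o(h). *)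
Lemma wd_lift_exp f g p al be :
  ccont f p -> nb p (fun z => cexp (f z) = g z) -> wd g p al be ->
  wd f p (al / g p)%C (be / g p)%C.
Proof.
  intros Hf Hfg Hg.
  assert (Hgp : cexp (f p) = g p) by (apply (nb_self p _ Hfg)).
  assert (Hgn : g p <> 0) by (rewrite <- Hgp; apply cexp_nz).
  set (d := fun h => (f (p + h) - f p)%C).
  assert (R0 : lo (fun h => cexp h - 1 - h)%C).
  { eapply lo_ext; [|apply (wd_cexp 0)]. apply filter_forall. intros h. cbv beta.
    rewrite cexp_0. replace (0 + h)%C with h by ring. ring. }
  set (G := fun h => ((g (p + h) - g p) / g p)%C).
  assert (EG : nb 0 (fun h => G h = d h + (cexp (d h) - 1 - d h))%C).
  { generalize (proj1 (nb_shift p _) Hfg). apply filter_imp. intros h Hh.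
    unfold G, d. rewrite cexp_minus, Hh, Hgp. field. auto. }
  assert (BG : bo G).
  { destruct (wd_bo _ _ _ _ Hg) as (K & HK & B).
    generalize (Cmod_pos _ Hgn); intros Hp.
    exists (K / Cmod (g p)). split; [now apply Rdiv_lt_0_compat|].
    generalize B. apply filter_imp. intros h Hh. unfold G.
    rewrite Cmod_div by auto. replace (K / Cmod (g p) * Cmod h) with (K * Cmod h / Cmod (g p)) by (field; lra).
    apply Rmult_le_compat_r; auto. left. now apply Rinv_0_lt_compat. }
  assert (Bd : bo d).
  { destruct BG as (K & HK & B). exists (2 * K). split; [lra|].
    destruct (R0 (1/2)) as (e & He & HR); [lra|].
    assert (Hd : nb 0 (fun h => Cmod (d h - 0) < e)).
    { generalize (proj1 (nb_shift p _) (Hf e He)). apply filter_imp. intros h.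
      unfold d. now replace (f (p + h) - f p - 0)%C with (f (p + h) - f p)%C by ring. }
    generalize (filter_and _ _ Hd (filter_and _ _ B EG)). apply filter_imp.
    intros h (A1' & A2' & A3'). specialize (HR _ A1').
    replace (d h) with (G h - (cexp (d h) - 1 - d h))%C by (rewrite A3'; ring).
    unfold Cminus at 1. eapply Rle_trans; [apply Cmod_triangle|]. rewrite Cmod_opp.
    generalize (Cmod_rev (d h) (- (cexp (d h) - 1 - d h))%C). rewrite Cmod_opp.
    replace (d h - - (cexp (d h) - 1 - d h))%C with (G h) by (rewrite A3'; ring).
    lra. }
  eapply lo_ext; [|apply (lo_plus _ _ (lo_scal (/ g p) _ Hg) (lo_scal (-(1)) _ (lo_comp _ _ R0 Bd)))].
  generalize EG. apply filter_imp. intros h Hh.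
  assert (E : d h = (G h - (cexp (d h) - 1 - d h))%C) by (rewrite Hh; ring).
  change (f (p + h) - f p)%C with (d h).
  rewrite E at 3. unfold G. field. auto.
Qed.

Lemma limC_re {T : Type} {F : (T -> Prop) -> Prop} {FF : Filter F} (f : T -> C) l :
  limC F f l -> limC F (fun x => RtoC (Re (f x))) (RtoC (Re l)).
Proof.
  intros H e He. generalize (H e He). apply filter_imp. intros x Hx.
  rewrite <- RtoC_minus, Cmod_R. eapply Rle_lt_trans; [|exact Hx].
  replace (Re (f x) - Re l) with (Re (f x - l)) by (destruct (f x), l; simpl; ring).
  apply re_le_Cmod.
Qed.

Lemma limC_im {T : Type} {F : (T -> Prop) -> Prop} {FF : Filter F} (f : T -> C) l :
  limC F f l -> limC F (fun x => RtoC (Im (f x))) (RtoC (Im l)).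
Proof.
  intros H e He. generalize (H e He). apply filter_imp. intros x Hx.
  rewrite <- RtoC_minus, Cmod_R. eapply Rle_lt_trans; [|exact Hx].
  replace (Im (f x) - Im l) with (Im (f x - l)) by (destruct (f x), l; simpl; ring).
  apply im_le_Cmod.
Qed.

Lemma limC_Cmod {T : Type} {F : (T -> Prop) -> Prop} {FF : Filter F} (f : T -> C) l :
  limC F f l -> limC F (fun x => RtoC (Cmod (f x))) (RtoC (Cmod l)).
Proof.
  intros H e He. generalize (H e He). apply filter_imp. intros x Hx.
  rewrite <- RtoC_minus, Cmod_R. eapply Rle_lt_trans; [|exact Hx].
  apply Rabs_le. generalize (Cmod_rev (f x) l) (Cmod_rev l (f x)).
  rewrite (Cmod_sub_sym l (f x)). lra.
Qed.

Lemma limC_real {T : Type} {F : (T -> Prop) -> Prop} {FF : Filter F} (f : T -> R) l (phi : R -> R) :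
  limC F (fun x => RtoC (f x)) (RtoC l) -> continuity_pt phi l ->
  limC F (fun x => RtoC (phi (f x))) (RtoC (phi l)).
Proof.
  intros H Hc e He. destruct (Hc e He) as (d & Hd & A).
  generalize (H d Hd). apply filter_imp. intros x Hx.
  rewrite <- RtoC_minus, Cmod_R in *.
  destruct (Req_dec (f x) l) as [->|N].
  - unfold Rminus. rewrite Rplus_opp_r, Rabs_R0. exact He.
  - apply (A (f x)). split; [split; [exact I|auto]|exact Hx].
Qed.

Definition slit (z : C) : Prop := 0 < Re z \/ Im z <> 0.
(** The half-angle formula gives the principal argument by one expression on the whole slit plane,
    so continuity needs no cases. *)
Definition Clog (z : C) : C := (ln (Cmod z), 2 * atan (Im z / (Cmod z + Re z))).

Lemma slit_pos z : slit z -> 0 < Cmod z + Re z.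
Proof.
  intros H. generalize (Cmod_ge_0 z) (re_le_Cmod z) (Cmod_sq z). intros H0 H1 H2.
  destruct H as [H|H]; [lra|].
  destruct (Rlt_le_dec 0 (Cmod z + Re z)) as [|N]; auto. exfalso.
  assert (E : Cmod z = - Re z).
  { generalize (Rle_abs (- Re z)). rewrite Rabs_Ropp. lra. }
  rewrite E in H2. assert (0 < Im z * Im z) by nra. nra.
Qed.

Lemma slit_nz z : slit z -> z <> 0.
Proof. intros [H|H] E; subst; simpl in H; lra. Qed.

Lemma Clog_exp z : slit z -> cexp (Clog z) = z.
Proof.
  intros H. assert (Hp := slit_pos z H). assert (Hm := Cmod_pos z (slit_nz z H)).
  assert (Hs := Cmod_sq z).
  unfold cexp, Clog; simpl. rewrite exp_ln by auto.
  set (t := Im z / (Cmod z + Re z)).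
  assert (Ht : 0 < 1 + Rsqr t) by (unfold Rsqr; nra).
  rewrite cos_2a_cos, sin_2a, cos_atan, sin_atan.
  assert (Hq : sqrt (1 + Rsqr t) * sqrt (1 + Rsqr t) = 1 + Rsqr t) by (apply sqrt_sqrt; lra).
  revert Hq. generalize (sqrt (1 + Rsqr t)) as q. intros q Hq.
  assert (Hq0 : q <> 0) by (intros E; rewrite E in Hq; lra).
  assert (E1 : 2 * (1 / q) * (1 / q) - 1 = 2 / (1 + Rsqr t) - 1).
  { rewrite <- Hq. field. auto. }
  assert (E2 : 2 * (t / q) * (1 / q) = 2 * t / (1 + Rsqr t)).
  { rewrite <- Hq. field. auto. }
  rewrite E1, E2.
  assert (E3 : 1 + Rsqr t = 2 * Cmod z / (Cmod z + Re z)).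
  { unfold t, Rsqr.
    assert (Hi : Im z * Im z = (Cmod z - Re z) * (Cmod z + Re z)) by nra.
    replace (Im z / (Cmod z + Re z) * (Im z / (Cmod z + Re z))) with (Im z * Im z / ((Cmod z + Re z) * (Cmod z + Re z))) by (field; lra).
    rewrite Hi. field. lra. }
  rewrite E3. unfold t. apply C_ext; simpl; field; lra.
Qed.

Lemma Clog_Im z : Rabs (Im (Clog z)) < PI.
Proof.
  simpl. generalize (atan_bound (Im z / (Cmod z + Re z))). intros.
  apply Rabs_def1; lra.
Qed.

Lemma ccont_Clog z : slit z -> ccont Clog z.
Proof.
  intros H. assert (Hp := slit_pos z H). assert (Hm := Cmod_pos z (slit_nz z H)).
  assert (I := ccont_id z). unfold ccont in I.
  assert (HR : (RtoC (Cmod z) + RtoC (Re z))%C <> 0).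
  { rewrite <- RtoC_plus. intros E. apply RtoC_inj in E. lra. }
  assert (A1' : limC (nb z) (fun w => RtoC (ln (Cmod w))) (RtoC (ln (Cmod z)))).
  { apply (limC_real Cmod _ ln); [now apply (limC_Cmod (fun w => w))|].
    apply derivable_continuous_pt. exists (/ Cmod z). now apply derivable_pt_lim_ln. }
  assert (A2' : limC (nb z) (fun w => RtoC (Im w / (Cmod w + Re w))) (RtoC (Im z / (Cmod z + Re z)))).
  { rewrite RtoC_div, RtoC_plus by lra.
    assert (A := limC_plus _ _ _ _ (limC_Cmod _ _ I) (limC_re _ _ I)).
    eapply limC_ext; [|exact (limC_div _ _ _ _ (limC_im _ _ I) A HR)].
    generalize (limC_away _ _ A HR). apply filter_imp. intros w Hw.
    rewrite RtoC_div, RtoC_plus; auto. intros E.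
    rewrite <- (RtoC_plus (Cmod w)), E, Cmod_0 in Hw.
    generalize (Cmod_ge_0 (RtoC (Cmod z) + RtoC (Re z))). lra. }
  assert (A3' : limC (nb z) (fun w => RtoC (atan (Im w / (Cmod w + Re w)))) (RtoC (atan (Im z / (Cmod z + Re z))))).
  { apply (limC_real _ _ atan A2').
    apply derivable_continuous_pt. eexists. apply derivable_pt_lim_atan. }
  unfold ccont. eapply limC_ext; [|replace (Clog z) with (RtoC (ln (Cmod z)) + Ci * (RtoC 2 * RtoC (atan (Im z / (Cmod z + Re z)))))%C].
  2: exact (limC_plus _ _ _ _ A1' (limC_mult _ _ _ _ (limC_const Ci) (limC_mult _ _ _ _ (limC_const (RtoC 2)) A3'))).
  - apply filter_forall. intros w. apply C_ext; simpl; ring.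
  - apply C_ext; simpl; ring.
Qed.

Lemma nb_slit z : slit z -> nb z slit.
Proof.
  intros [H|H].
  - generalize (nb_re_gt z 0 H). apply filter_imp. left; auto.
  - exists (Rabs (Im z)). split; [now apply Rabs_pos_lt|]. intros w Hw. right. intros E.
    generalize (im_le_Cmod (w - z)). 
    replace (Im (w - z)) with (- Im z) by (destruct w, z; simpl in *; subst; ring).
    rewrite Rabs_Ropp. lra.
Qed.

Lemma wd_Clog z : slit z -> wd Clog z (/ z)%C 0.
Proof.
  intros H. assert (Hz := slit_nz z H).
  eapply wd_eq; [| |apply (wd_lift_exp Clog (fun z => z) z 1 0)].
  - field; auto.
  - field; auto.
  - now apply ccont_Clog.
  - generalize (nb_slit z H). apply filter_imp. intros; now apply Clog_exp.
  - apply wd_id.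
Qed.

Lemma slit_1 : slit 1.
Proof. left; simpl; lra. Qed.

Lemma Clog_1 : Clog 1 = 0.
Proof.
  apply cexp_inj_small.
  - now rewrite Clog_exp, cexp_0 by apply slit_1.
  - replace (Clog 1 - 0)%C with (Clog 1) by ring.
    generalize (Clog_Im 1) PI_RGT_0. lra.
Qed.

Lemma wd_Clogf f p al be : wd f p al be -> slit (f p) ->
  wd (fun z => Clog (f z)) p (al / f p)%C (be / f p)%C.
Proof.
  intros H Hs. eapply wd_eq; [| |apply (wd_comp_hol f _ p al be _ H (wd_Clog _ Hs))];
  field; now apply slit_nz.
Qed.

Lemma Clog_near_1 : exists r, 0 < r <= 1 / 2 /\ forall z, Cmod (z - 1) < r ->
  slit z /\ Cmod (Clog z) <= 2 * Cmod (z - 1).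
Proof.
  assert (B : nb 1 (fun z => Cmod (Clog z) <= 2 * Cmod (z - 1))).
  { apply nb_shift. generalize (wd_Clog 1 slit_1 1 Rlt_0_1). apply filter_imp.
    intros h. rewrite Clog_1. replace (1 + h - 1)%C with h by ring. intros Hh.
    replace (Clog (1 + h)) with ((Clog (1 + h) - 0 - (/ 1 * h + 0 * Cconj h)) + h)%C by field.
    eapply Rle_trans; [apply Cmod_triangle|]. lra. }
  destruct (filter_and _ _ (nb_slit 1 slit_1) B) as (d & Hd & A).
  exists (Rmin d (1/2)). split; [split; [apply Rmin_pos; lra|apply Rmin_r]|].
  intros z Hz. apply A. eapply Rlt_le_trans; [exact Hz|apply Rmin_l].
Qed.

Lemma cexp_surj (z : C) : z <> 0 -> exists Z, cexp Z = z.
Proof.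
  intros Hz. destruct (classic (slit z)) as [H|H].
  - exists (Clog z). now apply Clog_exp.
  - assert (Hs : slit (- z)).
    { unfold slit in *. apply not_or_and in H. destruct H as [H1 H2].
      apply NNPP in H2. left. destruct z as [x y]; simpl in *.
      destruct (Req_dec x 0) as [E|N]; [|lra]. exfalso; apply Hz. subst. reflexivity. }
    set (p := (0, PI) : C). exists (Clog (- z) + p)%C. rewrite cexp_plus, Clog_exp by auto.
    unfold cexp, p; simpl. rewrite exp_0, cos_PI, sin_PI. destruct z; apply C_ext; simpl; ring.
Qed.

(** * Level curves of functions with prescribed ratio of derivatives *)

Definition nb2 (p : C) (t : R) (P : C * R -> Prop) : Prop :=
  exists d, 0 < d /\ forall z u, Cmod (z - p) < d -> Rabs (u - t) < d -> P (z, u).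

Global Instance nb2_filter p t : ProperFilter (nb2 p t).
Proof.
  constructor.
  - intros P (d & Hd & H). exists (p, t). apply H.
    + replace (p - p)%C with (RtoC 0) by ring. now rewrite Cmod_0.
    + unfold Rminus. now rewrite Rplus_opp_r, Rabs_R0.
  - constructor.
    + exists 1. split; [lra|auto].
    + intros P Q (d & Hd & H) (d' & Hd' & H'). exists (Rmin d d'). split.
      * now apply Rmin_pos.
      * intros z u Hz Hu. split; [apply H|apply H']; eapply Rlt_le_trans; eauto using Rmin_l, Rmin_r.
    + intros P Q HI (d & Hd & H). exists d. auto.
Qed.

Lemma nb2_fst p t (P : C -> Prop) : nb p P -> nb2 p t (fun x => P (fst x)).
Proof. intros (d & Hd & H). exists d. split; auto. Qed.

Lemma limC_fst p t : limC (nb2 p t) fst p.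
Proof. intros e He. exists e. auto. Qed.

Lemma limC_snd p t : limC (nb2 p t) (fun x => RtoC (snd x)) (RtoC t).
Proof.
  intros e He. exists e. split; auto. intros z u _ Hu. simpl.
  now rewrite <- RtoC_minus, Cmod_R.
Qed.

Lemma seg_ball (p z w : C) r x :
  0 <= x <= 1 -> Cmod (z - p) < r -> Cmod (w - p) < r -> Cmod (z + RtoC x * (w - z) - p) < r.
Proof.
  intros Hx Hz Hw.
  replace (z + RtoC x * (w - z) - p)%C with (RtoC (1 - x) * (z - p) + RtoC x * (w - p))%C
    by (rewrite RtoC_minus; ring).
  eapply Rle_lt_trans; [apply Cmod_triangle|].
  rewrite !Cmod_mult, !Cmod_R, !Rabs_pos_eq by lra.
  destruct (Req_dec x 0) as [->|N]; [lra|]. nra.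
Qed.

Lemma rd_lip (u : R -> C) (c : C) K s t :
  (forall x, Rmin s t <= x <= Rmax s t -> exists v, rd u x v /\ Cmod (v - c) <= K) ->
  Cmod (u t - u s - c * RtoC (t - s)) <= K * Rabs (t - s).
Proof.
  assert (Main : forall s t, s <= t ->
    (forall x, s <= x <= t -> exists v, rd u x v /\ Cmod (v - c) <= K) ->
    Cmod (u t - u s - c * RtoC (t - s)) <= K * (t - s)).
  { clear s t. intros s t Hst H.
    assert (D : forall x v, rd u x v -> rd (fun x => u x - c * RtoC x)%C x (v - c)%C).
    { intros x v Hv e He. destruct (Hv e He) as (d & Hd & A). exists d. split; auto.
      intros h Hh. rewrite RtoC_plus.
      replace (u (x + h)%R - c * (x + h) - (u x - c * x) - (v - c) * h)%C
        with (u (x + h)%R - u x - v * h)%C by ring. auto. }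
    replace (u t - u s - c * RtoC (t - s))%C with (u t - c * t - (u s - c * s))%C
      by (rewrite RtoC_minus; ring).
    replace (K * (t - s)) with (K * t - K * s) by ring.
    apply (mvt_maj (fun x => u x - c * RtoC x)%C (fun x => K * x)); auto.
    - intros x Hx. destruct (H x Hx) as (v & Hv & _). split.
      + eapply rd_rcont; eauto.
      + apply derivable_continuous_pt. exists K. apply derivable_pt_lim_linear.
    - intros x Hx. destruct (H x) as (v & Hv & HK); [lra|].
      exists (v - c)%C, K. repeat split; auto. apply derivable_pt_lim_linear. }
  intros H. destruct (Rle_dec s t) as [L|L].
  - rewrite Rabs_pos_eq by lra. apply Main; auto.
    intros x Hx. apply H. now rewrite Rmin_left, Rmax_right.
  - replace (u t - u s - c * RtoC (t - s))%C with (- (u s - u t - c * RtoC (s - t)))%C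
      by (rewrite !RtoC_minus; ring).
    rewrite Cmod_opp, <- Rabs_Ropp, Rabs_pos_eq by lra.
    replace (- (t - s)) with (s - t) by ring. apply Main; [lra|].
    intros x Hx. apply H. rewrite Rmin_right, Rmax_left; lra.
Qed.

(* Solutions of [H w t = const] move with velocity [2 a / (1 - x)], which has real part
   greater than [a] because [|x| < 1]. *)
Definition normal (a k : R) (H A : C -> R -> C) (p : C) (t : R) : Prop :=
  A p t <> 0 /\ limC (nb2 p t) (fun y => A (fst y) (snd y)) (A p t) /\
  nb2 p t (fun y =>
    (exists x : C, wd (fun W => H W (snd y)) (fst y) (A (fst y) (snd y) * (1 - x))%C 0 /\
       Cmod x <= (3 * k + 1) / 4) /\
    rd (H (fst y)) (snd y) (- (2 * a)%R * A (fst y) (snd y))%C).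

(** The finite form of the velocity 2a / (1 - x): it says d (1 - x) = 2 a tau for some x with |x| <=
    (1 + k) / 2. The bounds k, (3k + 1) / 4 and (1 + k) / 2 on x belong to a point of the region, to
    a neighbourhood of it and to a finite displacement. *)
Definition drift (a k : R) (d : C) (tau : R) : Prop :=
  Cmod (d - RtoC (2 * a * tau)) <= (1 + k) / 2 * Cmod d.

Lemma normal_bounds a k H A p t : 1 <= a -> 0 <= k < 1 -> normal a k H A p t ->
  exists r e, 0 < r /\ 0 <= e /\ e <= 1 /\ (3 * k + 1) / 4 + e + 2 * e <= (1 + k) / 2 /\
   (forall z w u, Cmod (z - p) < r -> Cmod (w - p) < r -> Rabs (u - t) < r ->
     Cmod (H z u - H w u - A p t * (z - w)) <= ((3 * k + 1) / 4 + e) * Cmod (A p t) * Cmod (z - w)) /\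
   (forall z u u', Cmod (z - p) < r -> Rabs (u - t) < r -> Rabs (u' - t) < r ->
     Cmod (H z u' - H z u + RtoC (2 * a) * A p t * RtoC (u' - u)) <= e * Cmod (A p t) * Rabs (u' - u)).
Proof.
  intros Ha Hk (HA & HL & HN). generalize (Cmod_pos _ HA). intros Hp.
  (* With e = 2 a e0, three times e is exactly the gap (1 - k) / 4 between (3k + 1) / 4 and (1 + k)
     / 2. *)
  set (e0 := (1 - k) / (24 * a)).
  assert (He0 : 0 < e0) by (apply Rdiv_lt_0_compat; lra).
  assert (Ea : a * e0 = (1 - k) / 24) by (unfold e0; field; lra).
  destruct (filter_and _ _ HN (HL (e0 * Cmod (A p t)) ltac:(nra))) as (r & Hr & B).
  exists r, (2 * a * e0). repeat split; try nra.
  - intros z w u Hz Hw Hu.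
    apply (mvt_seg (fun W => H W u) w z (A p t) (((3 * k + 1) / 4 + 2 * a * e0) * Cmod (A p t))).
    intros x Hx.
    destruct (B (w + RtoC x * (z - w))%C u) as [[(xx & Hw' & Hxx) _] HA']; auto.
    { now apply seg_ball. }
    simpl in *. eexists _, _. split; [exact Hw'|]. rewrite Cmod_0, Rplus_0_r.
    set (A1 := A (w + RtoC x * (z - w))%C u) in *.
    replace (A1 * (1 - xx) - A p t)%C with ((A1 - A p t) * (1 - xx) + - (A p t * xx))%C by ring.
    eapply Rle_trans; [apply Cmod_triangle|].
    rewrite Cmod_opp, !Cmod_mult.
    assert (Cmod (1 - xx) <= 2).
    { unfold Cminus. eapply Rle_trans; [apply Cmod_triangle|]. rewrite Cmod_opp, Cmod_1. lra. }
    assert (Cmod (A1 - A p t) * Cmod (1 - xx) <= e0 * Cmod (A p t) * 2).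
    { apply Rmult_le_compat; auto using Cmod_ge_0. lra. }
    assert (e0 <= a * e0) by nra.
    assert (Cmod (A p t) * Cmod xx <= Cmod (A p t) * ((3 * k + 1) / 4)) by (apply Rmult_le_compat_l; lra).
    nra.
  - intros z u u' Hz Hu Hu'.
    replace (H z u' - H z u + RtoC (2 * a) * A p t * RtoC (u' - u))%C
      with (H z u' - H z u - (- RtoC (2 * a) * A p t) * RtoC (u' - u))%C by ring.
    apply rd_lip. intros x Hx.
    destruct (B z x) as [[_ Hrd] HA']; auto.
    { apply Rabs_def2 in Hu, Hu'. unfold Rmin, Rmax in Hx.
      apply Rabs_def1; destruct (Rle_dec u u'); lra. }
    eexists. split; [exact Hrd|]. simpl in *.
    replace (- RtoC (2 * a) * A z x - - RtoC (2 * a) * A p t)%C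
      with (- (RtoC (2 * a) * (A z x - A p t)))%C by ring.
    rewrite Cmod_opp, Cmod_mult, Cmod_R, Rabs_pos_eq by lra.
    replace (2 * a * e0 * Cmod (A p t)) with (2 * a * (e0 * Cmod (A p t))) by ring.
    apply Rmult_le_compat_l; lra.
Qed.

Lemma normal_inj a k H A p t : 1 <= a -> 0 <= k < 1 -> normal a k H A p t ->
  exists r, 0 < r /\ forall z w u, Cmod (z - p) < r -> Cmod (w - p) < r -> Rabs (u - t) < r ->
    H z u = H w u -> z = w.
Proof.
  intros Ha Hk HN. assert (HA := proj1 HN). apply Cmod_pos in HA.
  destruct (normal_bounds a k H A p t Ha Hk HN) as (r & e & Hr & He & He1 & Hke & B & _).
  exists r. split; auto. intros z w u Hz Hw Hu E.
  specialize (B z w u Hz Hw Hu). rewrite E in B.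
  replace (H w u - H w u - A p t * (z - w))%C with (- (A p t * (z - w)))%C in B by ring.
  rewrite Cmod_opp, Cmod_mult in B.
  apply Cmod_eq0_sub. generalize (Cmod_ge_0 (z - w)). intros.
  assert (0 <= Cmod (A p t) * Cmod (z - w)) by nra.
  rewrite Rmult_assoc in B.
  assert (((1 - ((3 * k + 1) / 4 + e)) * Cmod (A p t)) * Cmod (z - w) <= 0) by nra.
  assert (0 < (1 - ((3 * k + 1) / 4 + e)) * Cmod (A p t)) by (apply Rmult_lt_0_compat; lra).
  nra.
Qed.

(** One step along a level set, forwards or backwards in time, by [solve_ball] around [z] at time
    [u']. The radius serves all [z] and [u] near [p] and [t], which is what the supremum argument of
    [flow_pair] requires. *)
Lemma normal_step a k H A p t : 1 <= a -> 0 <= k < 1 -> normal a k H A p t ->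
  exists r, 0 < r /\ forall z u u', Cmod (z - p) < r -> Rabs (u - t) < r -> Rabs (u' - u) < r ->
    exists w, H w u' = H z u /\ drift a k (w - z) (u' - u).
Proof.
  intros Ha Hk HN. assert (HA := proj1 HN). generalize (Cmod_pos _ HA). intros HAp.
  destruct (normal_bounds a k H A p t Ha Hk HN) as (r & e & Hr & He & He1 & Hke & B1 & B2).
  assert (Hk1 : 0 <= (3 * k + 1) / 4 + e < 1) by lra.
  set (k1 := (3 * k + 1) / 4 + e) in *.
  (* The first bound keeps the ball of radius r / 4 about [z] within reach of the estimates. The
     second makes the change of [H] in time, at most (2a + 1) |A| r', fit into the range that
     [solve_ball] covers. *)
  set (r' := Rmin (r / 4) ((1 - k1) * (r / 4) / (2 * a + 1))).
  assert (Hr' : 0 < r').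
  { apply Rmin_pos; [lra|]. apply Rdiv_lt_0_compat; [|lra]. apply Rmult_lt_0_compat; lra. }
  assert (Hr1 : r' <= r / 4) by apply Rmin_l.
  assert (Hr2 : (2 * a + 1) * r' <= (1 - k1) * (r / 4)).
  { assert (r' <= (1 - k1) * (r / 4) / (2 * a + 1)) by apply Rmin_r.
    apply Rmult_le_compat_l with (r := 2 * a + 1) in H0; [|lra].
    replace ((2 * a + 1) * ((1 - k1) * (r / 4) / (2 * a + 1))) with ((1 - k1) * (r / 4)) in H0
      by (field; lra). exact H0. }
  exists r'. split; auto. intros z u u' Hz Hu Hu'.
  assert (Hu'' : Rabs (u' - t) < r).
  { replace (u' - t) with ((u' - u) + (u - t)) by ring.
    eapply Rle_lt_trans; [apply Rabs_triang|]. lra. }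
  assert (T := B2 z u u' ltac:(lra) ltac:(lra) Hu'').
  assert (Hball : forall w, Cmod (w - z) <= r / 4 -> Cmod (w - p) < r).
  { intros w Hw. generalize (Cmod_tri3 w z p). lra. }
  destruct (solve_ball (fun w => H w u') z (A p t) (H z u) (r / 4) k1) as (w & Hw & E); auto.
  - replace (H z u - H z u')%C with ((- (H z u' - H z u + RtoC (2 * a) * A p t * RtoC (u' - u)))
       + RtoC (2 * a) * A p t * RtoC (u' - u))%C by ring.
    eapply Rle_trans; [apply Cmod_triangle|].
    rewrite Cmod_opp, !Cmod_mult, !Cmod_R, (Rabs_pos_eq (2 * a)) by lra.
    apply Rle_trans with ((2 * a + 1) * Cmod (A p t) * Rabs (u' - u)).
    + assert (0 <= Cmod (A p t) * Rabs (u' - u)) by (apply Rmult_le_pos; [lra|apply Rabs_pos]). nra.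
    + replace ((1 - k1) * Cmod (A p t) * (r / 4)) with (Cmod (A p t) * ((1 - k1) * (r / 4))) by ring.
      replace ((2 * a + 1) * Cmod (A p t) * Rabs (u' - u)) with (Cmod (A p t) * ((2 * a + 1) * Rabs (u' - u))) by ring.
      apply Rmult_le_compat_l; [lra|]. nra.
  - exists w. split; auto. unfold drift.
    assert (Hwp := Hball w Hw).
    assert (S := B1 w z u' Hwp ltac:(lra) Hu'').
    simpl in E. rewrite E in S.
    set (tau := u' - u) in *. set (d := (w - z)%C) in *.
    assert (K : Cmod (A p t) * Cmod (d - RtoC (2 * a * tau)) <= Cmod (A p t) * (k1 * Cmod d + e * Rabs tau)).
    { rewrite <- Cmod_mult.
      replace (A p t * (d - RtoC (2 * a * tau)))%C
        with (- (H z u - H z u' - A p t * d) + - (H z u' - H z u + RtoC (2 * a) * A p t * RtoC tau))%C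
        by (rewrite (RtoC_mult (2 * a)); ring).
      eapply Rle_trans; [apply Cmod_triangle|]. rewrite !Cmod_opp. lra. }
    apply Rmult_le_reg_l in K; auto.
    assert (L : 2 * a * Rabs tau <= Cmod d + Cmod (d - RtoC (2 * a * tau))).
    { generalize (Cmod_rev (RtoC (2 * a * tau)) d). rewrite Cmod_sub_sym, Cmod_R, !Rabs_mult.
      rewrite (Rabs_pos_eq 2), (Rabs_pos_eq a) by lra. lra. }
    generalize (Cmod_ge_0 d) (Rabs_pos tau). intros.
    (* Turns the time error e |tau| into a multiple of |d|, as [drift] measures relative to |d|. *)
    assert (L2 : Rabs tau <= 2 * Cmod d).
    { assert (k1 <= 1) by lra. assert (Rabs tau <= a * Rabs tau) by nra.
      assert (e * Rabs tau <= Rabs tau) by nra. nra. }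
    apply Rle_trans with (k1 * Cmod d + e * (2 * Cmod d)); [|nra].
    assert (e * Rabs tau <= e * (2 * Cmod d)) by (apply Rmult_le_compat_l; lra). lra.
Qed.

(** What the sequel needs of [drift] for forward steps, in a form that adds up over successive steps
    and passes to limits. *)
Definition advance (v c : R) (d : C) (tau : R) : Prop := v * tau <= Re d /\ Cmod d <= c * tau.

(** The least real part and the greatest modulus of 2a / (1 - x) for |x| <= (1 + k) / 2. *)
Definition slow (a k : R) : R := 2 * a / (1 + (1 + k) / 2).
Definition fast (a k : R) : R := 2 * a / (1 - (1 + k) / 2).

Lemma slow_gt a k : 1 <= a -> 0 <= k < 1 -> a < slow a k.
Proof.
  intros Ha Hk. unfold slow. apply Rmult_lt_reg_r with (1 + (1 + k) / 2); [lra|].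
  unfold Rdiv at 2. rewrite Rmult_assoc, Rinv_l by lra. nra.
Qed.

Lemma fast_pos a k : 1 <= a -> 0 <= k < 1 -> 0 < fast a k.
Proof. intros. apply Rdiv_lt_0_compat; lra. Qed.

Lemma drift_fast a k d tau : 1 <= a -> 0 <= k < 1 -> drift a k d tau -> Cmod d <= fast a k * Rabs tau.
Proof.
  intros Ha Hk H. unfold drift in H.
  generalize (Cmod_rev d (RtoC (2 * a * tau))).
  rewrite Cmod_R, !Rabs_mult, (Rabs_pos_eq 2), (Rabs_pos_eq a) by lra. intros H1.
  unfold fast. apply Rmult_le_reg_l with (1 - (1 + k) / 2); [lra|].
  replace ((1 - (1 + k) / 2) * (2 * a / (1 - (1 + k) / 2) * Rabs tau)) with (2 * a * Rabs tau) by (field; lra).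
  lra.
Qed.

Lemma drift_advance a k d tau : 1 <= a -> 0 <= k < 1 -> 0 <= tau -> drift a k d tau ->
  advance (slow a k) (fast a k) d tau.
Proof.
  intros Ha Hk Ht H. split; [|rewrite <- (Rabs_pos_eq tau) by auto; now apply drift_fast].
  unfold drift in H. set (kp := (1 + k) / 2) in *.
  assert (Hkp : 0 < kp < 1) by (unfold kp; lra).
  assert (H2 : Cmod (d - RtoC (2 * a * tau)) ^ 2 <= (kp * Cmod d) ^ 2).
  { apply pow_incr. split; [apply Cmod_ge_0|exact H]. }
  rewrite Rpow_mult_distr, !Cmod_sq in H2.
  set (T := 2 * a * tau) in *. destruct d as [x y]. simpl in H2 |- *.
  assert (HT : 0 <= T) by (unfold T; nra).
  unfold slow. fold kp. replace (2 * a / (1 + kp) * tau) with (T / (1 + kp)) by (unfold T; field; lra).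
  apply Rmult_le_reg_r with (1 + kp); [lra|].
  unfold Rdiv. rewrite Rmult_assoc, Rinv_l, Rmult_1_r by lra.
  apply Rnot_lt_le. intros N.
  (* The squared drift inequality reads (T - x)^2 - kp^2 x^2 <= -(1 - kp^2) y^2. If (1 + kp) x < T,
     both factors on the left would be positive. *)
  assert (Hc : (T - x - kp * x) * (T - x + kp * x) <= 0).
  { assert (0 <= (1 - kp * kp) * (y * y)) by (apply Rmult_le_pos; nra). nra. }
  assert (0 < T - x + kp * x).
  { destruct (Rle_dec 0 x); nra. }
  nra.
Qed.

Lemma advance_plus v c d d' tau tau' :
  advance v c d tau -> advance v c d' tau' -> advance v c (d + d') (tau + tau').
Proof.
  intros [A B] [A' B']. split.
  - destruct d, d'; simpl in *. lra.
  - eapply Rle_trans; [apply Cmod_triangle|]. lra.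
Qed.

Definition region (a : R) (W : C) (t : R) : Prop := 0 <= t /\ 0 < Re W /\ a * t <= Re W.

(* A solution that can be continued a little from the neighbourhood of every
   point of the region can be continued for all times: take the supremum. *)
Lemma flow_pair (a v c : R) (S : C -> C -> R -> Prop) :
  1 <= a -> a <= v -> 0 < c ->
  (forall p p' t, region a p t -> region a p' t ->
    exists r, 0 < r /\ forall z z' u u', Cmod (z - p) < r -> Cmod (z' - p') < r -> Rabs (u - t) < r ->
      S z z' u -> u <= u' < u + r ->
      exists w w', S w w' u' /\ advance v c (w - z) (u' - u) /\ advance v c (w' - z') (u' - u)) ->
  forall z z' t0, region a z t0 -> region a z' t0 -> S z z' t0 ->
  forall t, t0 <= t -> exists w w', S w w' t /\ advance v c (w - z) (t - t0) /\ advance v c (w' - z') (t - t0).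
Proof.
  intros Ha Hv Hc Hstep z z' t0 Hz Hz' HS t Ht.
  set (Q := fun u w w' => S w w' u /\ advance v c (w - z) (u - t0) /\ advance v c (w' - z') (u - t0)).
  set (G := fun u => t0 <= u <= t /\ exists w w', Q u w w').
  assert (G0 : G t0).
  { split; [lra|]. exists z, z'. split; auto.
    replace (z - z)%C with (RtoC 0) by ring. replace (z' - z')%C with (RtoC 0) by ring.
    rewrite Rminus_diag. split; split; simpl; rewrite ?Cmod_0; lra. }
  destruct (completeness G) as (m & Hm1 & Hm2).
  { exists t. intros u [Hu _]. lra. }
  { exists t0. exact G0. }
  assert (Hm0 : t0 <= m) by (apply Hm1; exact G0).
  assert (Hmt : m <= t) by (apply Hm2; intros u [Hu _]; lra).
  assert (Sq : forall n, exists y : R * (C * C), m - / (INR n + 1) < fst y <= m /\ t0 <= fst y <= t /\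
     Q (fst y) (fst (snd y)) (snd (snd y))).
  { intros n. assert (Hp : 0 < / (INR n + 1)) by (apply Rinv_0_lt_compat; generalize (pos_INR n); lra).
    apply NNPP. intros N.
    assert (B : is_upper_bound G (m - / (INR n + 1))).
    { intros u (Hu & w & w' & HQ). apply Rnot_lt_le. intros L. apply N.
      exists (u, (w, w')). simpl. repeat split; auto; try lra.
      - apply Hm1. split; auto. exists w, w'. exact HQ.
      - apply HQ.
      - apply HQ.
      - apply HQ.
      - apply HQ.
      - apply HQ. }
    specialize (Hm2 _ B). lra. }
  destruct (choice _ Sq) as (y & Hy).
  set (un := fun n => fst (y n)) in *. set (wn := fun n => fst (snd (y n))) in *.
  set (wn' := fun n => snd (snd (y n))) in *.
  assert (Bd : forall (z0 w : C) u, t0 <= u <= t -> advance v c (w - z0) (u - t0) -> Cmod w <= Cmod z0 + c * (t - t0)).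
  { intros z0 w u Hu [_ A]. generalize (Cmod_rev w z0). nra. }
  destruct (bw wn (Cmod z + c * (t - t0))) as (f & p & Hf & Hp).
  { intros n. destruct (Hy n) as (_ & H1 & _ & H2 & _). eapply Bd; eauto. }
  destruct (bw (fun n => wn' (f n)) (Cmod z' + c * (t - t0))) as (g & p' & Hg & Hp').
  { intros n. destruct (Hy (f n)) as (_ & H1 & _ & _ & H2). eapply Bd; eauto. }
  assert (Hp2 := limC_subseq _ _ g Hg Hp). simpl in Hp2.
  set (h := fun n => f (g n)).
  assert (Hh : forall n, (n <= h n)%nat) by (intros n; etransitivity; [apply Hg|apply Hf]).
  assert (Hun : forall e, 0 < e -> eventually (fun n => Rabs (un (h n) - m) < e)).
  { intros e He. destruct (inv_INR_small e He) as (N & HN). exists N. intros n Hn.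
    destruct (Hy (h n)) as (H1 & _). fold un in H1.
    assert (/ (INR (h n) + 1) < e) by (apply HN; etransitivity; [exact Hn|apply Hh]).
    unfold un in *. apply Rabs_def1; lra. }
  assert (Hre : forall (z0 q : C) (s : nat -> C), limC eventually s q ->
     (forall n, v * (un (h n) - t0) <= Re (s n - z0)) -> v * (m - t0) <= Re (q - z0)).
  { intros z0 q s Hs Hn. apply le_epsilon. intros e He.
    assert (He2 : 0 < e / 2 / v) by (apply Rdiv_lt_0_compat; lra).
    destruct (filter_ex (F := eventually) _ (filter_and _ _ (Hs (e / 2) (half_pos _ He)) (Hun _ He2)))
      as (n & B1 & B2).
    specialize (Hn n). generalize (re_le_Cmod (s n - q)) (Rle_abs (Re (s n - q))).
    apply Rabs_def2 in B2. destruct B2 as [_ B2].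
    apply Rmult_lt_compat_l with (r := v) in B2; [|lra].
    replace (v * - (e / 2 / v)) with (- (e / 2)) in B2 by (field; lra).
    destruct (s n), q, z0; simpl in *. nra. }
  assert (Rp : v * (m - t0) <= Re (p - z)).
  { apply (Hre z p _ Hp2). intros n. destruct (Hy (h n)) as (_ & _ & _ & [H2 _] & _). exact H2. }
  assert (Rp' : v * (m - t0) <= Re (p' - z')).
  { apply (Hre z' p' _ Hp'). intros n. destruct (Hy (h n)) as (_ & _ & _ & _ & [H2 _]). exact H2. }
  (* The cluster points stay in the region because its edge Re W = a t moves with speed a <= v. *)
  assert (Reg : forall z0 q : C, region a z0 t0 -> v * (m - t0) <= Re (q - z0) -> region a q m).
  { intros z0 q (R1 & R2 & R3) Hq. destruct z0, q; unfold region; simpl in *.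
    assert (a * (m - t0) <= v * (m - t0)) by (apply Rmult_le_compat_r; lra).
    assert (0 <= a * (m - t0)) by nra. repeat split; lra. }
  destruct (Hstep p p' m (Reg _ _ Hz Rp) (Reg _ _ Hz' Rp')) as (r & Hr & Hst).
  destruct (filter_ex (F := eventually) _ (filter_and _ _ (Hun (r / 2) (half_pos _ Hr)) (filter_and _ _ (Hp2 r Hr) (Hp' r Hr))))
    as (n & N1 & N2 & N3).
  destruct (Hy (h n)) as (Y1 & Y2 & YS & YA & YA').
  (* One more step from a time within r / 2 of the supremum [m] passes beyond [m], unless it has
     already reached the final time [t]. *)
  set (u1 := Rmin t (m + r / 4)).
  assert (Hu1 : un (h n) <= u1 < un (h n) + r).
  { unfold un in *. apply Rabs_def2 in N1. unfold u1. split.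
    - apply Rmin_glb; lra.
    - eapply Rle_lt_trans; [apply Rmin_r|]. lra. }
  destruct (Hst (wn (h n)) (wn' (h n)) (un (h n)) u1) as (w & w' & E1 & E2 & E3); auto.
  { lra. }
  assert (QQ : Q u1 w w').
  { split; [exact E1|].
    replace (w - z)%C with ((wn (h n) - z) + (w - wn (h n)))%C by ring.
    replace (w' - z')%C with ((wn' (h n) - z') + (w' - wn' (h n)))%C by ring.
    replace (u1 - t0) with ((un (h n) - t0) + (u1 - un (h n))) by ring.
    split; apply advance_plus; auto. }
  assert (Gu : u1 <= m).
  { apply Hm1. split; [|exists w, w'; exact QQ]. split; [unfold un in *; lra|apply Rmin_l]. }
  assert (u1 = t).
  { unfold u1, Rmin in *. destruct (Rle_dec t (m + r / 4)); lra. }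
  exists w, w'. rewrite <- H. exact QQ.
Qed.

(** The diagonal case of [flow_pair]. Pairs are needed for univalence, where the invariant z <> z'
    concerns two level curves at once. *)
Lemma flow (a v c : R) (S : C -> R -> Prop) :
  1 <= a -> a <= v -> 0 < c ->
  (forall p t, region a p t ->
    exists r, 0 < r /\ forall z u u', Cmod (z - p) < r -> Rabs (u - t) < r ->
      S z u -> u <= u' < u + r ->
      exists w, S w u' /\ advance v c (w - z) (u' - u)) ->
  forall z t0, region a z t0 -> S z t0 ->
  forall t, t0 <= t -> exists w, S w t /\ advance v c (w - z) (t - t0).
Proof.
  intros Ha Hv Hc Hst z t0 Hz HS t Ht.
  destruct (flow_pair a v c (fun w w' u => S w u /\ w = w') Ha Hv Hc) with (z := z) (z' := z) (t0 := t0) (t := t)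
    as (w & w' & (H1 & _) & H2 & _); auto.
  - intros p p' u Hp _. destruct (Hst p u Hp) as (r & Hr & A). exists r. split; auto.
    intros x x' s s' Hx _ Hs (HSx & ->) Hs'. destruct (A _ _ _ Hx Hs HSx Hs') as (w & E & F).
    exists w, w. auto.
  - exists w. auto.
Qed.

(** * The Loewner chain in logarithmic coordinates *)

(** Derivatives in the real variable t are computed by the Wirtinger rules, with t as the real part
    of a complex variable. *)
Lemma rd_of_wd_Re (h : R -> C) t al be :
  wd (fun z => h (Re z)) (RtoC t) al be -> rd h t (al + be)%C.
Proof.
  intros H. assert (H' := rd_of_wd (fun z => h (Re z)) 0 1 t al be).
  replace (0 + RtoC t * 1)%C with (RtoC t) in H' by ring.
  specialize (H' H). replace (al * 1 + be * Cconj 1)%C with (al + be)%C in H'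
    by (replace (Cconj 1) with (RtoC 1) by (apply C_ext; simpl; ring); ring).
  intros e He. destruct (H' e He) as (d & Hd & A). exists d. split; auto.
  intros x Hx. specialize (A x Hx). simpl in A.
  replace (0 + ((t + x) * 1 - 0 * 0)) with (t + x) in A by ring.
  replace (0 + (t * 1 - 0 * 0)) with t in A by ring. exact A.
Qed.

Lemma rd_scal (c : C) u t v : rd u t v -> rd (fun x => c * u x)%C t (c * v)%C.
Proof.
  intros R e He. generalize (Cmod_ge_0 c); intros Hc.
  assert (He' : 0 < e / (Cmod c + 1)) by (apply Rdiv_lt_0_compat; lra).
  destruct (R _ He') as (d & Hd' & A). exists d. split; auto. intros h Hh.
  replace (c * u (t + h)%R - c * u t - c * v * h)%C with (c * (u (t + h)%R - u t - v * h))%C by ring.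
  rewrite Cmod_mult. specialize (A h Hh).
  apply Rle_trans with (Cmod c * (e / (Cmod c + 1) * Rabs h)); [apply Rmult_le_compat_l; auto|].
  assert (e * Rabs h = (Cmod c + 1) * (e / (Cmod c + 1) * Rabs h)) by (field; lra).
  assert (0 <= e / (Cmod c + 1) * Rabs h) by (apply Rmult_le_pos; [lra|apply Rabs_pos]). nra.
Qed.

Lemma wd_exp_Re c p : wd (fun z => RtoC (exp (c * Re z))) p (RtoC (c / 2 * exp (c * Re p))) (RtoC (c / 2 * exp (c * Re p))).
Proof.
  eapply wd_eq; [| |apply (wd_RtoC_Re (fun x => exp (c * x)) p (c * exp (c * Re p)))].
  - f_equal. field.
  - f_equal. field.
  - apply is_derive_Reals. auto_derive; auto. ring.
Qed.

Lemma continuity_pt_expc c t : continuity_pt (fun x => exp (c * x)) t.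
Proof.
  apply derivable_continuous_pt. exists (c * exp (c * t)).
  apply is_derive_Reals. auto_derive; auto. ring.
Qed.

(** Bernoulli's inequality for the base exp x. It brings a >= 1 into the bound on [theta]. *)
Lemma exp_convex a x : 1 <= a -> 0 <= x -> a * (exp x - 1) <= exp (a * x) - 1.
Proof.
  intros Ha Hx.
  assert (H : a * (exp x - 1) - exp (a * x) <= a * (exp 0 - 1) - exp (a * 0)).
  { apply (deriv_nonpos_le (fun x => a * (exp x - 1) - exp (a * x)) 0 x Hx).
    - intros y _. apply derivable_continuous_pt. exists (a * exp y - a * exp (a * y)).
      apply is_derive_Reals. auto_derive; auto. ring.
    - intros y Hy. exists (a * exp y - a * exp (a * y)). split.
      + apply is_derive_Reals. auto_derive; auto. ring.
      + assert (exp y <= exp (a * y)).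
        { apply exp_le. nra. }
        nra. }
  rewrite Rmult_0_r, exp_0 in H. lra.
Qed.

Lemma exp_cancel t : (exp (- (2) * t) * exp (2 * t) = 1)%C.
Proof.
  rewrite <- RtoC_mult, <- exp_plus. replace (- (2) * t + 2 * t) with 0 by ring. now rewrite exp_0.
Qed.

Definition cpl (x y : R) : C := (x, y).

(* [cpl a b] is [s]; with [w = exp W], [L W] stands for [log g(w)], [q W] for [w g'(w)/g(w)] and
   [E W] for [(1 - s) (1 - w g'(w)/g(w)) - s w g''(w)/g'(w)]. *)
Record core (a b k : R) (L q E : C -> C) : Prop := Core {
  core_a : 1 <= a;
  core_k : 0 <= k < 1;
  core_b : Rabs b <= k * Cmod (cpl a b);
  core_L : forall W, 0 < Re W -> wd L W (q W) 0;
  core_q : forall W, 0 < Re W -> wd q W (q W * (1 - E W - q W) / cpl a b)%C 0;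
  core_q0 : forall W, 0 < Re W -> q W <> 0;
  core_E : forall W, 0 < Re W ->
    Cmod (Ci * b + a * (1 - exp (2 * Re W))%R * E W) <= a * k * Cmod (cpl a b) - Rabs b * (a - 1);
  core_turn : forall W n, 0 < Re W -> L (W + turn n)%C = (L W + turn n)%C /\ q (W + turn n)%C = q W;
  core_infty : exists X K, 0 < X /\ forall W, X <= Re W -> Cmod (L W - W) <= K * exp (- (2) * Re W)
}.

Section Core.
Context {a b k : R} {L q E : C -> C} (HC : core a b k L q E).

Let Ha : 1 <= a := core_a _ _ _ _ _ _ HC.
Let Hk : 0 <= k < 1 := core_k _ _ _ _ _ _ HC.
Let Hb := core_b _ _ _ _ _ _ HC.
Let HL := core_L _ _ _ _ _ _ HC.
Let Hq := core_q _ _ _ _ _ _ HC.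
Let Hq0 := core_q0 _ _ _ _ _ _ HC.
Let HE := core_E _ _ _ _ _ _ HC.
Notation s := (cpl a b).

Lemma s_nz : s <> 0.
Proof. intros H. apply (f_equal Re) in H. simpl in H. lra. Qed.

Lemma s_pos : 0 < Cmod s.
Proof. apply Cmod_pos, s_nz. Qed.

Lemma a_nz : RtoC a <> 0.
Proof. intros H. apply RtoC_inj in H. lra. Qed.

(** The difference of the two sides is a (k |s| - |b|). *)
Lemma core_bound_ge : Rabs b <= a * k * Cmod s - Rabs b * (a - 1).
Proof. nra. Qed.

(* [chainU W t] is the logarithm of [g(w) (1 - (1 - exp(-2t)) w g'(w)/g(w))^s], and [chainV W t]
   is the [s]-th root of this quantity, which makes sense before [chainP] is known not to vanish. *)
Definition chain_factor (W : C) (t : R) : C := (1 - (1 - exp (- (2) * t))%R * q W)%C.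
Notation chainP := chain_factor.
Definition chain_log (W : C) (t : R) : C := (L W + s * Clog (chainP W t))%C.
Notation chainU := chain_log.
Definition chain_root (W : C) (t : R) : C := (cexp (L W / s) * chainP W t)%C.
Notation chainV := chain_root.
(** The factor A that makes [chainU] satisfy [normal]; [root_speed] does this for [chainV]. The same
    x, namely [defect], serves both. *)
Definition chain_speed (W : C) (t : R) : C := (s * exp (- (2) * t) * q W / (a * chainP W t))%C.
Notation speedU := chain_speed.
Definition root_speed (W : C) (t : R) : C := (cexp (L W / s) * q W * exp (- (2) * t) / a)%C.
Notation speedV := root_speed.
Definition chain_defect (W : C) (t : R) : C := ((Ci * b + a * (1 - exp (2 * t))%R * E W) / s)%C.
Notation defect := chain_defect.

(** The left-hand side is the factor that the W-derivatives of [chainU] and of [chainV] have in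
    common. *)
Lemma defect_eq W t :
  (exp (- (2) * t) + (1 - exp (- (2) * t))%R * E W = s * exp (- (2) * t) / a * (1 - defect W t))%C.
Proof.
  unfold defect.
  assert (Hs : s = (a + Ci * b)%C) by (apply C_ext; simpl; ring).
  assert (Hx := exp_cancel t).
  rewrite !RtoC_minus.
  replace (s * exp (- (2) * t) / a * (1 - (Ci * b + a * (1 - exp (2 * t)) * E W) / s))%C
    with ((exp (- (2) * t) * (s - Ci * b - a * E W) + a * (exp (- (2) * t) * exp (2 * t)) * E W) / a)%C
    by (field; repeat split; auto using a_nz, s_nz).
  rewrite Hx, Hs. field. apply a_nz.
Qed.

(** s times the defect is theta times the expression of the hypothesis plus (1 - theta) i b. *)
Lemma defect_theta W t theta : 0 < Re W -> exp (2 * t) - 1 = theta * (exp (2 * Re W) - 1) ->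
  Cmod (defect W t) * Cmod s <= Rabs theta * (a * k * Cmod s - Rabs b * (a - 1)) + Rabs (1 - theta) * Rabs b.
Proof.
  intros HW Ht. unfold defect. rewrite <- Cmod_mult.
  replace ((Ci * b + a * (1 - exp (2 * t))%R * E W) / s * s)%C
    with (theta * (Ci * b + a * (1 - exp (2 * Re W))%R * E W) + (1 - theta)%R * (Ci * b))%C.
  - eapply Rle_trans; [apply Cmod_triangle|]. rewrite !Cmod_mult, !Cmod_R, Cmod_Ci, Rmult_1_l.
    apply Rplus_le_compat_r. apply Rmult_le_compat_l; [apply Rabs_pos|]. now apply HE.
  - replace (1 - exp (2 * t)) with (theta * (1 - exp (2 * Re W))) by lra.
    rewrite !RtoC_mult, !RtoC_minus. field. apply s_nz.
Qed.

Definition theta (W : C) (t : R) : R := (exp (2 * t) - 1) / (exp (2 * Re W) - 1).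

Lemma exp2_pos x : 0 < x -> 0 < exp (2 * x) - 1.
Proof. intros H. rewrite <- exp_0. assert (exp 0 < exp (2 * x)) by (apply exp_increasing; lra). lra. Qed.

Lemma theta_spec W t : 0 < Re W -> exp (2 * t) - 1 = theta W t * (exp (2 * Re W) - 1).
Proof. intros HW. unfold theta. field. generalize (exp2_pos _ HW). lra. Qed.

(** In the region exp(2 Re W) >= exp(2 a t), and [exp_convex] extracts the factor a. *)
Lemma theta_region W t : region a W t -> 0 <= theta W t /\ a * theta W t <= 1.
Proof.
  intros (Ht & HW & HR). assert (Hp := exp2_pos _ HW).
  assert (H0 : 0 <= exp (2 * t) - 1).
  { rewrite <- exp_0. destruct (Req_dec t 0) as [->|N]; [rewrite Rmult_0_r; lra|].
    assert (exp 0 < exp (2 * t)) by (apply exp_increasing; lra). lra. }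
  unfold theta. split.
  - apply Rmult_le_pos; auto. left. now apply Rinv_0_lt_compat.
  - apply Rmult_le_reg_r with (exp (2 * Re W) - 1); auto.
    replace (a * ((exp (2 * t) - 1) / (exp (2 * Re W) - 1)) * (exp (2 * Re W) - 1))
      with (a * (exp (2 * t) - 1)) by (field; lra).
    rewrite Rmult_1_l. eapply Rle_trans; [apply exp_convex; lra|].
    assert (exp (a * (2 * t)) <= exp (2 * Re W)); [|lra].
    apply exp_le. lra.
Qed.

(** At th = theta the left side is |b| + a theta (k |s| - |b|), at most k |s| because a theta <= 1.
    The slack [e] serves points near the region but not in it. *)
Lemma theta_bound W t th e : region a W t -> 0 <= e -> Rabs (th - theta W t) <= e ->
  Rabs th * (a * k * Cmod s - Rabs b * (a - 1)) + Rabs (1 - th) * Rabs b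
    <= k * Cmod s + e * (a * k * Cmod s - Rabs b * (a - 1) + Rabs b).
Proof.
  intros HR He Hth. destruct (theta_region W t HR) as [H0 H1].
  assert (HM := core_bound_ge). set (M := a * k * Cmod s - Rabs b * (a - 1)) in *.
  generalize (Rabs_pos b); intros Hb0.
  assert (T0 : theta W t <= 1) by nra.
  assert (A1' : Rabs th <= theta W t + e).
  { replace th with (theta W t + (th - theta W t)) by ring.
    eapply Rle_trans; [apply Rabs_triang|]. rewrite (Rabs_pos_eq (theta W t)) by auto. lra. }
  assert (A2' : Rabs (1 - th) <= (1 - theta W t) + e).
  { replace (1 - th) with ((1 - theta W t) + - (th - theta W t)) by ring.
    eapply Rle_trans; [apply Rabs_triang|]. rewrite Rabs_Ropp, (Rabs_pos_eq (1 - _)) by lra. lra. }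
  assert (B1 : Rabs th * M <= (theta W t + e) * M) by (apply Rmult_le_compat_r; lra).
  assert (B2 : Rabs (1 - th) * Rabs b <= (1 - theta W t + e) * Rabs b) by (apply Rmult_le_compat_r; lra).
  assert (B3 : theta W t * M + (1 - theta W t) * Rabs b <= k * Cmod s).
  { replace (theta W t * M + (1 - theta W t) * Rabs b)
      with (Rabs b + (a * theta W t) * (k * Cmod s - Rabs b)) by (unfold M; ring).
    nra. }
  nra.
Qed.

Lemma defect_region W t : region a W t -> Cmod (defect W t) <= k.
Proof.
  intros HR. destruct HR as (H1 & H2 & H3).
  assert (B := defect_theta W t _ H2 (theta_spec W t H2)).
  assert (D := theta_bound W t (theta W t) 0 ltac:(repeat split; auto) (Rle_refl 0)).
  rewrite Rminus_diag, Rabs_R0 in D. specialize (D (Rle_refl 0)).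
  generalize s_pos. intros Hs. apply Rmult_le_reg_r with (Cmod s); auto. lra.
Qed.

Lemma limC_expc p t c : limC (nb2 p t) (fun y => RtoC (exp (c * snd y))) (RtoC (exp (c * t))).
Proof. apply (limC_real snd t (fun x => exp (c * x))); [apply limC_snd|apply continuity_pt_expc]. Qed.

Lemma nb2_pos p t : 0 < Re p -> nb2 p t (fun y => 0 < Re (fst y)).
Proof. intros H. apply (nb2_fst p t (fun z => 0 < Re z)). now apply nb_re_gt. Qed.

(** [E] is not assumed continuous, so the defect is not compared with its value at [p]. Instead
    [theta] is continuous and the bound of the hypothesis holds at every nearby point. *)
Lemma defect_near p t : region a p t -> nb2 p t (fun y => Cmod (defect (fst y) (snd y)) <= (3 * k + 1) / 4).
Proof.
  intros HR. assert (HR' := HR). destruct HR as (H1 & H2 & H3).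
  assert (Hs := s_pos). assert (HM := core_bound_ge).
  set (M := a * k * Cmod s - Rabs b * (a - 1)) in *.
  generalize (Rabs_pos b); intros Hb0.
  set (e := (1 - k) / 4 * Cmod s / (M + Rabs b + 1)).
  assert (He : 0 < e).
  { apply Rdiv_lt_0_compat; [|lra]. apply Rmult_lt_0_compat; lra. }
  assert (Hl : limC (nb2 p t) (fun y => RtoC (theta (fst y) (snd y))) (RtoC (theta p t))).
  { unfold theta. assert (Hp := exp2_pos _ H2). rewrite RtoC_div, !RtoC_minus by lra.
    eapply limC_ext; [|apply (limC_div (fun y => RtoC (exp (2 * snd y)) - 1)%C (fun y => RtoC (exp (2 * Re (fst y))) - 1)%C)].
    - generalize (nb2_pos p t H2). apply filter_imp. intros y Hy. generalize (exp2_pos _ Hy). intros.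
      rewrite RtoC_div, !RtoC_minus by lra. reflexivity.
    - apply limC_minus; [apply limC_expc|apply limC_const].
    - apply limC_minus; [|apply limC_const].
      apply (limC_real (fun y => Re (fst y)) (Re p) (fun x => exp (2 * x))); [|apply continuity_pt_expc].
      apply limC_re, limC_fst.
    - rewrite <- RtoC_minus. intros X. apply RtoC_inj in X. lra. }
  generalize (filter_and _ _ (nb2_pos p t H2) (Hl e He)). apply filter_imp. intros [W u] [HW Hth]. simpl in *.
  rewrite <- RtoC_minus, Cmod_R in Hth.
  assert (B := defect_theta W u _ HW (theta_spec W u HW)).
  assert (D := theta_bound p t (theta W u) e HR' ltac:(lra) ltac:(lra)).
  fold M in B, D.
  apply Rmult_le_reg_r with (Cmod s); auto.
  assert (e * (M + Rabs b) <= (1 - k) / 4 * Cmod s).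
  { apply Rle_trans with (e * (M + Rabs b + 1)); [nra|]. right. unfold e. field. lra. }
  nra.
Qed.

Lemma wd_chainP W t : 0 < Re W ->
  wd (fun W => chainP W t) W (- (1 - exp (- (2) * t))%R * (q W * (1 - E W - q W) / s))%C 0.
Proof.
  intros HW. unfold chainP. eapply wd_eq; [| |apply wd_minus; [apply wd_const|apply wd_scal; now apply Hq]].
  - field. apply s_nz.
  - ring.
Qed.

Lemma rd_chainP W t : rd (chainP W) t (- (2) * exp (- (2) * t) * q W)%C.
Proof.
  eapply (eq_ind _ (rd (chainP W) t)).
  - apply rd_of_wd_Re. unfold chainP.
    eapply wd_ext; [|apply wd_plus; [apply (wd_const (1 - q W)%C)|apply (wd_scal (q W)), (wd_exp_Re (- (2)))]].
    apply filter_forall. intros z. rewrite RtoC_minus. ring.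
  - simpl. rewrite !RtoC_mult, RtoC_div, !RtoC_opp by lra. field.
Qed.

Lemma limC_q p t : 0 < Re p -> limC (nb2 p t) (fun y => q (fst y)) (q p).
Proof. intros Hp. apply (limC_comp fst q); [apply limC_fst|]. eapply wd_ccont. now apply Hq. Qed.

Lemma limC_L p t : 0 < Re p -> limC (nb2 p t) (fun y => L (fst y)) (L p).
Proof. intros Hp. apply (limC_comp fst L); [apply limC_fst|]. eapply wd_ccont. now apply HL. Qed.

Lemma limC_chainP p t : 0 < Re p -> limC (nb2 p t) (fun y => chainP (fst y) (snd y)) (chainP p t).
Proof.
  intros Hp. unfold chainP. apply limC_minus; [apply limC_const|].
  apply limC_mult; [|now apply limC_q].
  rewrite RtoC_minus. eapply limC_ext; [|apply limC_minus; [apply limC_const|apply limC_expc]].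
  apply filter_forall. intros y. now rewrite RtoC_minus.
Qed.

Lemma ccont_cexp z : ccont cexp z.
Proof. eapply wd_ccont. apply wd_cexp. Qed.

Lemma expc_nz x : RtoC (exp x) <> 0.
Proof. intros X. apply RtoC_inj in X. generalize (exp_pos x). lra. Qed.

Lemma normal_V p t : region a p t -> normal a k chainV speedV p t.
Proof.
  intros HR. assert (HR' := HR). destruct HR' as (_ & Hp & _).
  split; [|split].
  - unfold speedV, Cdiv. repeat apply Cmult_nz; auto using cexp_nz, expc_nz.
    apply Cinv_nz, a_nz.
  - unfold speedV. apply limC_div; [|apply limC_const|apply a_nz].
    apply limC_mult; [apply limC_mult|apply limC_expc]; [|now apply limC_q].
    apply (limC_comp (fun y => L (fst y) / s)%C cexp); [|apply ccont_cexp].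
    apply limC_div; [now apply limC_L|apply limC_const|apply s_nz].
  - generalize (filter_and _ _ (nb2_pos p t Hp) (defect_near p t HR)).
    apply filter_imp. intros [W u] [HW Hd]. simpl in *. split.
    + exists (defect W u). split; auto. unfold chainV.
      assert (D : wd (fun W => cexp (L W / s)) W (cexp (L W / s) * (/ s * q W))%C (cexp (L W / s) * (/ s * 0))%C).
      { apply (wd_cexpf (fun W => L W / s)%C). eapply wd_ext; [|exact (wd_scal (/ s)%C L W (q W) 0 (HL W HW))].
        apply filter_forall. intros z. unfold Cdiv. ring. }
      eapply wd_eq; [| |apply wd_mult; [exact D|now apply wd_chainP]].
      * assert (X := defect_eq W u). unfold speedV, chainP.
        replace (cexp (L W / s) * q W * exp (- (2) * u) / a * (1 - defect W u))%C
          with (cexp (L W / s) * q W / s * (s * exp (- (2) * u) / a * (1 - defect W u)))%C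
          by (field; repeat split; auto using a_nz, s_nz).
        rewrite <- X. rewrite !RtoC_minus. field. apply s_nz.
      * ring.
    + eapply (eq_ind _ (rd (chainV W) u)).
      * exact (rd_scal (cexp (L W / s)) _ _ _ (rd_chainP W u)).
      * unfold speedV. rewrite !RtoC_mult. field. apply a_nz.
Qed.

Lemma chainU_deriv_eq W t : chainP W t <> 0 ->
  (q W + s * (- (1 - exp (- (2) * t))%R * (q W * (1 - E W - q W) / s) / chainP W t))%C
  = (speedU W t * (1 - defect W t))%C.
Proof.
  intros Hn. assert (X := defect_eq W t). unfold speedU.
  replace (s * exp (- (2) * t) * q W / (a * chainP W t) * (1 - defect W t))%C
    with (q W / chainP W t * (s * exp (- (2) * t) / a * (1 - defect W t)))%C
    by (field; split; auto; apply a_nz).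
  rewrite <- X.
  replace (q W) with (q W * chainP W t / chainP W t)%C at 1 by (field; auto).
  set (pp := chainP W t) in *.
  replace (q W * pp / pp + s * (- (1 - exp (- (2) * t))%R * (q W * (1 - E W - q W) / s) / pp))%C
    with (q W * (pp - (1 - exp (- (2) * t))%R * (1 - E W - q W)) / pp)%C
    by (field; split; auto using s_nz).
  replace (pp - (1 - exp (- (2) * t))%R * (1 - E W - q W))%C
    with (exp (- (2) * t) + (1 - exp (- (2) * t))%R * E W)%C
    by (unfold pp, chainP; rewrite !RtoC_minus; ring).
  field. auto.
Qed.

Lemma wd_chainU W t : 0 < Re W -> slit (chainP W t) ->
  wd (fun W => chainU W t) W (speedU W t * (1 - defect W t))%C 0.
Proof.
  intros HW Hs. assert (Hn := slit_nz _ Hs). unfold chainU.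
  eapply wd_eq; [| |apply wd_plus; [apply HL; auto|apply wd_scal, wd_Clogf; [now apply wd_chainP|exact Hs]]].
  - now apply chainU_deriv_eq.
  - field. auto.
Qed.

Lemma normal_U p t : region a p t -> slit (chainP p t) -> normal a k chainU speedU p t.
Proof.
  intros HR Hs. assert (HR' := HR). destruct HR' as (_ & Hp & _).
  assert (Hn : (a * chainP p t)%C <> 0) by (apply Cmult_nz; [apply a_nz|now apply slit_nz]).
  split; [|split].
  - unfold speedU, Cdiv. repeat apply Cmult_nz; auto using expc_nz, s_nz, Cinv_nz.
  - unfold speedU. apply limC_div; auto.
    + apply limC_mult; [apply limC_mult; [apply limC_const|apply limC_expc]|now apply limC_q].
    + apply limC_mult; [apply limC_const|now apply limC_chainP].
  - assert (Hsn : nb2 p t (fun y => slit (chainP (fst y) (snd y)))).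
    { destruct (nb_slit _ Hs) as (d & Hd & A).
      generalize (limC_chainP p t Hp d Hd). apply filter_imp. auto. }
    generalize (filter_and _ _ Hsn (filter_and _ _ (nb2_pos p t Hp) (defect_near p t HR))).
    apply filter_imp. intros [W u] [Hsu [HW Hd]]. simpl in *. split.
    + exists (defect W u). split; auto. now apply wd_chainU.
    + eapply (eq_ind _ (rd (chainU W) u)).
      * apply rd_of_wd_Re. unfold chainU. apply wd_plus; [apply wd_const|].
        apply wd_scal, (wd_Clogf (fun z => chainP W (Re z))); [|exact Hsu].
        unfold chainP.
        eapply wd_ext; [|apply wd_plus; [apply (wd_const (1 - q W)%C)|apply (wd_scal (q W)), (wd_exp_Re (- (2)))]].
        apply filter_forall. intros z. rewrite RtoC_minus. ring.
      * simpl. change (chainP W (fst (RtoC u))) with (chainP W u).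
        unfold speedU. rewrite !RtoC_mult, !RtoC_div, !RtoC_opp by lra. field.
        repeat split; auto using a_nz, slit_nz.
Qed.

End Core.

(** * Behaviour near infinity *)

Definition far (P : C -> Prop) : Prop := exists X, 0 < X /\ forall W, X <= Re W -> P W.

Global Instance far_filter : Filter far.
Proof.
  constructor.
  - exists 1. split; [lra|auto].
  - intros P Q (X & HX & H) (Y & HY & H'). exists (Rmax X Y). split.
    + eapply Rlt_le_trans; [exact HX|apply Rmax_l].
    + intros W HW. split; [apply H|apply H']; eapply Rle_trans; [|exact HW| |exact HW];
        [apply Rmax_l|apply Rmax_r].
  - intros P Q HI (X & HX & H). exists X. auto.
Qed.

Lemma far_gt c : far (fun W => c < Re W).
Proof.
  exists (Rmax 1 (c + 1)). generalize (Rmax_l 1 (c + 1)) (Rmax_r 1 (c + 1)).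
  intros. split; [lra|]. intros; lra.
Qed.

Lemma far_exp d : 0 < d -> far (fun W => exp (- (2) * Re W) <= d).
Proof.
  intros Hd. generalize (far_gt (- ln d / 2)). apply filter_imp. intros W HW.
  rewrite <- (exp_ln d) by auto. left. apply exp_increasing. lra.
Qed.

Lemma far_shift P : far P -> far (fun W => forall x, 0 <= x <= 1 -> P (W + RtoC x)%C).
Proof.
  intros (X & HX & H). exists X. split; auto. intros W HW x Hx. apply H.
  destruct W; simpl in *. lra.
Qed.

Lemma rd_Cmod2 u y v : rd u y v ->
  derivable_pt_lim (fun y => Cmod (u y) ^ 2) y (2 * (Re (u y) * Re v + Im (u y) * Im v)).
Proof.
  intros Hv. assert (D1 := rd_re u y v 1 Hv). assert (D2 := rd_re u y v (- Ci) Hv).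
  apply is_derive_Reals.
  apply (is_derive_ext (fun y => Re (1 * u y) * Re (1 * u y) + Re (- Ci * u y) * Re (- Ci * u y))).
  - intros z. rewrite Cmod_sq. destruct (u z); simpl. ring.
  - apply is_derive_Reals.
    eapply (eq_ind _ (derivable_pt_lim _ y));
      [exact (derivable_pt_lim_plus _ _ _ _ _ (derivable_pt_lim_mult _ _ _ _ _ D1 D1) (derivable_pt_lim_mult _ _ _ _ _ D2 D2))|].
    simpl. destruct (u y), v; simpl. ring.
Qed.

(** |u|^2 exp(-2 e y) is nonincreasing, and 2 e x <= 1 with exp(-1) >= 1/4 gives the factor 2. *)
Lemma gronwall_segment (u : R -> C) e x : 0 <= x <= 1 -> 0 <= e <= 1 / 2 ->
  (forall y, 0 <= y <= 1 -> exists v, rd u y v /\ Cmod v <= e * Cmod (u y)) ->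
  Cmod (u x) <= 2 * Cmod (u 0).
Proof.
  intros Hx He H.
  assert (D : forall y, 0 <= y <= 1 -> exists l, derivable_pt_lim (fun y => Cmod (u y) ^ 2 * exp (- (2 * e) * y)) y l /\ l <= 0).
  { intros y Hy. destruct (H y Hy) as (v & Hv & Hl).
    assert (Dq := rd_Cmod2 u y v Hv).
    eexists. split.
    - apply derivable_pt_lim_mult; [exact Dq|].
      instantiate (1 := - (2 * e) * exp (- (2 * e) * y)).
      apply is_derive_Reals. auto_derive; auto. ring.
    - assert (Re (u y) * Re v + Im (u y) * Im v <= Cmod (u y) * Cmod v).
      { replace (Re (u y) * Re v + Im (u y) * Im v) with (Re (u y * Cconj v))
          by (destruct (u y), v; simpl; ring).
        rewrite <- (Cmod_conj v), <- Cmod_mult.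
        eapply Rle_trans; [apply Rle_abs|apply re_le_Cmod]. }
      generalize (exp_pos (- (2 * e) * y)) (Cmod_ge_0 (u y)). intros.
      assert (Cmod (u y) * Cmod v <= Cmod (u y) * (e * Cmod (u y))) by (apply Rmult_le_compat_l; auto).
      assert (2 * (Re (u y) * Re v + Im (u y) * Im v) - 2 * e * Cmod (u y) ^ 2 <= 0) by (simpl; nra).
      nra. }
  assert (M := deriv_nonpos_le (fun y => Cmod (u y) ^ 2 * exp (- (2 * e) * y)) 0 x ltac:(lra)).
  simpl in M. rewrite Rmult_0_r, exp_0 in M.
  assert (M' : Cmod (u x) * (Cmod (u x) * 1) * exp (- (2 * e) * x) <= Cmod (u 0) * (Cmod (u 0) * 1) * 1).
  { apply M.
    - intros y Hy. apply derivable_continuous_pt. apply ex_derive_Reals_0.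
      destruct (D y) as (l & Hl & _); [lra|]. exists l. now apply is_derive_Reals.
    - intros y Hy. apply D. lra. }
  assert (E1 : 1 / 4 <= exp (- (2 * e) * x)).
  { apply Rle_trans with (exp (- (1))).
    - rewrite exp_Ropp. generalize exp_le_3 (exp_pos 1). intros.
      apply Rmult_le_reg_r with (exp 1); auto. rewrite Rinv_l; lra.
    - apply exp_le. nra. }
  generalize (Cmod_ge_0 (u x)) (Cmod_ge_0 (u 0)). intros. apply Rnot_lt_le. intros N.
  assert (Cmod (u x) * Cmod (u x) <= 4 * (Cmod (u 0) * Cmod (u 0))) by nra. nra.
Qed.

Lemma cexp_near_0 : exists r, 0 < r <= 1 / 4 /\ forall z, Cmod z < r -> Cmod (cexp z - 1) <= 2 * Cmod z.
Proof.
  destruct (wd_cexp 0 1 Rlt_0_1) as (d & Hd & A).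
  exists (Rmin d (1 / 4)). split; [split; [apply Rmin_pos; lra|apply Rmin_r]|].
  intros z Hz. assert (Hz' : Cmod (z - 0) < d).
  { replace (z - 0)%C with z by ring. eapply Rlt_le_trans; [exact Hz|apply Rmin_l]. }
  specialize (A z Hz'). rewrite cexp_0 in A. replace (0 + z)%C with z in A by ring.
  replace (cexp z - 1)%C with ((cexp z - 1 - (1 * z + 0 * Cconj z)) + z)%C by ring.
  eapply Rle_trans; [apply Cmod_triangle|]. lra.
Qed.

Section Far.
Context {a b k : R} {L q E : C -> C} (HC : core a b k L q E).

Let Ha : 1 <= a := core_a _ _ _ _ _ _ HC.
Let Hk : 0 <= k < 1 := core_k _ _ _ _ _ _ HC.
Notation s := (cpl a b).
Let Hs := @s_nz _ _ _ _ _ _ HC.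

Lemma s_ge_1 : 1 <= Cmod s.
Proof. generalize (re_le_Cmod s) (Rle_abs (Re s)). simpl. lra. Qed.

Lemma far_E : exists K, 0 < K /\ far (fun W => Cmod (E W) <= K * exp (- (2) * Re W)).
Proof.
  set (M := a * k * Cmod s - Rabs b * (a - 1)).
  assert (HM : Rabs b <= M) by apply (core_bound_ge HC).
  generalize (Rabs_pos b); intros Hb0.
  exists (2 * (M + Rabs b + 1)). split; [lra|].
  generalize (far_gt 1). apply filter_imp. intros W HW.
  assert (B := core_E _ _ _ _ _ _ HC W ltac:(lra)). fold M in B.
  assert (B' : Cmod (a * (1 - exp (2 * Re W))%R * E W) <= M + Rabs b).
  { replace (a * (1 - exp (2 * Re W))%R * E W)%C
      with ((Ci * b + a * (1 - exp (2 * Re W))%R * E W) + - (Ci * b))%C by ring.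
    eapply Rle_trans; [apply Cmod_triangle|]. rewrite Cmod_opp, (Cmod_mult Ci), Cmod_Ci, Cmod_R. lra. }
  rewrite !Cmod_mult, !Cmod_R, (Rabs_pos_eq a) in B' by lra.
  assert (Hx : 2 <= exp (2 * Re W)).
  { apply Rle_trans with (exp 1); [generalize (exp_ineq1_le 1); lra|]. left. apply exp_increasing. lra. }
  rewrite Rabs_left1 in B' by lra.
  replace (- (2) * Re W) with (- (2 * Re W)) by ring. rewrite exp_Ropp.
  set (y := exp (2 * Re W)) in *. generalize (Cmod_ge_0 (E W)). intros He.
  apply Rmult_le_reg_r with y; [lra|].
  rewrite Rmult_assoc, Rinv_l, Rmult_1_r by lra.
  assert (y / 2 * Cmod (E W) <= a * (- (1 - y)) * Cmod (E W)).
  { apply Rmult_le_compat_r; auto. nra. }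
  lra.
Qed.

Lemma far_L : exists K, 0 < K /\ far (fun W => Cmod (L W - W) <= K * exp (- (2) * Re W)).
Proof.
  destruct (core_infty _ _ _ _ _ _ HC) as (X & K & HX & H).
  exists (Rabs K + 1). generalize (Rabs_pos K); intros HK. split; [lra|].
  exists X. split; auto. intros W HW. eapply Rle_trans; [now apply H|].
  apply Rmult_le_compat_r; [left; apply exp_pos|]. generalize (Rle_abs K). lra.
Qed.

(** With w = exp W, the branch of (g(w) / w)^(1/s) that tends to 1 at infinity. *)
Let rho (W : C) : C := cexp ((L W - W) / s).
Let n (W : C) : C := (q W * rho W)%C.

Lemma wd_rho W : 0 < Re W -> wd rho W (rho W * ((q W - 1) / s))%C 0.
Proof.
  intros HW. eapply wd_eq; [| |apply (wd_cexpf (fun W => (L W - W) / s)%C)].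
  - reflexivity.
  - instantiate (1 := 0%C). ring.
  - eapply wd_ext; [|eapply wd_eq; [| |apply (wd_scal (/ s)%C), wd_minus; [apply (core_L _ _ _ _ _ _ HC); auto|apply wd_id]]].
    + apply filter_forall. intros z. unfold Cdiv. ring.
    + unfold Cdiv. ring.
    + ring.
Qed.

Lemma wd_n W : 0 < Re W -> wd n W (- n W * E W / s)%C 0.
Proof.
  intros HW. eapply wd_eq; [| |apply wd_mult; [now apply (core_q _ _ _ _ _ _ HC)|now apply wd_rho]].
  - unfold n. field. auto.
  - ring.
Qed.

Lemma rd_horizontal f W x al : wd f (W + RtoC x) al 0 -> rd (fun x => f (W + RtoC x)%C) x al.
Proof.
  intros H. assert (H' := rd_of_wd f W 1 x al 0).
  replace (W + RtoC x * 1)%C with (W + RtoC x)%C in H' by ring. specialize (H' H).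
  replace (al * 1 + 0 * Cconj 1)%C with al in H' by ring.
  intros e He. destruct (H' e He) as (d & Hd & A). exists d. split; auto.
  intros h Hh. specialize (A h Hh). rewrite !Cmult_1_r in A. exact A.
Qed.

(** exp(1/s) has modulus exp(a / |s|^2) > 1. The proof of [far_n] divides by this difference. *)
Lemma omega_nz : (cexp (/ s) - 1)%C <> 0.
Proof.
  intros X. assert (H : cexp (/ s) = 1%C) by (replace (cexp (/ s)) with ((cexp (/ s) - 1) + 1)%C by ring; rewrite X; ring).
  apply (f_equal Cmod) in H. rewrite Cmod_cexp, Cmod_1, <- exp_0 in H. apply exp_inv in H.
  simpl in H. assert (0 < a ^ 2 + b ^ 2) by (simpl; nra).
  apply Rmult_eq_compat_r with (r := a ^ 2 + b ^ 2) in H. simpl in H. field_simplify in H; [lra|].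
  simpl in H0. nra.
Qed.

Lemma far_rho : exists K, 0 < K /\ far (fun W => Cmod (rho W - 1) <= K * exp (- (2) * Re W)).
Proof.
  destruct far_L as (K & HK & HL). destruct cexp_near_0 as (r & Hr & Hexp).
  exists (2 * K). split; [lra|].
  assert (Hd : 0 < r / (2 * K)) by (apply Rdiv_lt_0_compat; lra).
  generalize (filter_and _ _ HL (far_exp _ Hd)). apply filter_imp. intros W [H1 H2].
  assert (H3 : Cmod ((L W - W) / s) <= K * exp (- (2) * Re W)).
  { rewrite Cmod_div by auto. generalize s_ge_1 (Cmod_ge_0 (L W - W)). intros.
    apply Rle_trans with (Cmod (L W - W)); auto.
    apply Rmult_le_reg_r with (Cmod s); [lra|]. unfold Rdiv. rewrite Rmult_assoc, Rinv_l by lra. nra. }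
  unfold rho. eapply Rle_trans; [apply Hexp|lra].
  eapply Rle_lt_trans; [exact H3|].
  apply Rmult_le_compat_l with (r := K) in H2; [|lra].
  replace (K * (r / (2 * K))) with (r / 2) in H2 by (field; lra). lra.
Qed.

(* With [n = q exp((L - W)/s)] one has [n' = - n E / s], so [n] is nearly constant on unit
   horizontal segments; integrating [exp(L/s)' = n exp(W/s) / s] over one of them and
   comparing with [exp(L/s) = (1 + o(1)) exp(W/s)] identifies this constant as [1]. *)
Lemma far_n : exists K, 0 < K /\ far (fun W => Cmod (n W - 1) <= K * exp (- (2) * Re W)).
Proof.
  destruct far_E as (KE & HKE & FE). destruct far_rho as (Kr & HKr & Fr).
  set (w := Cmod (cexp (/ s) - 1)).
  assert (Hw : 0 < w) by (apply Cmod_pos, omega_nz).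
  exists (2 / w * (6 * KE + 4 * Kr)). split.
  { apply Rmult_lt_0_compat; [apply Rdiv_lt_0_compat; lra|lra]. }
  (* Makes e at most 1/2, as [gronwall_segment] asks, and at most w / 12, so that 6 e |1 - n W| is
     absorbed by half of w |1 - n W| at the end. *)
  set (d := Rmin (1 / 2) (w / 12) / KE).
  assert (Hd : 0 < d) by (apply Rdiv_lt_0_compat; [apply Rmin_pos; lra|lra]).
  generalize (filter_and _ _ (far_shift _ FE) (filter_and _ _ (far_shift _ Fr) (filter_and _ _ (far_exp d Hd) (far_gt 0)))).
  apply filter_imp. intros W (F1 & F2 & F3 & HW).
  set (e := KE * exp (- (2) * Re W)).
  assert (He0 : 0 < e) by (apply Rmult_lt_0_compat; [lra|apply exp_pos]).
  assert (Hed : e <= Rmin (1 / 2) (w / 12)).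
  { unfold e. apply Rmult_le_compat_l with (r := KE) in F3; [|lra].
    unfold d in F3. replace (KE * (Rmin (1 / 2) (w / 12) / KE)) with (Rmin (1 / 2) (w / 12)) in F3 by (field; lra).
    exact F3. }
  assert (He1 : e <= 1 / 2) by (eapply Rle_trans; [exact Hed|apply Rmin_l]).
  assert (He2 : e <= w / 12) by (eapply Rle_trans; [exact Hed|apply Rmin_r]).
  assert (Hmono : forall x, 0 <= x -> exp (- (2) * Re (W + RtoC x)) <= exp (- (2) * Re W)).
  { intros x Hx. destruct (Req_dec x 0) as [->|N]; [right; f_equal; destruct W; simpl; ring|].
    left. apply exp_increasing. destruct W; simpl. lra. }
  assert (Hpos : forall x, 0 <= x -> 0 < Re (W + RtoC x)) by (intros; destruct W; simpl in *; lra).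
  assert (S1 := s_ge_1).
  assert (Dn : forall x, 0 <= x <= 1 -> exists v, rd (fun x => n (W + RtoC x)%C) x v /\ Cmod v <= e * Cmod (n (W + RtoC x))).
  { intros x Hx. eexists. split; [apply rd_horizontal, wd_n, Hpos; lra|].
    rewrite Cmod_div, Cmod_mult, Cmod_opp by auto.
    assert (B : Cmod (E (W + RtoC x)) <= e).
    { eapply Rle_trans; [now apply F1|]. apply Rmult_le_compat_l; [lra|]. apply Hmono; lra. }
    generalize (Cmod_ge_0 (n (W + RtoC x))) (Cmod_ge_0 (E (W + RtoC x))). intros.
    apply Rmult_le_reg_r with (Cmod s); [lra|]. unfold Rdiv. rewrite Rmult_assoc, Rinv_l, Rmult_1_r by lra.
    apply Rle_trans with (e * Cmod (n (W + RtoC x)) * 1); [nra|]. apply Rmult_le_compat_l; [nra|lra]. }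
  assert (Gn : forall x, 0 <= x <= 1 -> Cmod (n (W + RtoC x)) <= 2 * Cmod (n W)).
  { intros x Hx. generalize (gronwall_segment (fun x => n (W + RtoC x)%C) e x Hx ltac:(lra) Dn).
    replace (W + RtoC 0)%C with W by ring. auto. }
  assert (Dif : forall x, 0 <= x <= 1 -> Cmod (n (W + RtoC x) - n W) <= 2 * e * Cmod (n W)).
  { intros x Hx.
    assert (R := rd_lip (fun x => n (W + RtoC x)%C) 0 (2 * e * Cmod (n W)) 0 x).
    simpl in R. replace (W + RtoC 0)%C with W in R by ring.
    replace (n (W + RtoC x) - n W - 0 * RtoC (x - 0))%C with (n (W + RtoC x) - n W)%C in R by ring.
    eapply Rle_trans; [apply R|].
    - intros y Hy. rewrite Rmin_left, Rmax_right in Hy by lra.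
      destruct (Dn y ltac:(lra)) as (v & Hv & Hl). exists v. split; auto.
      replace (v - 0)%C with v by ring. generalize (Gn y ltac:(lra)). nra.
    - rewrite Rabs_pos_eq by lra. generalize (Cmod_ge_0 (n W)). intros.
      assert (0 <= 2 * e * Cmod (n W)) by (apply Rmult_le_pos; lra). nra. }
  (* If [n] were constant on the segment, [G] would be constant too: its derivative contains only n
     (W + x) - n W. *)
  set (G := fun x : R => (cexp (L (W + RtoC x) / s) - n W * cexp ((W + RtoC x) / s))%C).
  assert (EG : forall x, G x = (cexp ((W + RtoC x) / s) * (rho (W + RtoC x) - n W))%C).
  { intros x. unfold G, rho. 
    replace (cexp (L (W + RtoC x) / s)) with (cexp ((W + RtoC x) / s) * cexp ((L (W + RtoC x) - (W + RtoC x)) / s))%C.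
    - ring.
    - rewrite <- cexp_plus. f_equal. field. auto. }
  assert (Hre : Rabs (Re (/ s)) <= 1).
  { eapply Rle_trans; [apply re_le_Cmod|]. rewrite Cmod_inv by auto.
    rewrite <- Rinv_1. apply Rinv_le_contravar; lra. }
  assert (Bexp : forall x, 0 <= x <= 1 -> Cmod (cexp ((W + RtoC x) / s)) <= 3 * Cmod (cexp (W / s))).
  { intros x Hx. replace ((W + RtoC x) / s)%C with (RtoC x * / s + W / s)%C by (field; auto).
    rewrite cexp_plus, Cmod_mult. apply Rmult_le_compat_r; [apply Cmod_ge_0|].
    rewrite Cmod_cexp. apply Rle_trans with (exp 1); [|apply exp_le_3].
    replace (Re (RtoC x * / s)) with (x * Re (/ s)) by (simpl; ring).
    apply exp_le.
    assert (x * Re (/ s) <= 1); [|lra].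
    generalize (Rle_abs (Re (/ s))). intros. nra. }
  assert (DG : Cmod (G 1 - G 0) <= 6 * e * Cmod (n W) * Cmod (cexp (W / s))).
  { assert (R := rd_lip G 0 (6 * e * Cmod (n W) * Cmod (cexp (W / s))) 0 1).
    replace (G 1 - G 0 - 0 * RtoC (1 - 0))%C with (G 1 - G 0)%C in R by ring.
    eapply Rle_trans; [apply R|].
    - intros x Hx. rewrite Rmin_left, Rmax_right in Hx by lra.
      exists (/ s * cexp ((W + RtoC x) / s) * (n (W + RtoC x) - n W))%C. split.
      + apply (rd_horizontal (fun Z => cexp (L Z / s) - n W * cexp (Z / s))%C).
        assert (P := Hpos x ltac:(lra)).
        assert (D1 : wd (fun Z => cexp (L Z / s)) (W + RtoC x) (cexp (L (W + RtoC x) / s) * (/ s * q (W + RtoC x)))%C (cexp (L (W + RtoC x) / s) * (/ s * 0))%C).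
        { apply (wd_cexpf (fun W => L W / s)%C). eapply wd_ext; [|exact (wd_scal (/ s)%C L _ _ 0 (core_L _ _ _ _ _ _ HC _ P))].
          apply filter_forall. intros z. unfold Cdiv. ring. }
        assert (D2 : wd (fun Z => cexp (Z / s)) (W + RtoC x) (cexp ((W + RtoC x) / s) * (/ s * 1))%C (cexp ((W + RtoC x) / s) * (/ s * 0))%C).
        { apply (wd_cexpf (fun W => W / s)%C). eapply wd_ext; [|exact (wd_scal (/ s)%C (fun z => z) _ _ 0 (wd_id _))].
          apply filter_forall. intros z. unfold Cdiv. ring. }
        eapply wd_eq; [| |apply (wd_minus _ _ _ _ _ _ _ D1 (wd_scal (n W) _ _ _ _ D2))].
        * unfold n at 2. unfold rho.
          replace (cexp (L (W + RtoC x) / s)) with (cexp ((W + RtoC x) / s) * cexp ((L (W + RtoC x) - (W + RtoC x)) / s))%C.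
          -- ring.
          -- rewrite <- cexp_plus. f_equal. field. auto.
        * ring.
      + replace (/ s * cexp ((W + RtoC x) / s) * (n (W + RtoC x) - n W) - 0)%C
          with (/ s * cexp ((W + RtoC x) / s) * (n (W + RtoC x) - n W))%C by ring.
        rewrite !Cmod_mult, Cmod_inv by auto.
        assert (I : 0 < / Cmod s <= 1).
        { split; [apply Rinv_0_lt_compat; lra|]. rewrite <- Rinv_1. apply Rinv_le_contravar; lra. }
        assert (B1 := Bexp x Hx). assert (B2 := Dif x Hx).
        replace (6 * e * Cmod (n W) * Cmod (cexp (W / s)))
          with (1 * (3 * Cmod (cexp (W / s))) * (2 * e * Cmod (n W))) by ring.
        apply Rmult_le_compat; auto using Cmod_ge_0.
        * apply Rmult_le_pos; [lra|apply Cmod_ge_0].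
        * apply Rmult_le_compat; auto using Cmod_ge_0; lra.
    - rewrite Rminus_0_r, Rabs_R1. lra. }
  set (c := cexp (W / s)) in *.
  assert (Hc : 0 < Cmod c) by (apply Cmod_pos, cexp_nz).
  rewrite !EG in DG.
  replace (cexp ((W + RtoC 0) / s)) with c in DG by (unfold c; f_equal; field; auto).
  replace (cexp ((W + RtoC 1) / s)) with (c * cexp (/ s))%C in DG
    by (unfold c; rewrite <- cexp_plus; f_equal; field; auto).
  replace (W + RtoC 0)%C with W in DG by ring.
  set (om := cexp (/ s)) in *.
  (* As [rho] is near 1 at both ends, the increment of [G] is nearly c (om - 1) (1 - n W); dividing
     by om - 1 isolates 1 - n W. *)
  replace (c * om * (rho (W + RtoC 1) - n W) - c * (rho W - n W))%C
    with (c * ((om - 1) * (1 - n W) + (om * (rho (W + RtoC 1) - 1) - (rho W - 1))))%C in DG by ring.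
  rewrite Cmod_mult in DG.
  assert (DG' : Cmod ((om - 1) * (1 - n W) + (om * (rho (W + RtoC 1) - 1) - (rho W - 1))) <= 6 * e * Cmod (n W)).
  { apply Rmult_le_reg_l with (Cmod c); auto. lra. }
  assert (Hom : Cmod om <= 3).
  { unfold om. rewrite Cmod_cexp. apply Rle_trans with (exp 1); [|apply exp_le_3].
    apply exp_le.
    generalize (Rle_abs (Re (/ s))). lra. }
  set (ex := exp (- (2) * Re W)) in *.
  assert (R1 : Cmod (rho (W + RtoC 1) - 1) <= Kr * ex).
  { eapply Rle_trans; [apply F2; lra|]. apply Rmult_le_compat_l; [lra|]. apply Hmono; lra. }
  assert (R0 : Cmod (rho W - 1) <= Kr * ex).
  { generalize (F2 0 ltac:(lra)). now replace (W + RtoC 0)%C with W by ring. }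
  assert (R3 : Cmod (om * (rho (W + RtoC 1) - 1) - (rho W - 1)) <= 4 * Kr * ex).
  { unfold Cminus at 1. eapply Rle_trans; [apply Cmod_triangle|]. rewrite Cmod_opp, Cmod_mult.
    generalize (Cmod_ge_0 om) (Cmod_ge_0 (rho (W + RtoC 1) - 1)). nra. }
  assert (R4 : w * Cmod (1 - n W) <= 6 * e * Cmod (n W) + 4 * Kr * ex).
  { unfold w. fold om. rewrite <- Cmod_mult.
    replace ((om - 1) * (1 - n W))%C with (((om - 1) * (1 - n W) + (om * (rho (W + RtoC 1) - 1) - (rho W - 1)))
       + - (om * (rho (W + RtoC 1) - 1) - (rho W - 1)))%C by ring.
    eapply Rle_trans; [apply Cmod_triangle|]. rewrite Cmod_opp. lra. }
  assert (R5 : Cmod (n W) <= 1 + Cmod (1 - n W)).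
  { generalize (Cmod_rev (n W) 1). rewrite Cmod_1, Cmod_sub_sym. lra. }
  rewrite Cmod_sub_sym.
  assert (R6 : w / 2 * Cmod (1 - n W) <= (6 * KE + 4 * Kr) * ex).
  { fold e in R4. generalize (Cmod_ge_0 (1 - n W)). intros. 
    assert (6 * e * Cmod (n W) <= 6 * e * (1 + Cmod (1 - n W))) by (apply Rmult_le_compat_l; lra).
    assert (6 * e * Cmod (1 - n W) <= w / 2 * Cmod (1 - n W)) by (apply Rmult_le_compat_r; lra).
    unfold e in *. lra. }
  apply Rmult_le_reg_l with (w / 2); [lra|].
  replace (w / 2 * (2 / w * (6 * KE + 4 * Kr) * ex)) with ((6 * KE + 4 * Kr) * ex) by (field; lra).
  exact R6.
Qed.

Lemma far_q : exists K, 0 < K /\ far (fun W => Cmod (q W - 1) <= K * exp (- (2) * Re W)).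
Proof.
  destruct far_n as (K & HK & Fn). destruct far_rho as (Kr & HKr & Fr).
  exists (2 * (K + Kr)). split; [lra|].
  assert (Hd : 0 < 1 / (2 * Kr)) by (apply Rdiv_lt_0_compat; lra).
  generalize (filter_and _ _ Fn (filter_and _ _ Fr (far_exp _ Hd))).
  apply filter_imp. intros W (H1 & H2 & H3).
  apply Rmult_le_compat_l with (r := Kr) in H3; [|lra].
  replace (Kr * (1 / (2 * Kr))) with (1 / 2) in H3 by (field; lra).
  assert (H4 : 1 / 2 <= Cmod (rho W)).
  { generalize (Cmod_rev 1 (rho W)). rewrite Cmod_1, Cmod_sub_sym. lra. }
  assert (H5 : Cmod (q W - 1) * Cmod (rho W) <= (K + Kr) * exp (- (2) * Re W)).
  { rewrite <- Cmod_mult. replace ((q W - 1) * rho W)%C with ((n W - 1) + - (rho W - 1))%C by (unfold n; ring).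
    eapply Rle_trans; [apply Cmod_triangle|]. rewrite Cmod_opp. lra. }
  generalize (Cmod_ge_0 (q W - 1)). nra.
Qed.

End Far.

(** * Univalence of the chain *)

Lemma Clog_scale r z : 0 < r -> slit z -> Clog (RtoC r * z) = (RtoC (ln r) + Clog z)%C.
Proof.
  intros Hr Hz. apply cexp_inj_small.
  - rewrite cexp_plus, cexp_real, exp_ln, !Clog_exp; auto.
    destruct Hz as [H|H]; [left|right]; destruct z; simpl in *; nra.
  - generalize (Clog_Im (RtoC r * z)) (Clog_Im z). intros H1 H2.
    replace (Im (Clog (RtoC r * z) - (RtoC (ln r) + Clog z))) with (Im (Clog (RtoC r * z)) - Im (Clog z))
      by (unfold Clog; simpl; ring).
    apply Rabs_def2 in H1, H2. apply Rabs_def1; lra.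
Qed.

Lemma far_product K d : 0 < K -> 0 < d -> exists R0, 0 < R0 /\ forall xi t, t + R0 <= xi -> 0 <= t ->
  exp (2 * t) * (K * exp (- (2) * xi)) <= d.
Proof.
  intros HK Hd. exists (Rmax 1 (- ln (d / K) / 2)).
  assert (H1 := Rmax_l 1 (- ln (d / K) / 2)). assert (H2 := Rmax_r 1 (- ln (d / K) / 2)).
  set (R0 := Rmax 1 (- ln (d / K) / 2)) in *. split; [lra|].
  intros xi t Hx Ht.
  replace (exp (2 * t) * (K * exp (- (2) * xi))) with (K * exp (2 * t + - (2) * xi))
    by (rewrite exp_plus; ring).
  assert (Hdk : 0 < d / K) by (apply Rdiv_lt_0_compat; lra).
  assert (exp (2 * t + - (2) * xi) <= d / K).
  { rewrite <- (exp_ln (d / K)) by auto.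
    apply exp_le. lra. }
  apply Rle_trans with (K * (d / K)); [apply Rmult_le_compat_l; lra|]. right. field. lra.
Qed.

Section Chain.
Context {a b k : R} {L q E : C -> C} (HC : core a b k L q E).

Let Ha : 1 <= a := core_a _ _ _ _ _ _ HC.
Let Hk : 0 <= k < 1 := core_k _ _ _ _ _ _ HC.
Notation s := (cpl a b).
Let Hs := @s_nz _ _ _ _ _ _ HC.
Notation chainP := (@chain_factor q).
Notation chainU := (@chain_log a b L q).
Notation speedU := (@chain_speed a b q).
Notation defect := (@chain_defect a b E).
Notation v := (slow a k).
Notation c := (fast a k).

Let Hv : a < v := slow_gt a k Ha Hk.
Let Hc : 0 < c := fast_pos a k Ha Hk.

(** The decay exp(-2 Re W) of q - 1, E and L - W outweighs the factor exp(2t) once Re W exceeds t by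
    a constant. For the bracket, chainP exp(2t) - 1 = -(exp(2t) - 1) (q - 1). *)
Lemma far_all d : 0 < d -> exists R0, 0 < R0 /\ forall W t, 0 <= t -> t + R0 <= Re W ->
  Cmod (q W - 1) <= d /\ Cmod ((exp (2 * t) - 1)%R * E W) <= d /\
  Cmod (chainP W t * exp (2 * t) - 1) <= d /\ Cmod (L W - W) <= d.
Proof.
  intros Hd.
  destruct (far_q HC) as (K1 & HK1 & X1 & HX1 & F1).
  destruct (far_E HC) as (K2 & HK2 & X2 & HX2 & F2).
  destruct (far_L HC) as (K3 & HK3 & X3 & HX3 & F3).
  destruct (far_product K1 d HK1 Hd) as (R1 & HR1 & P1).
  destruct (far_product K2 d HK2 Hd) as (R2 & HR2 & P2).
  destruct (far_product K3 d HK3 Hd) as (R3 & HR3 & P3).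
  exists (X1 + X2 + X3 + R1 + R2 + R3). split; [lra|]. intros W t Ht HW.
  specialize (F1 W ltac:(lra)). specialize (F2 W ltac:(lra)). specialize (F3 W ltac:(lra)).
  specialize (P1 (Re W) t ltac:(lra) Ht). specialize (P2 (Re W) t ltac:(lra) Ht).
  specialize (P3 (Re W) t ltac:(lra) Ht).
  assert (He : 1 <= exp (2 * t)) by (generalize (exp_ineq1_le (2 * t)); lra).
  generalize (Cmod_ge_0 (q W - 1)) (Cmod_ge_0 (E W)) (Cmod_ge_0 (L W - W)). intros.
  assert (A1' : exp (2 * t) * Cmod (q W - 1) <= d).
  { eapply Rle_trans; [|exact P1]. apply Rmult_le_compat_l; lra. }
  assert (A2' : exp (2 * t) * Cmod (E W) <= d).
  { eapply Rle_trans; [|exact P2]. apply Rmult_le_compat_l; lra. }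
  assert (A3' : exp (2 * t) * Cmod (L W - W) <= d).
  { eapply Rle_trans; [|exact P3]. apply Rmult_le_compat_l; lra. }
  split; [nra|]. split; [|split; [|nra]].
  - rewrite Cmod_mult, Cmod_R, Rabs_pos_eq by lra. nra.
  - replace (chainP W t * exp (2 * t) - 1)%C with (- ((exp (2 * t) - 1)%R * (q W - 1)))%C.
    + rewrite Cmod_opp, Cmod_mult, Cmod_R, Rabs_pos_eq by lra. nra.
    + unfold chain_factor. assert (Hx := exp_cancel t).
      rewrite !RtoC_minus.
      replace ((1 - (1 - exp (- (2) * t)) * q W) * exp (2 * t) - 1)%C
        with (exp (2 * t) - exp (2 * t) * q W + (exp (- (2) * t) * exp (2 * t)) * q W - 1)%C by ring.
      rewrite Hx. ring.
Qed.

(** As v > a >= 1, a point advancing with speed v overtakes the line Re W = t + R0, which moves with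
    speed 1. *)
Lemma late_time t R0 : 0 <= t -> 0 < R0 -> exists T, t <= T /\ T + R0 <= v * (T - t).
Proof.
  intros Ht HR. assert (Hv1 : 1 < v) by lra. exists ((R0 + v * t) / (v - 1)). split.
  - apply Rmult_le_reg_r with (v - 1); [lra|]. unfold Rdiv. rewrite Rmult_assoc, Rinv_l by lra. lra.
  - apply Rmult_le_reg_r with (v - 1); [lra|]. right. field. lra.
Qed.

Lemma chainP_nz W t : region a W t -> chainP W t <> 0.
Proof.
  intros HR H0. assert (HR' := HR). destruct HR' as (Ht & HW & _).
  destruct (far_all (1 / 2)) as (R0 & HR0 & F); [lra|].
  destruct (late_time t R0 Ht HR0) as (T & HT & HTR).
  (* The zero set of [chainP] is the zero level of [chainV], since the exponential factor has no
     zeros. A zero would survive until time T, when chainP exp(2T) is close to 1. *)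
  destruct (flow a v c (fun W t => chainP W t = 0) Ha (Rlt_le _ _ Hv) Hc) with (z := W) (t0 := t) (t := T)
    as (w & Hw & [Adv _]); auto.
  - intros p u Hp. destruct (normal_step a k _ _ p u Ha Hk (normal_V HC p u Hp)) as (r & Hr & A).
    exists r. split; auto. intros z x x' Hz Hx Hzero Hx'.
    destruct (A z x x' Hz Hx) as (w & Hw & Hd); [rewrite Rabs_pos_eq; lra|].
    exists w. split; [|apply drift_advance; auto; lra].
    unfold chain_root in Hw. rewrite Hzero, Cmult_0_r in Hw.
    destruct (classic (chainP w x' = 0)) as [|N]; auto. exfalso.
    apply (Cmult_nz (cexp (L w / s)) (chainP w x')); auto. apply cexp_nz.
  - destruct (F w T) as (_ & _ & B & _); [lra| |].
    + destruct w, W; simpl in *. lra.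
    + rewrite Hw in B. replace (0 * exp (2 * T) - 1)%C with (- (1))%C in B by ring.
      rewrite Cmod_opp, Cmod_1 in B. lra.
Qed.

(* For fixed [W] the values [chainP W t] move away from [1] along a ray as [t] grows,
   so they could only reach the negative axis through [0]. *)
Lemma chainP_slit W t : region a W t -> slit (chainP W t).
Proof.
  intros HR. apply NNPP. intros N. unfold slit in N. apply not_or_and in N. destruct N as [N1 N2].
  apply NNPP in N2. destruct HR as (Ht & HW & HR).
  set (cc := 1 - exp (- (2) * t)).
  assert (Hcc : 0 <= cc < 1).
  { unfold cc. generalize (exp_pos (- (2) * t)). split; [|lra].
    assert (exp (- (2) * t) <= exp 0); [|rewrite exp_0 in *; lra].
    apply exp_le. lra. }
  set (y := 1 - Re (chainP W t)).
  assert (Hy : 1 <= y) by (unfold y; lra).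
  assert (Eq : (cc * q W)%C = RtoC y).
  { replace (cc * q W)%C with (1 - chainP W t)%C by (unfold chain_factor, cc; ring).
    unfold y. apply C_ext; [simpl; ring|]. change (0 - Im (chainP W t) = 0). rewrite N2. ring. }
  assert (Hcy : 0 <= cc / y <= cc).
  { split; [apply Rmult_le_pos; [lra|left; apply Rinv_0_lt_compat; lra]|].
    apply Rmult_le_reg_r with y; [lra|]. unfold Rdiv. rewrite Rmult_assoc, Rinv_l by lra. nra. }
  (* The time at which the ray meets 0: there 1 - exp(-2 t') = cc / y, while cc q = y. As y >= 1,
     this time is at most t and still belongs to the region. *)
  set (t' := - ln (1 - cc / y) / 2).
  assert (Et : exp (- (2) * t') = 1 - cc / y).
  { unfold t'. replace (- (2) * (- ln (1 - cc / y) / 2)) with (ln (1 - cc / y)) by field.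
    apply exp_ln. lra. }
  assert (Ht' : 0 <= t' <= t).
  { split.
    - apply Rnot_lt_le. intros L0. assert (exp 0 < exp (- (2) * t')) by (apply exp_increasing; lra).
      rewrite exp_0 in H. lra.
    - apply Rnot_lt_le. intros L0. assert (exp (- (2) * t') < exp (- (2) * t)) by (apply exp_increasing; lra).
      unfold cc in *. lra. }
  apply (chainP_nz W t').
  - repeat split; try lra. nra.
  - unfold chain_factor. rewrite Et. replace (1 - (1 - cc / y)) with (cc / y) by ring.
    rewrite RtoC_div by lra.
    replace (cc / y * q W)%C with (cc * q W / y)%C.
    + rewrite Eq. unfold Cdiv. rewrite Cinv_r; [ring|]. intros X; apply RtoC_inj in X; lra.
    + field. intros X; apply RtoC_inj in X; lra.
Qed.

Lemma chainU_step p t : region a p t ->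
  exists r, 0 < r /\ forall z u u', Cmod (z - p) < r -> Rabs (u - t) < r -> Rabs (u' - u) < r ->
    exists w, chainU w u' = chainU z u /\ drift a k (w - z) (u' - u).
Proof.
  intros Hp. eapply normal_step; eauto. apply (normal_U HC); auto. now apply chainP_slit.
Qed.

Lemma chainU_flow W t0 t : region a W t0 -> t0 <= t ->
  exists w, chainU w t = chainU W t0 /\ advance v c (w - W) (t - t0).
Proof.
  intros HR Ht.
  apply (flow a v c (fun w u => chainU w u = chainU W t0)); auto; try lra.
  intros p u Hp. destruct (chainU_step p u Hp) as (r & Hr & A). exists r. split; auto.
  intros z x x' Hz Hx HS Hx'. destruct (A z x x' Hz Hx) as (w & Hw & Hd); [rewrite Rabs_pos_eq; lra|].
  exists w. split; [congruence|]. apply drift_advance; auto; lra.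
Qed.

Lemma advance_region W w t0 t : region a W t0 -> t0 <= t -> advance v c (w - W) (t - t0) ->
  region a w t /\ (t0 < t -> a * t < Re w).
Proof.
  intros (H1 & H2 & H3) Ht [A _].
  assert (B : a * (t - t0) <= v * (t - t0)) by (apply Rmult_le_compat_r; lra).
  assert (0 <= a * (t - t0)) by nra.
  assert (Re (w - W) = Re w - Re W) by (destruct w, W; reflexivity).
  repeat split; try lra. intros. assert (a * (t - t0) < v * (t - t0)) by (apply Rmult_lt_compat_r; lra). lra.
Qed.

Lemma chainU_far : exists R0, 0 < R0 /\ forall W t, 0 <= t -> t + R0 <= Re W ->
  (exists al, wd (fun W => chainU W t) W al 0 /\ Cmod (al - 1) <= 1 / 2) /\
  Cmod (chainU W t - (W - RtoC (2 * t) * s)) <= 1.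
Proof.
  destruct Clog_near_1 as (r & Hr & Hlog). assert (S1 := s_ge_1 HC).
  (* The three bounds serve [Clog_near_1], the estimate of the derivative, and |s| |Clog| <= 1/2. *)
  set (d := Rmin (r / 2) (Rmin (1 / 20) (1 / (4 * Cmod s)))).
  assert (Hd : 0 < d).
  { repeat apply Rmin_pos; try lra. apply Rdiv_lt_0_compat; lra. }
  assert (D1 : d <= r / 2) by apply Rmin_l.
  assert (D2 : d <= 1 / 20) by (eapply Rle_trans; [apply Rmin_r|apply Rmin_l]).
  assert (D3 : d <= 1 / (4 * Cmod s)) by (eapply Rle_trans; [apply Rmin_r|apply Rmin_r]).
  apply Rmult_le_compat_r with (r := Cmod s) in D3; [|lra].
  replace (1 / (4 * Cmod s) * Cmod s) with (1 / 4) in D3 by (field; lra).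
  destruct (far_all d Hd) as (R0 & HR0 & F).
  exists R0. split; auto. intros W t Ht HW. destruct (F W t Ht HW) as (F1 & F2 & F3 & F4).
  assert (He : 0 < exp (2 * t)) by apply exp_pos.
  destruct (Hlog (chainP W t * exp (2 * t))%C ltac:(lra)) as [Hsl Hcl].
  assert (EP : chainP W t = (RtoC (exp (- (2) * t)) * (chainP W t * exp (2 * t)))%C).
  { assert (Hx := exp_cancel t).
    replace (exp (- (2) * t) * (chainP W t * exp (2 * t)))%C with ((exp (- (2) * t) * exp (2 * t)) * chainP W t)%C by ring.
    rewrite Hx. ring. }
  assert (HP : slit (chainP W t)).
  { rewrite EP. generalize (exp_pos (- (2) * t)). intros.
    destruct Hsl as [H1|H1]; [left|right].
    - rewrite re_scal_l. nra.
    - rewrite im_scal_l. nra. }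
  assert (HPn := slit_nz _ HP).
  split.
  - eexists. split; [apply (wd_chainU HC); auto; lra|].
    assert (X := defect_eq HC W t).
    replace (speedU W t * (1 - defect W t) - 1)%C
      with (q W * ((1 + (exp (2 * t) - 1)%R * E W) / (chainP W t * exp (2 * t))) - 1)%C.
    + set (pe := (chainP W t * exp (2 * t))%C) in *.
      set (ee := ((exp (2 * t) - 1)%R * E W)%C) in *.
      assert (Hpe : 19 / 20 <= Cmod pe).
      { generalize (Cmod_rev 1 pe). rewrite Cmod_1, Cmod_sub_sym. lra. }
      assert (Hpn : pe <> 0) by (intros Y; rewrite Y, Cmod_0 in Hpe; lra).
      apply Rmult_le_reg_r with (Cmod pe); [lra|].
      rewrite <- Cmod_mult.
      replace ((q W * ((1 + ee) / pe) - 1) * pe)%C with ((q W - 1) * (1 + ee) + (ee + - (pe - 1)))%C by (field; auto).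
      eapply Rle_trans; [apply Cmod_triangle|]. rewrite Cmod_mult.
      assert (Cmod (1 + ee) <= 2) by (eapply Rle_trans; [apply Cmod_triangle|]; rewrite Cmod_1; lra).
      assert (Cmod (ee + - (pe - 1)) <= 1 / 10) by (eapply Rle_trans; [apply Cmod_triangle|]; rewrite Cmod_opp; lra).
      generalize (Cmod_ge_0 (q W - 1)) (Cmod_ge_0 (1 + ee)). intros.
      assert (Cmod (q W - 1) * Cmod (1 + ee) <= 1 / 20 * 2) by (apply Rmult_le_compat; lra). lra.
    + unfold speedU.
      replace (s * exp (- (2) * t) * q W / (a * chainP W t) * (1 - defect W t))%C
        with (q W / chainP W t * (s * exp (- (2) * t) / a * (1 - defect W t)))%C
        by (field; repeat split; auto; apply (a_nz HC)).
      rewrite <- X.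
      assert (Hx := exp_cancel t).
      assert (Hx2 : RtoC (exp (- (2) * t)) = (/ exp (2 * t))%C).
      { replace (RtoC (exp (- (2) * t))) with (exp (- (2) * t) * exp (2 * t) * / exp (2 * t))%C by (field; apply expc_nz).
        rewrite Hx. field. apply expc_nz. }
      rewrite !RtoC_minus, Hx2. field. split; auto. apply expc_nz.
  - unfold chain_log. rewrite EP, Clog_scale by (auto; apply exp_pos). rewrite ln_exp.
    replace (L W + s * (RtoC (- (2) * t) + Clog (chainP W t * exp (2 * t))) - (W - RtoC (2 * t) * s))%C
      with ((L W - W) + s * Clog (chainP W t * exp (2 * t)))%C.
    + eapply Rle_trans; [apply Cmod_triangle|]. rewrite Cmod_mult.
      assert (Cmod s * Cmod (Clog (chainP W t * exp (2 * t))) <= Cmod s * (2 * d)).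
      { apply Rmult_le_compat_l; lra. }
      lra.
    + rewrite !RtoC_mult, RtoC_opp. ring.
Qed.

Lemma chainU_far_inj R0 t : 
  (forall W, R0 <= Re W -> exists al, wd (fun W => chainU W t) W al 0 /\ Cmod (al - 1) <= 1 / 2) ->
  forall W W', R0 <= Re W -> R0 <= Re W' ->
  Cmod (chainU W t - chainU W' t - (W - W')) <= 1 / 2 * Cmod (W - W').
Proof.
  intros H W W' HW HW'.
  replace (W - W')%C with (1 * (W - W'))%C at 1 by ring.
  apply (mvt_seg (fun W => chainU W t)). intros x Hx.
  destruct (H (W' + RtoC x * (W - W'))%C) as (al & Hal & Hb).
  { destruct W, W'; simpl in *. nra. }
  exists al, 0. rewrite Cmod_0, Rplus_0_r. auto.
Qed.

Lemma chainU_inj W W' t : region a W t -> region a W' t -> chainU W t = chainU W' t -> W = W'.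
Proof.
  intros HR HR' HE. apply NNPP. intros N.
  destruct chainU_far as (R0 & HR0 & F).
  assert (Ht : 0 <= t) by apply HR.
  destruct (late_time t R0 Ht HR0) as (T & HT & HTR).
  destruct (flow_pair a v c (fun z z' u => z <> z' /\ chainU z u = chainU z' u) Ha (Rlt_le _ _ Hv) Hc)
    with (z := W) (z' := W') (t0 := t) (t := T) as (w & w' & (Hne & Heq) & A & A'); auto.
  (* If both curves cluster at the same point, local injectivity forbids distinct points with equal
     values there. Otherwise a step short compared with the distance of the two cluster points
     cannot make the curves meet. *)
  - intros p p' u Hp Hp'. destruct (classic (p = p')) as [<-|Npp].
    + destruct (normal_inj a k _ _ p u Ha Hk (normal_U HC p u Hp (chainP_slit p u Hp))) as (r & Hr & I).
      exists r. split; auto. intros z z' x x' Hz Hz' Hx (Hne & Heq) _. exfalso. apply Hne.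
      eapply I; eauto.
    + destruct (chainU_step p u Hp) as (r & Hr & S). destruct (chainU_step p' u Hp') as (r' & Hr' & S').
      (* Each curve is within dd of its cluster point and moves by at most c dd, so together they
         bridge at most half of the distance. *)
      set (dd := Cmod (p - p') / (4 * (1 + c))).
      assert (Hpp : 0 < Cmod (p - p')).
      { apply Cmod_pos. intros X. apply Npp. replace p with ((p - p') + p')%C by ring. rewrite X. ring. }
      assert (Hdd : 0 < dd) by (apply Rdiv_lt_0_compat; lra).
      exists (Rmin dd (Rmin r r')). split; [repeat apply Rmin_pos; auto|].
      intros z z' x x' Hz Hz' Hx (Hne & Heq) Hx'.
      assert (M1 := Rmin_l dd (Rmin r r')). assert (M2 := Rmin_r dd (Rmin r r')).
      assert (M3 := Rmin_l r r'). assert (M4 := Rmin_r r r').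
      destruct (S z x x') as (w & Hw & Hdr); try lra. { rewrite Rabs_pos_eq; lra. }
      destruct (S' z' x x') as (w' & Hw' & Hdr'); try lra. { rewrite Rabs_pos_eq; lra. }
      apply drift_advance in Hdr, Hdr'; auto; try lra.
      exists w, w'. split; [split|split]; auto; [|congruence].
      intros Ew. destruct Hdr as [_ G1], Hdr' as [_ G2]. rewrite <- Ew in G2.
      generalize (Cmod_tri3 p z p') (Cmod_tri3 z w p') (Cmod_tri3 w z' p').
      rewrite (Cmod_sub_sym p z), (Cmod_sub_sym z w).
      assert (c * (x' - x) <= c * dd) by (apply Rmult_le_compat_l; lra).
      assert (Edd : 4 * dd + 4 * (c * dd) = Cmod (p - p')) by (unfold dd; field; lra).
      lra.
  - apply Hne. assert (HT0 : 0 <= T) by lra.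
    assert (Hbig : forall w W0, region a W0 t -> advance v c (w - W0) (T - t) -> T + R0 <= Re w).
    { intros x W0 (_ & H1 & _) [H2 _]. destruct x, W0; simpl in *. lra. }
    assert (B := chainU_far_inj (T + R0) T (fun W HW => proj1 (F W T HT0 HW)) w w' (Hbig _ _ HR A) (Hbig _ _ HR' A')).
    rewrite Heq in B. replace (chainU w' T - chainU w' T - (w - w'))%C with (- (w - w'))%C in B by ring.
    rewrite Cmod_opp in B. apply Cmod_eq0_sub. generalize (Cmod_ge_0 (w - w')). lra.
Qed.

Lemma chainU_0 W : chainU W 0 = L W.
Proof.
  unfold chain_log, chain_factor. rewrite Rmult_0_r, exp_0.
  replace (1 - (1 - 1)%R * q W)%C with (RtoC 1) by (apply C_ext; simpl; ring).
  rewrite Clog_1. ring.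
Qed.

End Chain.

(** * Boundary behaviour *)

Lemma turn_reduce (z : C) : exists n, 0 <= Im (z + turn n) <= 2 * PI.
Proof.
  generalize PI_RGT_0; intros Hpi.
  exists (- Int_part (Im z / (2 * PI)))%Z.
  destruct (base_Int_part (Im z / (2 * PI))) as [H1 H2].
  set (m := Int_part (Im z / (2 * PI))) in *.
  assert (E : Im (z + turn (- m)) = 2 * PI * (Im z / (2 * PI) - IZR m)).
  { unfold turn. destruct z; simpl. rewrite opp_IZR. field. lra. }
  rewrite E. nra.
Qed.

Lemma Re_turn z n : Re (z + turn n) = Re z.
Proof. destruct z; simpl. ring. Qed.

(** Periodicity reduces the strip to a rectangle, where a sequence with unbounded values would
    cluster at a point of continuity. *)
Lemma strip_bounded (f : C -> C) x1 x2 :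
  (forall W n, x1 <= Re W <= x2 -> f (W + turn n)%C = f W) ->
  (forall W, x1 <= Re W <= x2 -> ccont f W) ->
  exists K, forall W, x1 <= Re W <= x2 -> Cmod (f W) <= K.
Proof.
  intros Hper Hcont. apply NNPP. intros N.
  assert (Sq : forall n : nat, exists W, x1 <= Re W <= x2 /\ 0 <= Im W <= 2 * PI /\ INR n < Cmod (f W)).
  { intros n. apply NNPP. intros N'. apply N. exists (INR n). intros W HW.
    apply Rnot_lt_le. intros HL. apply N'. destruct (turn_reduce W) as (m & Hm).
    exists (W + turn m)%C. rewrite Re_turn, Hper; auto. }
  destruct (choice _ Sq) as (w & Hw).
  destruct (bw w (Rabs x1 + Rabs x2 + 2 * PI)) as (phi & z & Hphi & Hz).
  { intros n. destruct (Hw n) as (H1 & H2 & _). eapply Rle_trans; [apply Cmod_le_re_im|].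
    rewrite (Rabs_pos_eq (Im _)) by lra.
    assert (Rabs (Re (w n)) <= Rabs x1 + Rabs x2); [|lra].
    generalize (Rle_abs x1) (Rle_abs x2) (Rle_abs (- x1)) (Rle_abs (- x2)) (Rabs_pos x1) (Rabs_pos x2).
    rewrite !Rabs_Ropp. intros. apply Rabs_le. lra. }
  assert (HR : x1 <= Re z <= x2).
  { assert (G := limC_re _ _ Hz).
    split; apply le_epsilon; intros e He; destruct (G e He) as (n & Hn);
      specialize (Hn n (le_n _)); rewrite <- RtoC_minus, Cmod_R in Hn; apply Rabs_def2 in Hn;
      destruct (Hw (phi n)) as (H1 & _); lra. }
  destruct (limC_bounded _ _ (limC_comp _ _ _ Hz (Hcont z HR))) as (N0 & HN).
  destruct (INR_unbounded (Cmod (f z) + 1)) as (m & Hm).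
  specialize (HN (N0 + m)%nat ltac:(lia)). simpl in HN.
  destruct (Hw (phi (N0 + m)%nat)) as (_ & _ & H3).
  assert (INR m <= INR (phi (N0 + m)%nat)) by (apply le_INR; generalize (Hphi (N0 + m)%nat); lia).
  lra.
Qed.

Definition pw (x p : R) : R := exp (p * ln x).

Lemma pw_pos x p : 0 < pw x p.
Proof. apply exp_pos. Qed.

Lemma pw_small p e : 0 < p -> 0 < e -> exists d, 0 < d /\ forall x, 0 < x < d -> pw x p < e.
Proof.
  intros Hp He. exists (exp (ln e / p)). split; [apply exp_pos|]. intros x [H1 H2].
  unfold pw. rewrite <- (exp_ln e) by auto. apply exp_increasing.
  apply ln_increasing in H2; auto. rewrite ln_exp in H2.
  apply Rmult_lt_compat_l with (r := p) in H2; auto.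
  replace (p * (ln e / p)) with (ln e) in H2 by (field; lra). exact H2.
Qed.

Lemma pw_mono x y p : 0 <= p -> 0 < x <= y -> pw x p <= pw y p.
Proof.
  intros Hp [H1 H2]. unfold pw. assert (ln x <= ln y) by (apply ln_le; lra).
  apply exp_le. assert (p * ln x <= p * ln y) by (apply Rmult_le_compat_l; lra). lra.
Qed.

Lemma pw_deriv x p : 0 < x -> derivable_pt_lim (fun x => pw x p) x (p * pw x (p - 1)).
Proof.
  intros Hx. apply is_derive_Reals. unfold pw. auto_derive; auto.
  replace ((p - 1) * ln x) with (p * ln x + - ln x) by ring.
  rewrite exp_plus, exp_Ropp, exp_ln by auto. ring.
Qed.

Lemma pw_mul_self x p : 0 < x -> x * pw x p = pw x (p + 1).
Proof.
  intros Hx. unfold pw. replace ((p + 1) * ln x) with (ln x + p * ln x) by ring.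
  now rewrite exp_plus, exp_ln.
Qed.

Section Boundary.
Context {a b k : R} {L q E : C -> C} (HC : core a b k L q E).

Let Ha : 1 <= a := core_a _ _ _ _ _ _ HC.
Let Hk : 0 <= k < 1 := core_k _ _ _ _ _ _ HC.
Notation s := (cpl a b).
Let Hs := @s_nz _ _ _ _ _ _ HC.
Notation chainP := (@chain_factor q).
Notation chainU := (@chain_log a b L q).
Notation speedU := (@chain_speed a b q).
Notation defect := (@chain_defect a b E).
Notation v := (slow a k).
Notation c := (fast a k).

Let Hv : a < v := slow_gt a k Ha Hk.
Let Hc : 0 < c := fast_pos a k Ha Hk.

Lemma chainU_turn W n t : 0 < Re W -> chainU (W + turn n)%C t = (chainU W t + turn n)%C.
Proof.
  intros HW. destruct (core_turn _ _ _ _ _ _ HC W n HW) as [H1 H2].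
  unfold chain_log, chain_factor. rewrite H1, H2. ring.
Qed.

Lemma chainU_cont W t : region a W t -> limC (nb2 W t) (fun y => chainU (fst y) (snd y)) (chainU W t).
Proof.
  intros HR. assert (HR' := HR). destruct HR' as (_ & HW & _). unfold chain_log.
  apply limC_plus; [now apply (limC_L HC)|]. apply limC_mult; [apply limC_const|].
  apply (limC_comp (fun y => chainP (fst y) (snd y)) Clog); [now apply (limC_chainP HC)|].
  apply ccont_Clog. now apply (chainP_slit HC).
Qed.

Lemma chainU_ccont W t : region a W t -> ccont (fun W => chainU W t) W.
Proof.
  intros HR e He. destruct (chainU_cont W t HR e He) as (d & Hd & A).
  exists d. split; auto. intros z Hz. apply (A z t); auto. rewrite Rminus_diag, Rabs_R0. auto.
Qed.

(* Following level curves up to time 1 carries the values of [L] near the boundary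
   to values of [chainU _ 1] on a compact part of its domain, modulo [turn]. *)
Lemma L_bounded : exists K, 0 < K /\ forall W, 0 < Re W <= 1 -> Cmod (L W - W) <= K.
Proof.
  (* A curve that starts with 0 < Re W <= 1 has real part between v and 1 + c at time 1. Subtracting
     W makes the function periodic. *)
  destruct (strip_bounded (fun W => chainU W 1 - W)%C v (1 + c)) as (K & HK).
  - intros W n HW. rewrite chainU_turn by lra. ring.
  - intros W HW. apply limC_minus; [|apply ccont_id].
    apply chainU_ccont. repeat split; lra.
  - exists (Rabs K + c + 1). generalize (Rabs_pos K) (Rle_abs K). intros. split; [lra|].
    intros W HW. assert (HR : region a W 0) by (repeat split; lra).
    destruct (chainU_flow HC W 0 1 HR Rle_0_1) as (w & Hw & Hw1 & Hw2).
    rewrite (chainU_0 (L := L)) in Hw.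
    rewrite Rminus_0_r, Rmult_1_r in Hw1, Hw2.
    assert (Er : Re (w - W) = Re w - Re W) by (destruct w, W; reflexivity).
    assert (Re (w - W) <= c).
    { generalize (re_le_Cmod (w - W)) (Rle_abs (Re (w - W))). lra. }
    assert (B := HK w ltac:(lra)). rewrite Hw in B.
    replace (L W - W)%C with ((L W - w) + (w - W))%C by ring.
    eapply Rle_trans; [apply Cmod_triangle|]. lra.
Qed.

(** By the hypothesis a (exp(2 Re W) - 1) |E| <= 2 a k |s|, and exp(2x) - 1 >= 2x cancels the 2.
    That the constant is exactly k |s| gives the exponent -k in [q_bounded]. *)
Lemma E_bound W : 0 < Re W -> Cmod (E W) <= k * Cmod s / Re W.
Proof.
  intros HW. assert (B := core_E _ _ _ _ _ _ HC W HW).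
  assert (S0 := s_pos HC). assert (Hb := core_b _ _ _ _ _ _ HC).
  assert (Hx : 2 * Re W <= exp (2 * Re W) - 1) by (generalize (exp_ineq1_le (2 * Re W)); lra).
  generalize (Rabs_pos b); intros Hb0.
  assert (B' : Cmod (a * (1 - exp (2 * Re W))%R * E W) <= 2 * a * k * Cmod s).
  { replace (a * (1 - exp (2 * Re W))%R * E W)%C
      with ((Ci * b + a * (1 - exp (2 * Re W))%R * E W) + - (Ci * b))%C by ring.
    eapply Rle_trans; [apply Cmod_triangle|]. rewrite Cmod_opp, (Cmod_mult Ci), Cmod_Ci, Cmod_R.
    destruct (Rle_dec a 2); nra. }
  rewrite !Cmod_mult, !Cmod_R, (Rabs_pos_eq a), Rabs_left1 in B' by lra.
  apply Rmult_le_reg_r with (Re W); auto.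
  unfold Rdiv. rewrite Rmult_assoc, Rinv_l, Rmult_1_r by lra.
  generalize (Cmod_ge_0 (E W)). intros.
  assert (a * (2 * Re W) * Cmod (E W) <= a * - (1 - exp (2 * Re W)) * Cmod (E W)).
  { apply Rmult_le_compat_r; auto. apply Rmult_le_compat_l; lra. }
  apply Rmult_le_reg_l with (2 * a); [lra|]. lra.
Qed.

(** On a horizontal ray u = q exp(L/s) satisfies u' = u (1 - E) / s, so |u'| <= (1 + k/y) |u|, and
    integrating down from y = 1 gives growth at most like x^(-k). [L_bounded] then removes the
    factor exp(L/s). *)
Lemma q_bounded : exists K, 0 < K /\ forall W, 0 < Re W <= 1 -> Cmod (q W) <= K * pw (Re W) (- k).
Proof.
  destruct L_bounded as (KL & HKL & BL).
  destruct (strip_bounded q 1 1) as (Kq & BQ).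
  { intros W n HW. apply (core_turn _ _ _ _ _ _ HC). lra. }
  { intros W HW. eapply wd_ccont. apply (core_q _ _ _ _ _ _ HC). lra. }
  assert (S1 := s_ge_1 HC).
  set (Kq' := Rabs Kq + 1). generalize (Rabs_pos Kq) (Rle_abs Kq); intros.
  exists (exp 1 * (Kq' * exp (2 * KL + 1))).
  split. { repeat apply Rmult_lt_0_compat; try apply exp_pos. unfold Kq'; lra. }
  intros W HW. destruct W as [x th]. simpl in HW.
  set (g := fun Z => (q Z * cexp (L Z / s))%C).
  assert (Wg : forall Z, 0 < Re Z -> wd g Z (g Z * ((1 - E Z) / s))%C 0).
  { intros Z HZ.
    assert (D1 : wd (fun Z => cexp (L Z / s)) Z (cexp (L Z / s) * (/ s * q Z))%C (cexp (L Z / s) * (/ s * 0))%C).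
    { apply (wd_cexpf (fun W => L W / s)%C). eapply wd_ext; [|exact (wd_scal (/ s)%C L _ _ 0 (core_L _ _ _ _ _ _ HC _ HZ))].
      apply filter_forall. intros z. unfold Cdiv. ring. }
    eapply wd_eq; [| |apply (wd_mult _ _ _ _ _ _ _ (core_q _ _ _ _ _ _ HC Z HZ) D1)].
    - unfold g. field. auto.
    - ring. }
  set (i := (0, th) : C).
  assert (Ei : forall y, (i + RtoC y)%C = (y, th)) by (intros; unfold i; apply C_ext; simpl; ring).
  set (u := fun y : R => g (i + RtoC y)%C).
  assert (Du : forall y, 0 < y -> rd u y (u y * ((1 - E (y, th)) / s))%C).
  { intros y Hy. unfold u. rewrite <- (Ei y) at 1. apply rd_horizontal, Wg. rewrite Ei. exact Hy. }
  (* The quantity |u|^2 y^(2k) exp(2y) is nondecreasing in y; the sign is changed to fit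
     [deriv_nonpos_le]. *)
  assert (M := deriv_nonpos_le (fun y => - (Cmod (u y) ^ 2 * exp (2 * k * ln y + 2 * y))) x 1 ltac:(lra)).
  assert (D : forall y, x <= y <= 1 -> exists l, derivable_pt_lim (fun y => - (Cmod (u y) ^ 2 * exp (2 * k * ln y + 2 * y))) y l /\ l <= 0).
  { intros y Hy. eexists. split.
    - apply derivable_pt_lim_opp, derivable_pt_lim_mult; [apply rd_Cmod2, Du; lra|].
      instantiate (1 := exp (2 * k * ln y + 2 * y) * (2 * k / y + 2)).
      apply is_derive_Reals. auto_derive; [lra|]. field. lra.
    - set (w := ((1 - E (y, th)) / s)%C).
      assert (Hw : Cmod w <= 1 + k / y).
      { unfold w. rewrite Cmod_div by auto.
        assert (B := E_bound (y, th) ltac:(simpl; lra)). simpl in B.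
        assert (Cmod (1 - E (y, th)) <= 1 + k * Cmod s / y).
        { unfold Cminus. eapply Rle_trans; [apply Cmod_triangle|]. rewrite Cmod_opp, Cmod_1. lra. }
        apply Rmult_le_reg_r with (Cmod s); [lra|].
        unfold Rdiv at 1. rewrite Rmult_assoc, Rinv_l, Rmult_1_r by lra.
        replace ((1 + k / y) * Cmod s) with (Cmod s + k * Cmod s / y) by (field; lra). lra. }
      assert (Hr : - (Cmod (u y) ^ 2 * (1 + k / y)) <= Re (u y) * Re (u y * w) + Im (u y) * Im (u y * w)).
      { replace (Re (u y) * Re (u y * w) + Im (u y) * Im (u y * w)) with (Cmod (u y) ^ 2 * Re w)
          by (rewrite Cmod_sq; destruct (u y), w; simpl; ring).
        generalize (re_le_Cmod w) (Rle_abs (- Re w)) (pow2_ge_0 (Cmod (u y))). rewrite Rabs_Ropp. intros.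
        assert (- (1 + k / y) <= Re w) by lra. nra. }
      generalize (exp_pos (2 * k * ln y + 2 * y)). intros Hp.
      set (ex := exp (2 * k * ln y + 2 * y)) in *.
      set (m2 := Cmod (u y) ^ 2) in *.
      set (rr := Re (u y) * Re (u y * w) + Im (u y) * Im (u y * w)) in *.
      assert (0 <= (2 * rr + m2 * (2 * k / y + 2)) * ex); [|lra].
      apply Rmult_le_pos; [|lra]. replace (2 * k / y) with (2 * (k / y)) by (field; lra). lra. }
  assert (M' : Cmod (u x) ^ 2 * exp (2 * k * ln x + 2 * x) <= Cmod (u 1) ^ 2 * exp (2 * k * ln 1 + 2 * 1)).
  { apply Ropp_le_cancel. apply M.
    - intros y Hy. apply derivable_continuous_pt. apply ex_derive_Reals_0.
      destruct (D y Hy) as (l & Hl & _). exists l. now apply is_derive_Reals.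
    - intros y Hy. apply D. lra. }
  rewrite ln_1, Rmult_0_r, Rplus_0_l, Rmult_1_r in M'.
  assert (P : Cmod (u x) * pw x k <= Cmod (u 1) * exp 1).
  { assert (E1 : exp 2 = exp 1 * exp 1) by (rewrite <- exp_plus; f_equal; ring).
    assert (E2 : exp (2 * k * ln x + 2 * x) = pw x k * pw x k * exp (2 * x)).
    { unfold pw. rewrite <- !exp_plus. f_equal. ring. }
    rewrite E1, E2 in M'.
    assert (1 <= exp (2 * x)) by (generalize (exp_ineq1_le (2 * x)); lra).
    generalize (Cmod_ge_0 (u x)) (pw_pos x k) (Cmod_ge_0 (u 1)) (exp_pos 1). intros.
    assert (0 <= Cmod (u x) * pw x k) by nra. assert (0 <= Cmod (u 1) * exp 1) by nra.
    apply Rnot_lt_le. intros N.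
    assert ((Cmod (u x) * pw x k) * (Cmod (u x) * pw x k) <= (Cmod (u 1) * exp 1) * (Cmod (u 1) * exp 1)).
    { apply Rle_trans with (Cmod (u x) ^ 2 * (pw x k * pw x k * exp (2 * x))); [|simpl in *; lra].
      replace (Cmod (u x) ^ 2 * (pw x k * pw x k * exp (2 * x))) with ((Cmod (u x) * pw x k) * (Cmod (u x) * pw x k) * exp (2 * x)) by ring.
      assert (0 <= (Cmod (u x) * pw x k) * (Cmod (u x) * pw x k)) by nra. nra. }
    nra. }
  assert (Ek : pw x (- k) * pw x k = 1).
  { unfold pw. rewrite <- exp_plus. replace (- k * ln x + k * ln x) with 0 by ring. apply exp_0. }
  assert (U1 : Cmod (u 1) <= Kq' * Cmod (cexp (L (1, th) / s))).
  { unfold u, g. rewrite Ei, Cmod_mult. apply Rmult_le_compat_r; [apply Cmod_ge_0|].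
    eapply Rle_trans; [apply BQ; simpl; lra|]. unfold Kq'. lra. }
  (* exp(L/s) need not be bounded uniformly in th, but its values at two points of one ray are
     comparable, since L - W is bounded. *)
  assert (U2 : Cmod (cexp (L (1, th) / s)) <= exp (2 * KL + 1) * Cmod (cexp (L (x, th) / s))).
  { replace (L (1, th) / s)%C with ((L (1, th) - L (x, th)) / s + L (x, th) / s)%C by (field; auto).
    rewrite cexp_plus, Cmod_mult. apply Rmult_le_compat_r; [apply Cmod_ge_0|].
    rewrite Cmod_cexp.
    assert (B : Re ((L (1, th) - L (x, th)) / s) <= 2 * KL + 1).
    { eapply Rle_trans; [apply Rle_abs|]. eapply Rle_trans; [apply re_le_Cmod|].
      rewrite Cmod_div by auto.
      assert (Cmod (L (1, th) - L (x, th)) <= 2 * KL + 1).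
      { replace (L (1, th) - L (x, th))%C with ((L (1, th) - (1, th)) + - (L (x, th) - (x, th)) + ((1, th) - (x, th)))%C by ring.
        eapply Rle_trans; [apply Cmod_triangle|].
        eapply Rle_trans; [apply Rplus_le_compat_r, Cmod_triangle|]. rewrite Cmod_opp.
        assert (B1 := BL (1, th) ltac:(simpl; lra)). assert (B2 := BL (x, th) ltac:(simpl; lra)).
        assert (Cmod ((1, th) - (x, th)) <= 1).
        { replace ((1, th) - (x, th))%C with (RtoC (1 - x)) by (apply C_ext; simpl; ring).
          rewrite Cmod_R, Rabs_pos_eq; lra. }
        lra. }
      apply Rmult_le_reg_r with (Cmod s); [lra|].
      unfold Rdiv. rewrite Rmult_assoc, Rinv_l, Rmult_1_r by lra. nra. }
    apply exp_le. lra. }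
  assert (Ux : Cmod (u x) = Cmod (q (x, th)) * Cmod (cexp (L (x, th) / s))).
  { unfold u, g. now rewrite Ei, Cmod_mult. }
  simpl Re.
  set (cx := Cmod (cexp (L (x, th) / s))) in *.
  assert (Hcx : 0 < cx) by (apply Cmod_pos, cexp_nz).
  apply Rmult_le_reg_r with (cx * pw x k); [apply Rmult_lt_0_compat; auto using pw_pos|].
  replace (exp 1 * (Kq' * exp (2 * KL + 1)) * pw x (- k) * (cx * pw x k))
    with (exp 1 * (Kq' * (exp (2 * KL + 1) * cx)) * (pw x (- k) * pw x k)) by ring.
  rewrite Ek, Rmult_1_r.
  replace (Cmod (q (x, th)) * (cx * pw x k)) with (Cmod (u x) * pw x k) by (rewrite Ux; ring).
  eapply Rle_trans; [exact P|]. rewrite Rmult_comm.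
  apply Rmult_le_compat_l; [left; apply exp_pos|].
  eapply Rle_trans; [exact U1|]. apply Rmult_le_compat_l; [unfold Kq'; lra|exact U2].
Qed.

Lemma L_holder : exists K, 0 < K /\ forall x y th, 0 < x <= y -> y <= 1 ->
  Cmod (L (y, th) - L (x, th)) <= K * (pw y (1 - k) - pw x (1 - k)).
Proof.
  destruct q_bounded as (K & HK & B). exists (K / (1 - k)). split; [apply Rdiv_lt_0_compat; lra|].
  intros x y th Hx Hy. set (i := (0, th) : C).
  assert (Ei : forall y, (i + RtoC y)%C = (y, th)) by (intros; unfold i; apply C_ext; simpl; ring).
  rewrite <- !Ei.
  replace (K / (1 - k) * (pw y (1 - k) - pw x (1 - k))) with (K / (1 - k) * pw y (1 - k) - K / (1 - k) * pw x (1 - k)) by ring.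
  assert (DL : forall z, 0 < z -> rd (fun z => L (i + RtoC z)%C) z (q (z, th))).
  { intros z Hz. rewrite <- Ei. apply rd_horizontal. apply (core_L _ _ _ _ _ _ HC). rewrite Ei. exact Hz. }
  assert (DP : forall z, 0 < z -> derivable_pt_lim (fun z => K / (1 - k) * pw z (1 - k)) z (K * pw z (- k))).
  { intros z Hz. replace (K * pw z (- k)) with (K / (1 - k) * ((1 - k) * pw z (1 - k - 1))).
    - apply derivable_pt_lim_scal. now apply pw_deriv.
    - replace (1 - k - 1) with (- k) by ring. field. lra. }
  apply (mvt_maj (fun z => L (i + RtoC z)%C) (fun z => K / (1 - k) * pw z (1 - k))); [lra| |].
  - intros z Hz. split; [eapply rd_rcont; apply DL; lra|].
    apply derivable_continuous_pt. eexists. apply DP. lra.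
  - intros z Hz. exists (q (z, th)), (K * pw z (- k)). split; [apply DL; lra|].
    split; [apply DP; lra|]. apply (B (z, th)). simpl. lra.
Qed.

Lemma boundary_limit : exists K ell, 0 < K /\
  forall x th, 0 < x <= 1 -> Cmod (L (x, th) - ell th) <= K * pw x (1 - k).
Proof.
  destruct L_holder as (K & HK & B). destruct L_bounded as (KL & HKL & BL).
  assert (H : forall th : R, exists l : C, forall x, 0 < x <= 1 -> Cmod (L (x, th) - l) <= K * pw x (1 - k)).
  { intros th. set (xn := fun n : nat => / (INR n + 1)).
    assert (Hxn : forall n, 0 < xn n <= 1).
    { intros n. unfold xn. generalize (pos_INR n). intros. split; [apply Rinv_0_lt_compat; lra|].
      rewrite <- Rinv_1. apply Rinv_le_contravar; lra. }
    destruct (bw (fun n => L (xn n, th)) (KL + 1 + Rabs th)) as (phi & l & Hphi & Hl).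
    { intros n. assert (B1 := BL (xn n, th) (Hxn n)).
      assert (Cmod (xn n, th) <= 1 + Rabs th).
      { eapply Rle_trans; [apply Cmod_le_re_im|]. simpl. rewrite (Rabs_pos_eq (xn n)); destruct (Hxn n); lra. }
      generalize (Cmod_rev (L (xn n, th)) (xn n, th)). lra. }
    exists l. intros x Hx. rewrite Cmod_sub_sym.
    apply (limC_le (F := eventually) _ l _ _ Hl).
    destruct (inv_INR_small x ltac:(lra)) as (N & HN). exists N. intros n Hn.
    rewrite Cmod_sub_sym.
    assert (xn (phi n) <= x).
    { left. apply HN. generalize (Hphi n). lia. }
    eapply Rle_trans; [apply B; [split; [apply Hxn|exact H]|lra]|].
    generalize (pw_pos (xn (phi n)) (1 - k)). intros. apply Rmult_le_compat_l; lra. }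
  destruct (choice _ H) as (ell & Hell). exists K, ell. split; auto.
Qed.

(** In the region t <= Re W, so 1 - exp(-2t) <= 2 Re W outweighs the growth of q, and chainP is 1 +
    O(x^(1 - k)) with x = Re W. Hence [chainU] has the same boundary values as [L]. *)
Lemma chainU_near_boundary : exists K d, 0 < K /\ 0 < d <= 1 /\ forall W t, region a W t -> Re W <= d ->
  Cmod (chainU W t - L W) <= K * pw (Re W) (1 - k) /\ 1 / 2 <= Cmod (chainP W t).
Proof.
  destruct q_bounded as (K & HK & B). destruct Clog_near_1 as (r & Hr & Hlog).
  destruct (pw_small (1 - k) (r / (2 * K)) ltac:(lra)) as (d & Hd & Hpw); [apply Rdiv_lt_0_compat; lra|].
  assert (S1 := s_ge_1 HC).
  exists (Cmod s * (4 * K)), (Rmin 1 (d / 2)).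
  assert (M1 := Rmin_l 1 (d / 2)). assert (M2 := Rmin_r 1 (d / 2)).
  split; [apply Rmult_lt_0_compat; lra|]. split; [split; [apply Rmin_pos; lra|lra]|].
  intros W t (Ht & HW & HR) HWd.
  assert (Hp : Cmod (chainP W t - 1) <= 2 * K * pw (Re W) (1 - k)).
  { unfold chain_factor. replace (1 - (1 - exp (- (2) * t))%R * q W - 1)%C with (- ((1 - exp (- (2) * t))%R * q W))%C by ring.
    rewrite Cmod_opp, Cmod_mult, Cmod_R.
    assert (He : exp (- (2) * t) <= 1).
    { rewrite <- exp_0. apply exp_le. lra. }
    rewrite Rabs_pos_eq by lra.
    assert (He2 : 1 - exp (- (2) * t) <= 2 * t) by (generalize (exp_ineq1_le (- (2) * t)); lra).
    assert (Bq := B W ltac:(lra)). generalize (Cmod_ge_0 (q W)). intros.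
    replace (1 - k) with (- k + 1) by ring. rewrite <- pw_mul_self by auto.
    replace (2 * K * (Re W * pw (Re W) (- k))) with (2 * Re W * (K * pw (Re W) (- k))) by ring.
    apply Rmult_le_compat; try lra. assert (t <= Re W) by nra. lra. }
  assert (Hsm : Cmod (chainP W t - 1) < r).
  { eapply Rle_lt_trans; [exact Hp|]. assert (X := Hpw (Re W) ltac:(lra)).
    apply Rmult_lt_compat_l with (r := 2 * K) in X; [|lra].
    replace (2 * K * (r / (2 * K))) with r in X by (field; lra). exact X. }
  destruct (Hlog _ Hsm) as [Hsl Hcl]. split.
  - unfold chain_log. replace (L W + s * Clog (chainP W t) - L W)%C with (s * Clog (chainP W t))%C by ring.
    rewrite Cmod_mult, Rmult_assoc. apply Rmult_le_compat_l; lra.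
  - generalize (Cmod_rev 1 (chainP W t)). rewrite Cmod_1, Cmod_sub_sym. lra.
Qed.

End Boundary.

(** * The extension in logarithmic coordinates *)

Definition mir (Z : C) : C := (- Re Z, Im Z).

Lemma mir_mir Z : mir (mir Z) = Z.
Proof. destruct Z; apply C_ext; simpl; ring. Qed.

Lemma mir_conj Z : mir Z = (- Cconj Z)%C.
Proof. destruct Z; apply C_ext; simpl; ring. Qed.

Lemma advance_lim {T : Type} {F : (T -> Prop) -> Prop} {PF : ProperFilter F} (f : T -> C) l v c tau :
  limC F f l -> F (fun x => advance v c (f x) tau) -> advance v c l tau.
Proof.
  intros Hl HA. split.
  - apply le_epsilon. intros e He.
    destruct (filter_ex _ (filter_and _ _ (Hl e He) HA)) as (x & H1 & H2 & _).
    generalize (re_le_Cmod (f x - l)) (Rle_abs (Re (f x - l))).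
    replace (Re (f x - l)) with (Re (f x) - Re l) by (destruct (f x), l; reflexivity). lra.
  - replace l with (l - 0)%C by ring. apply (limC_le f l 0 (c * tau) Hl).
    generalize HA. apply filter_imp. intros x [_ H]. now replace (f x - 0)%C with (f x) by ring.
Qed.

(** On the left half-plane the time is chosen so that the reflected point lies on the edge Re W = a
    t of the region. [ell] stands for the boundary values of [L]. *)
Definition extension (a b : R) (L q : C -> C) (ell : R -> C) (Z : C) : C :=
  if Rlt_dec 0 (Re Z) then L Z
  else if Rlt_dec (Re Z) 0 then @chain_log a b L q (mir Z) (- Re Z / a)
  else ell (Im Z).

Lemma pw_anti x y k : 0 <= k -> 0 < x <= y -> pw y (- k) <= pw x (- k).
Proof.
  intros Hk Hx. assert (H := pw_mono x y k Hk Hx). unfold pw in *.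
  rewrite !Ropp_mult_distr_l_reverse, !exp_Ropp. apply Rinv_le_contravar; auto. apply exp_pos.
Qed.

Section Extension.
Context {a b k : R} {L q E : C -> C} (HC : core a b k L q E) {K : R} {ell : R -> C}
  (HK : 0 < K) (Hell : forall x th, 0 < x <= 1 -> Cmod (L (x, th) - ell th) <= K * pw x (1 - k)).

Let Ha : 1 <= a := core_a _ _ _ _ _ _ HC.
Let Hk : 0 <= k < 1 := core_k _ _ _ _ _ _ HC.
Notation s := (cpl a b).
Let Hs := @s_nz _ _ _ _ _ _ HC.
Notation chainP := (@chain_factor q).
Notation chainU := (@chain_log a b L q).
Notation speedU := (@chain_speed a b q).
Notation defect := (@chain_defect a b E).
Notation v := (slow a k).
Notation c := (fast a k).
Notation T := (extension a b L q ell).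

Let Hv : a < v := slow_gt a k Ha Hk.
Let Hc : 0 < c := fast_pos a k Ha Hk.

Lemma T_out Z : 0 < Re Z -> T Z = L Z.
Proof. intros H. unfold extension. destruct (Rlt_dec 0 (Re Z)); [auto|lra]. Qed.

Lemma T_in Z : Re Z < 0 -> T Z = chainU (mir Z) (- Re Z / a).
Proof.
  intros H. unfold extension. destruct (Rlt_dec 0 (Re Z)); [lra|].
  destruct (Rlt_dec (Re Z) 0); [auto|lra].
Qed.

Lemma T_bd Z : Re Z = 0 -> T Z = ell (Im Z).
Proof.
  intros H. unfold extension. destruct (Rlt_dec 0 (Re Z)); [lra|].
  destruct (Rlt_dec (Re Z) 0); [lra|auto].
Qed.

Lemma region_in Z : Re Z < 0 -> region a (mir Z) (- Re Z / a).
Proof.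
  intros H. repeat split; simpl; try lra.
  - apply Rmult_le_pos; [lra|]. left. apply Rinv_0_lt_compat. lra.
  - right. field. lra.
Qed.

Lemma pw_1k_small e : 0 < e -> exists x, 0 < x <= 1 /\ K * pw x (1 - k) < e.
Proof.
  intros He. destruct (pw_small (1 - k) (e / K)) as (d & Hd & H); [lra|apply Rdiv_lt_0_compat; lra|].
  exists (Rmin 1 (d / 2)). assert (M1 := Rmin_l 1 (d / 2)). assert (M2 := Rmin_r 1 (d / 2)).
  assert (0 < Rmin 1 (d / 2)) by (apply Rmin_pos; lra).
  split; [lra|]. specialize (H (Rmin 1 (d / 2)) ltac:(lra)).
  apply Rmult_lt_compat_l with (r := K) in H; auto.
  replace (K * (e / K)) with e in H by (field; lra). exact H.
Qed.

Lemma ell_cont th e : 0 < e -> exists d, 0 < d /\ forall th', Rabs (th' - th) < d -> Cmod (ell th' - ell th) < e.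
Proof.
  intros He. destruct (pw_1k_small (e / 4)) as (x & Hx & Hs0); [lra|].
  assert (HL : ccont L (x, th)) by (eapply wd_ccont; apply (core_L _ _ _ _ _ _ HC); simpl; lra).
  destruct (HL (e / 2) (half_pos _ He)) as (d & Hd & A). exists d. split; auto.
  intros th' Hth. assert (B := A (x, th')).
  assert (Cmod ((x, th') - (x, th)) < d).
  { eapply Rle_lt_trans; [apply Cmod_le_re_im|]. simpl. rewrite Rplus_opp_r, Rabs_R0, Rplus_0_l. exact Hth. }
  specialize (B H). assert (B1 := Hell x th Hx). assert (B2 := Hell x th' Hx).
  generalize (Cmod_tri3 (ell th') (L (x, th')) (ell th)) (Cmod_tri3 (L (x, th')) (L (x, th)) (ell th)).
  rewrite (Cmod_sub_sym (ell th') (L (x, th'))). lra.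
Qed.

Lemma ell_turn th n : ell (th + 2 * PI * IZR n) = (ell th + turn n)%C.
Proof.
  apply Cmod_eps. intros e He. destruct (pw_1k_small (e / 2)) as (x & Hx & Hs0); [lra|].
  assert (B1 := Hell x th Hx). assert (B2 := Hell x (th + 2 * PI * IZR n) Hx).
  destruct (core_turn _ _ _ _ _ _ HC (x, th) n ltac:(simpl; lra)) as [H _].
  replace ((x, th) + turn n)%C with ((x, th + 2 * PI * IZR n) : C) in H
    by (apply C_ext; simpl; ring).
  rewrite H in B2. rewrite Cmod_sub_sym.
  replace (ell th + turn n - ell (th + 2 * PI * IZR n))%C
    with ((L (x, th) + turn n - ell (th + 2 * PI * IZR n)) + - (L (x, th) - ell th))%C by ring.
  eapply Rle_trans; [apply Cmod_triangle|]. rewrite Cmod_opp. lra.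
Qed.

Lemma T_turn Z n : T (Z + turn n)%C = (T Z + turn n)%C.
Proof.
  assert (HR := Re_turn Z n).
  destruct (Rtotal_order (Re Z) 0) as [H|[H|H]].
  - rewrite !T_in, HR by lra.
    replace (mir (Z + turn n)) with (mir Z + turn n)%C by (destruct Z; apply C_ext; simpl; ring).
    apply (chainU_turn HC). simpl. lra.
  - rewrite !T_bd by lra. replace (Im (Z + turn n)) with (Im Z + 2 * PI * IZR n) by (destruct Z; reflexivity).
    apply ell_turn.
  - rewrite !T_out by lra. now apply (core_turn _ _ _ _ _ _ HC).
Qed.

Lemma T_near_axis : exists K' d, 0 < K' /\ 0 < d <= 1 /\ forall Z, Re Z <> 0 -> Rabs (Re Z) <= d ->
  Cmod (T Z - ell (Im Z)) <= K' * pw (Rabs (Re Z)) (1 - k).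
Proof.
  destruct (chainU_near_boundary HC) as (K1 & d & HK1 & Hd & B).
  exists (K + K1), d. split; [lra|]. split; auto. intros Z HZ Hdz.
  destruct (Rtotal_order (Re Z) 0) as [H|[H|H]]; [|lra|].
  - rewrite Rabs_left in * by auto. rewrite T_in by auto.
    destruct (B (mir Z) (- Re Z / a) (region_in Z H)) as [B1 _]; [simpl; lra|]. simpl Re in B1.
    assert (B2 := Hell (- Re Z) (Im Z) ltac:(lra)). fold (mir Z) in B2.
    generalize (Cmod_tri3 (chainU (mir Z) (- Re Z / a)) (L (mir Z)) (ell (Im Z))). lra.
  - rewrite Rabs_pos_eq in * by lra. rewrite T_out by auto.
    assert (B2 := Hell (Re Z) (Im Z) ltac:(lra)).
    replace ((Re Z, Im Z) : C) with Z in B2 by (destruct Z; reflexivity).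
    generalize (pw_pos (Re Z) (1 - k)). intros. nra.
Qed.

Lemma wd_T_out Z : 0 < Re Z -> wd T Z (q Z) 0.
Proof.
  intros H. eapply wd_ext; [|apply (core_L _ _ _ _ _ _ HC); exact H].
  generalize (nb_re_gt Z 0 H). apply filter_imp. intros z Hz. now rewrite T_out.
Qed.

(** On the edge t = Re W / a, the motion of t adds half of -2 a A / a to both derivatives of chainU.
    They become A (1 - x) - A = -A x and -A, and the substitution W = - conj Z exchanges them and
    changes the signs. *)
Lemma wd_T_in Z : Re Z < 0 ->
  wd T Z (speedU (mir Z) (- Re Z / a)) (speedU (mir Z) (- Re Z / a) * defect (mir Z) (- Re Z / a))%C.
Proof.
  intros H. assert (HR := region_in Z H). assert (HS := chainP_slit HC _ _ HR).
  assert (HPn := slit_nz _ HS).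
  set (W := mir Z) in *. set (t := - Re Z / a) in *.
  assert (HW : 0 < Re W) by apply HR.
  assert (Et : forall x, - (2) / a * x = - (2) * (x / a)) by (intros; field; lra).
  set (M := fun W => (L W + s * Clog (1 - (1 - RtoC (exp (- (2) / a * Re W))) * q W))%C).
  assert (EM : forall W, M W = chainU W (Re W / a)).
  { intros W0. unfold M, chain_log, chain_factor. now rewrite RtoC_minus, Et. }
  assert (Etw : Re W / a = t) by reflexivity.
  assert (EP : (1 - (1 - RtoC (exp (- (2) / a * Re W))) * q W)%C = chainP W t).
  { unfold chain_factor. now rewrite RtoC_minus, Et, Etw. }
  assert (D : wd M W (- (speedU W t * defect W t))%C (- speedU W t)%C).
  { unfold M.
    assert (De := wd_exp_Re (- (2) / a) W).
    assert (D1 := wd_minus _ _ _ _ _ _ _ (wd_const 1 W) (wd_mult _ _ _ _ _ _ _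
      (wd_minus _ _ _ _ _ _ _ (wd_const 1 W) De) (core_q _ _ _ _ _ _ HC W HW))).
    assert (Hsl : slit (1 - (1 - RtoC (exp (- (2) / a * Re W))) * q W)%C) by (rewrite EP; exact HS).
    eapply wd_eq; [| |exact (wd_plus _ _ _ _ _ _ _ (core_L _ _ _ _ _ _ HC W HW) (wd_scal s _ _ _ _ (wd_Clogf _ _ _ _ D1 Hsl)))].
    - cbv beta. rewrite EP, Et, Etw. assert (X := chainU_deriv_eq HC W t HPn).
      replace (- (speedU W t * defect W t))%C with (speedU W t * (1 - defect W t) - speedU W t)%C by ring.
      rewrite <- X. unfold speedU.
      rewrite !RtoC_mult, !RtoC_div, !RtoC_opp, !RtoC_minus by lra.
      field. repeat split; auto. apply (a_nz HC).
    - cbv beta. rewrite EP, Et, Etw. unfold speedU.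
      rewrite !RtoC_mult, !RtoC_div, !RtoC_opp by lra.
      field. repeat split; auto. apply (a_nz HC). }
  assert (Dm : wd mir Z 0 (- (1))%C).
  { eapply wd_ext; [|eapply wd_eq; [| |apply (wd_opp _ _ _ _ (wd_conj Z))]].
    - apply filter_forall. intros z. symmetry. apply mir_conj.
    - ring.
    - ring. }
  eapply wd_ext; [|eapply wd_eq; [| |exact (wd_comp mir M Z _ _ _ _ Dm D)]].
  - generalize (nb_re_lt Z 0 H). apply filter_imp. intros z Hz. rewrite T_in, EM by auto. reflexivity.
  - replace (Cconj (- (1))) with (- (1))%C by (apply C_ext; simpl; ring). ring.
  - replace (Cconj 0) with (RtoC 0) by (apply C_ext; simpl; ring). ring.
Qed.

Lemma T_cont Z : ccont T Z.
Proof.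
  destruct (Rtotal_order (Re Z) 0) as [H|[H|H]].
  - eapply wd_ccont. now apply wd_T_in.
  - intros e He. destruct T_near_axis as (K' & d & HK' & Hd & B).
    destruct (pw_small (1 - k) (e / (2 * K'))) as (d1 & Hd1 & P1); [lra|apply Rdiv_lt_0_compat; lra|].
    destruct (ell_cont (Im Z) (e / 2) (half_pos _ He)) as (d2 & Hd2 & P2).
    exists (Rmin d (Rmin d1 d2)). split; [repeat apply Rmin_pos; lra|]. intros z Hz.
    assert (M1 := Rmin_l d (Rmin d1 d2)). assert (M2 := Rmin_r d (Rmin d1 d2)).
    assert (M3 := Rmin_l d1 d2). assert (M4 := Rmin_r d1 d2).
    assert (Hre : Rabs (Re z) <= Cmod (z - Z)).
    { replace (Re z) with (Re (z - Z)) by (destruct z, Z; simpl in *; lra). apply re_le_Cmod. }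
    assert (Him : Rabs (Im z - Im Z) <= Cmod (z - Z)).
    { replace (Im z - Im Z) with (Im (z - Z)) by (destruct z, Z; simpl in *; lra). apply im_le_Cmod. }
    rewrite (T_bd Z H). assert (Q := P2 (Im z) ltac:(lra)).
    assert (Q' : Cmod (T z - ell (Im z)) <= e / 2).
    { destruct (Req_dec (Re z) 0) as [H0|H0].
      - rewrite T_bd by auto. replace (ell (Im z) - ell (Im z))%C with (RtoC 0) by ring. rewrite Cmod_0. lra.
      - eapply Rle_trans; [apply B; auto; lra|].
        assert (X := P1 (Rabs (Re z)) ltac:(split; [now apply Rabs_pos_lt|lra])).
        apply Rmult_lt_compat_l with (r := K') in X; auto.
        replace (K' * (e / (2 * K'))) with (e / 2) in X by (field; lra). lra. }
    generalize (Cmod_tri3 (T z) (ell (Im z)) (ell (Im Z))). lra.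
  - eapply wd_ccont. now apply wd_T_out.
Qed.

Lemma T_qc_local Z0 : exists r K', 0 < r /\ 0 < K' /\ forall Z, Cmod (Z - Z0) < r -> Re Z <> 0 ->
  exists al be, wd T Z al be /\ Cmod be <= k * Cmod al /\ Cmod al <= K' * pw (Rabs (Re Z)) (- k).
Proof.
  assert (Dout : forall Z, 0 < Re Z -> wd T Z (q Z) 0 /\ Cmod 0 <= k * Cmod (q Z)).
  { intros Z HZ. split; [now apply wd_T_out|]. rewrite Cmod_0. generalize (Cmod_ge_0 (q Z)). nra. }
  assert (Din : forall Z, Re Z < 0 -> exists be, wd T Z (speedU (mir Z) (- Re Z / a)) be /\
     Cmod be <= k * Cmod (speedU (mir Z) (- Re Z / a))).
  { intros Z HZ. eexists. split; [now apply wd_T_in|]. rewrite Cmod_mult, Rmult_comm.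
    apply Rmult_le_compat_r; [apply Cmod_ge_0|]. apply (defect_region HC). now apply region_in. }
  (* Off the axis a plain local bound M is put into the form K' |Re Z|^(-k), so that one statement
     covers every [Z0]. *)
  assert (Away : forall Z r M, 0 < r -> r <= Rabs (Re Z0) / 2 -> 0 <= M -> Cmod (Z - Z0) < r ->
     M <= (M + 1) / pw (2 * Rabs (Re Z0)) (- k) * pw (Rabs (Re Z)) (- k)).
  { intros Z r M Hr Hr2 HM HZ.
    assert (Hre : Rabs (Re Z - Re Z0) <= Cmod (Z - Z0)).
    { replace (Re Z - Re Z0) with (Re (Z - Z0)) by (destruct Z, Z0; reflexivity). apply re_le_Cmod. }
    assert (H1 : Rabs (Re Z) <= 2 * Rabs (Re Z0)).
    { replace (Re Z) with ((Re Z - Re Z0) + Re Z0) by ring. eapply Rle_trans; [apply Rabs_triang|]. lra. }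
    assert (H2 : 0 < Rabs (Re Z)).
    { replace (Re Z0) with (Re Z + - (Re Z - Re Z0)) in Hr2 by ring.
      generalize (Rabs_triang (Re Z) (- (Re Z - Re Z0))). rewrite Rabs_Ropp. lra. }
    assert (A := pw_anti (Rabs (Re Z)) (2 * Rabs (Re Z0)) k ltac:(lra) ltac:(lra)).
    assert (P := pw_pos (2 * Rabs (Re Z0)) (- k)).
    apply Rmult_le_reg_r with (pw (2 * Rabs (Re Z0)) (- k)); auto.
    replace ((M + 1) / pw (2 * Rabs (Re Z0)) (- k) * pw (Rabs (Re Z)) (- k) * pw (2 * Rabs (Re Z0)) (- k))
      with ((M + 1) * pw (Rabs (Re Z)) (- k)) by (field; lra).
    nra. }
  destruct (Rtotal_order (Re Z0) 0) as [H|[H|H]].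
  - assert (HR := region_in Z0 H).
    assert (HN := normal_U HC _ _ HR (chainP_slit HC _ _ HR)).
    destruct HN as (_ & HL & _). destruct (limC_bounded _ _ HL) as (d & Hd & B).
    set (M := Cmod (speedU (mir Z0) (- Re Z0 / a)) + 1) in *.
    assert (HM : 0 <= M) by (unfold M; generalize (Cmod_ge_0 (speedU (mir Z0) (- Re Z0 / a))); lra).
    assert (HA0 : 0 < Rabs (Re Z0)) by (apply Rabs_pos_lt; lra).
    exists (Rmin d (Rabs (Re Z0) / 2)), ((M + 1) / pw (2 * Rabs (Re Z0)) (- k)).
    assert (M1 := Rmin_l d (Rabs (Re Z0) / 2)). assert (M2 := Rmin_r d (Rabs (Re Z0) / 2)).
    assert (M3 : 0 < Rmin d (Rabs (Re Z0) / 2)) by (apply Rmin_pos; lra).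
    split; [auto|]. split; [apply Rdiv_lt_0_compat; [lra|apply pw_pos]|].
    intros Z HZ _.
    assert (Hre : Rabs (Re Z - Re Z0) <= Cmod (Z - Z0)).
    { replace (Re Z - Re Z0) with (Re (Z - Z0)) by (destruct Z, Z0; reflexivity). apply re_le_Cmod. }
    assert (HZ0 : Re Z < 0).
    { rewrite (Rabs_left (Re Z0)) in * by auto. generalize (Rle_abs (Re Z - Re Z0)). lra. }
    destruct (Din Z HZ0) as (be & Hw & Hb). eexists _, be. split; [exact Hw|]. split; auto.
    eapply Rle_trans; [|apply (Away Z _ M M3 M2 HM HZ)].
    left. apply (B (mir Z) (- Re Z / a)).
    + rewrite !mir_conj. replace (- Cconj Z - - Cconj Z0)%C with (- Cconj (Z - Z0))%C by (rewrite Cminus_conj; ring).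
      rewrite Cmod_opp, Cmod_conj. lra.
    + replace (- Re Z / a - - Re Z0 / a) with (- (Re Z - Re Z0) / a) by (field; lra).
      unfold Rdiv. rewrite Rabs_mult, Rabs_Ropp, (Rabs_pos_eq (/ a)) by (left; apply Rinv_0_lt_compat; lra).
      assert (/ a <= 1) by (rewrite <- Rinv_1; apply Rinv_le_contravar; lra).
      assert (0 < / a) by (apply Rinv_0_lt_compat; lra).
      generalize (Rabs_pos (Re Z - Re Z0)). nra.
  - destruct (q_bounded HC) as (Kq & HKq & Bq).
    destruct (chainU_near_boundary HC) as (K1 & d & HK1 & Hd & B).
    assert (S1 := s_ge_1 HC).
    exists d, (Kq + 2 * Cmod s * Kq). split; [lra|]. split; [nra|].
    intros Z HZ HZ0.
    assert (Hre : Rabs (Re Z) <= Cmod (Z - Z0)).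
    { replace (Re Z) with (Re (Z - Z0)) by (destruct Z, Z0; simpl in *; lra). apply re_le_Cmod. }
    destruct (Rtotal_order (Re Z) 0) as [N|[N|N]]; [|lra|].
    + destruct (Din Z N) as (be & Hw & Hb). eexists _, be. split; [exact Hw|]. split; auto.
      rewrite Rabs_left in * by auto.
      assert (HR := region_in Z N).
      destruct (B _ _ HR ltac:(simpl; lra)) as [_ HP].
      assert (Bqz := Bq (mir Z) ltac:(simpl; lra)). simpl Re in Bqz.
      assert (HPn := slit_nz _ (chainP_slit HC _ _ HR)).
      unfold chain_speed. rewrite Cmod_div by (apply Cmult_nz; auto; apply (a_nz HC)).
      rewrite !Cmod_mult, !Cmod_R, (Rabs_pos_eq a) by lra.
      set (t := - Re Z / a) in *.
      rewrite Rabs_pos_eq by (left; apply exp_pos).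
      assert (He : exp (- (2) * t) <= 1).
      { rewrite <- exp_0. destruct HR as [Ht _].
        apply exp_le. lra. }
      generalize (exp_pos (- (2) * t)) (Cmod_ge_0 (q (mir Z))) (pw_pos (- Re Z) (- k)). intros.
      set (cp := Cmod (chainP (mir Z) t)) in *.
      apply Rmult_le_reg_r with (a * cp); [nra|].
      unfold Rdiv. rewrite Rmult_assoc, Rinv_l, Rmult_1_r by nra.
      set (pp := pw (- Re Z) (- k)) in *.
      apply Rle_trans with (Cmod s * 1 * (Kq * pp)).
      * apply Rmult_le_compat; try lra; [|]; [apply Rmult_le_pos; lra|].
        apply Rmult_le_compat_l; lra.
      * apply Rle_trans with ((2 * Cmod s * Kq) * pp * (1 * (1 / 2))).
        -- right. field.
        -- assert (0 <= Cmod s * Kq) by nra. 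
           apply Rmult_le_compat; [apply Rmult_le_pos; lra|lra| |].
           ++ apply Rmult_le_compat_r; lra.
           ++ apply Rmult_le_compat; lra.
    + destruct (Dout Z N) as (Hw & Hb). exists (q Z), 0. split; auto. split; auto.
      rewrite Rabs_pos_eq in * by lra.
      eapply Rle_trans; [apply Bq; lra|]. apply Rmult_le_compat_r; [left; apply pw_pos|]. nra.
  - assert (Hq : ccont q Z0) by (eapply wd_ccont; now apply (core_q _ _ _ _ _ _ HC)).
    destruct (limC_bounded _ _ Hq) as (d & Hd & B).
    set (M := Cmod (q Z0) + 1) in *.
    assert (HM : 0 <= M) by (unfold M; generalize (Cmod_ge_0 (q Z0)); lra).
    assert (HA0 : 0 < Rabs (Re Z0)) by (apply Rabs_pos_lt; lra).
    exists (Rmin d (Rabs (Re Z0) / 2)), ((M + 1) / pw (2 * Rabs (Re Z0)) (- k)).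
    assert (M1 := Rmin_l d (Rabs (Re Z0) / 2)). assert (M2 := Rmin_r d (Rabs (Re Z0) / 2)).
    assert (M3 : 0 < Rmin d (Rabs (Re Z0) / 2)) by (apply Rmin_pos; lra).
    split; [auto|]. split; [apply Rdiv_lt_0_compat; [lra|apply pw_pos]|].
    intros Z HZ _.
    assert (Hre : Rabs (Re Z - Re Z0) <= Cmod (Z - Z0)).
    { replace (Re Z - Re Z0) with (Re (Z - Z0)) by (destruct Z, Z0; reflexivity). apply re_le_Cmod. }
    assert (HZ0 : 0 < Re Z).
    { rewrite (Rabs_pos_eq (Re Z0)) in * by lra. generalize (Rle_abs (- (Re Z - Re Z0))). rewrite Rabs_Ropp. lra. }
    destruct (Dout Z HZ0) as (Hw & Hb). exists (q Z), 0. split; auto. split; auto.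
    eapply Rle_trans; [|apply (Away Z _ M M3 M2 HM HZ)]. left. apply B. lra.
Qed.

(** For Re Z = 0 the point is outside the region, so the curve is a limit of curves that start at
    real part 1/(n + 1). After a positive time the limit has real part at least v t and lies
    inside. *)
Lemma track_out Z t : 0 <= Re Z -> 0 < t ->
  exists w, chainU w t = T Z /\ advance v c (w - Z) t.
Proof.
  intros HZ Ht. destruct (Rle_lt_or_eq_dec _ _ HZ) as [H|H].
  - destruct (chainU_flow HC Z 0 t) as (w & Hw & A); [repeat split; lra|lra|].
    rewrite (chainU_0 (L := L)) in Hw. rewrite Rminus_0_r in A. exists w. now rewrite T_out.
  - assert (Hx : forall n, 0 < / (INR n + 1)) by (intros n; apply Rinv_0_lt_compat; generalize (pos_INR n); lra).
    set (Zn := fun n : nat => (/ (INR n + 1), Im Z) : C).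
    assert (Hn : forall n, exists w, chainU w t = L (Zn n) /\ advance v c (w - Zn n) t).
    { intros n. destruct (chainU_flow HC (Zn n) 0 t) as (w & Hw & A); [|lra|].
      - assert (Hx' := Hx n). repeat split; simpl; lra.
      - rewrite (chainU_0 (L := L)) in Hw. rewrite Rminus_0_r in A. eauto. }
    destruct (choice _ Hn) as (w & Hw).
    assert (HZn : limC eventually Zn Z).
    { intros e He. destruct (inv_INR_small e He) as (N & HN). exists N. intros n Hln.
      replace (Zn n - Z)%C with (RtoC (/ (INR n + 1))) by (unfold Zn; destruct Z; apply C_ext; simpl in *; lra).
      rewrite Cmod_R, Rabs_pos_eq; [auto|left; auto]. }
    destruct (bw w (Cmod Z + 1 + c * t)) as (phi & w0 & Hphi & Hl).
    { intros n. destruct (Hw n) as (_ & _ & A).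
      assert (Cmod (Zn n) <= Cmod Z + 1).
      { replace (Zn n) with (Z + RtoC (/ (INR n + 1)))%C by (unfold Zn; destruct Z; apply C_ext; simpl in *; lra).
        eapply Rle_trans; [apply Cmod_triangle|]. rewrite Cmod_R, Rabs_pos_eq by (left; auto).
        assert (/ (INR n + 1) <= 1); [|lra]. rewrite <- Rinv_1. apply Rinv_le_contravar; [lra|]. generalize (pos_INR n); lra. }
      generalize (Cmod_rev (w n) (Zn n)). lra. }
    assert (HZphi := limC_subseq _ _ phi Hphi HZn).
    assert (Adv : advance v c (w0 - Z) t).
    { apply (advance_lim (F := eventually) (fun n => w (phi n) - Zn (phi n))%C).
      - now apply limC_minus.
      - exists O. intros n _. apply Hw. }
    exists w0. split; auto.
    assert (HR : region a w0 t).
    { destruct Adv as [A _]. assert (a * t <= v * t) by (apply Rmult_le_compat_r; lra).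
      assert (0 < a * t) by nra.
      assert (Re (w0 - Z) = Re w0 - Re Z) by (destruct w0, Z; reflexivity). repeat split; lra. }
    apply (limC_unique (F := eventually) (fun n => chainU (w (phi n)) t)).
    + apply (limC_comp (fun n => w (phi n)) (fun W => chainU W t)); auto.
      now apply (chainU_ccont HC).
    + eapply limC_ext; [|apply (limC_comp _ T _ HZphi (T_cont Z))].
      exists O. intros n _. rewrite (proj1 (Hw (phi n))). apply T_out. simpl. apply Hx.
Qed.

Lemma T_inj Z Z' : T Z = T Z' -> Z = Z'.
Proof.
  (* The curve from the edge point of the earlier time is followed to the later one. There it is
     strictly inside the region, so by univalence it cannot be the edge point of [X'], unless the
     times agree. *)
  assert (In2 : forall X X', Re X < 0 -> Re X' < 0 -> Re X' <= Re X -> T X = T X' -> X = X').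
  { intros X X' H H' Hle HE. rewrite !T_in in HE by auto.
    assert (HR := region_in X H). assert (HR' := region_in X' H').
    assert (Ht : - Re X / a <= - Re X' / a).
    { apply Rmult_le_compat_r; [left; apply Rinv_0_lt_compat; lra|lra]. }
    destruct (chainU_flow HC _ _ _ HR Ht) as (w & Hw & A).
    destruct (advance_region HC _ _ _ _ HR Ht A) as [HRw Hst].
    rewrite HE in Hw. apply (chainU_inj HC) in Hw; auto. subst w.
    destruct (Rle_lt_or_eq_dec _ _ Ht) as [Hlt|Heq].
    - specialize (Hst Hlt). simpl in Hst.
      replace (a * (- Re X' / a)) with (- Re X') in Hst by (field; lra). lra.
    - rewrite Heq in A. destruct A as [_ A]. rewrite Rminus_diag, Rmult_0_r in A.
      assert (E0 : mir X' = mir X) by (apply Cmod_eq0_sub, Rle_antisym; [exact A|apply Cmod_ge_0]).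
      rewrite <- (mir_mir X), <- (mir_mir X'). now rewrite E0. }
  assert (OutIn : forall X X', 0 <= Re X -> Re X' < 0 -> T X = T X' -> False).
  { intros X X' H H' HE. assert (HR := region_in X' H').
    assert (Ht : 0 < - Re X' / a) by (apply Rdiv_lt_0_compat; lra).
    destruct (track_out X _ H Ht) as (w & Hw & [A _]).
    rewrite HE, T_in in Hw by auto.
    assert (Ev : a * (- Re X' / a) < v * (- Re X' / a)) by (apply Rmult_lt_compat_r; auto).
    replace (a * (- Re X' / a)) with (- Re X') in Ev by (field; lra).
    assert (Er : Re (w - X) = Re w - Re X) by (destruct w, X; reflexivity).
    apply (chainU_inj HC) in Hw; auto.
    - subst w. simpl in A, Er. lra.
    - repeat split; try lra. replace (a * (- Re X' / a)) with (- Re X') by (field; lra). lra. }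
  intros HE. destruct (Rlt_le_dec (Re Z) 0) as [H|H], (Rlt_le_dec (Re Z') 0) as [H'|H'].
  - destruct (Rle_dec (Re Z') (Re Z)) as [Hle|Hle]; [now apply In2|].
    symmetry. apply In2; auto. lra.
  - exfalso. now apply (OutIn Z' Z).
  - exfalso. now apply (OutIn Z Z').
  (* Both curves reach the same point at every small time t, having moved at most c t each, so |Z -
     Z'| <= 2 c t. *)
  - apply Cmod_eps. intros e He. set (t := e / (2 * c)).
    assert (Ht : 0 < t) by (apply Rdiv_lt_0_compat; lra).
    assert (Ect : 2 * (c * t) = e) by (unfold t; field; lra).
    destruct (track_out Z t H Ht) as (w & Hw & A). destruct (track_out Z' t H' Ht) as (w' & Hw' & A').
    assert (Hreg : forall X w, 0 <= Re X -> advance v c (w - X) t -> region a w t).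
    { intros X x HX [B _]. assert (Er : Re (x - X) = Re x - Re X) by (destruct x, X; reflexivity).
      assert (a * t < v * t) by (apply Rmult_lt_compat_r; auto). assert (0 < a * t) by nra. repeat split; lra. }
    assert (w = w').
    { apply (chainU_inj HC w w' t); [eapply Hreg; [exact H|exact A]|eapply Hreg; [exact H'|exact A']|congruence]. }
    subst w'. destruct A as [_ A], A' as [_ A'].
    generalize (Cmod_tri3 Z w Z'). rewrite (Cmod_sub_sym Z w). lra.
Qed.

(* Follow the level curve of [chainU] through [(W, t1)] backwards in time until it leaves the
   interior of the region; it leaves it through a point where [chainU] is a value of [T]. *)
Lemma chainU_in_range W t1 : region a W t1 -> exists Z, T Z = chainU W t1.
Proof.
  intros HR. set (p := chainU W t1).
  set (G := fun tau => 0 <= tau <= t1 /\ exists w, region a w (t1 - tau) /\ chainU w (t1 - tau) = p /\ Cmod (w - W) <= c * tau).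
  assert (Ht1 : 0 <= t1) by apply HR.
  assert (G0 : G 0).
  { split; [lra|]. exists W. rewrite Rminus_0_r, Rmult_0_r. split; auto. split; auto.
    replace (W - W)%C with (RtoC 0) by ring. rewrite Cmod_0. lra. }
  destruct (completeness G) as (m & Hm1 & Hm2).
  { exists t1. intros u [Hu _]. lra. }
  { exists 0. exact G0. }
  assert (Hm0 : 0 <= m) by (apply Hm1; exact G0).
  assert (Hmt : m <= t1) by (apply Hm2; intros u [Hu _]; lra).
  assert (Sq : forall n : nat, exists y : R * C, m - / (INR n + 1) < fst y <= m /\ 0 <= fst y <= t1 /\
     region a (snd y) (t1 - fst y) /\ chainU (snd y) (t1 - fst y) = p /\ Cmod (snd y - W) <= c * fst y).
  { intros n. assert (Hp : 0 < / (INR n + 1)) by (apply Rinv_0_lt_compat; generalize (pos_INR n); lra).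
    apply NNPP. intros N.
    assert (B : is_upper_bound G (m - / (INR n + 1))).
    { intros u Gu. apply Rnot_lt_le. intros Lt. apply N. assert (u <= m) by now apply Hm1.
      destruct Gu as (Hu & w & Hw). exists (u, w). simpl. tauto. }
    specialize (Hm2 _ B). lra. }
  destruct (choice _ Sq) as (y & Hy).
  destruct (bw (fun n => snd (y n)) (Cmod W + c * t1)) as (phi & w & Hphi & Hw).
  { intros n. destruct (Hy n) as (_ & H1 & _ & _ & H2). generalize (Cmod_rev (snd (y n)) W). nra. }
  set (un := fun n => t1 - fst (y (phi n))). set (wn := fun n => snd (y (phi n))).
  assert (Hun : forall e, 0 < e -> eventually (fun n => Rabs (un n - (t1 - m)) < e)).
  { intros e He. destruct (inv_INR_small e He) as (N & HN). exists N. intros n Hn.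
    destruct (Hy (phi n)) as (H1 & _).
    assert (/ (INR (phi n) + 1) < e) by (apply HN; generalize (Hphi n); lia).
    unfold un. apply Rabs_def1; lra. }
  assert (HRn : forall n, region a (wn n) (un n)) by (intros n; apply Hy).
  assert (Hpn : forall n, chainU (wn n) (un n) = p) by (intros n; apply Hy).
  assert (Hre : forall e, 0 < e -> eventually (fun n => Rabs (Re (wn n) - Re w) < e)).
  { intros e He. generalize (limC_re _ _ Hw e He). apply filter_imp. intros n.
    now rewrite <- RtoC_minus, Cmod_R. }
  assert (Hlow : a * (t1 - m) <= Re w).
  { apply le_epsilon. intros e He.
    assert (He2 : 0 < e / (2 * a)) by (apply Rdiv_lt_0_compat; lra).
    destruct (filter_ex (F := eventually) _ (filter_and _ _ (Hre _ (half_pos _ He)) (Hun _ He2))) as (n & B1 & B2).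
    destruct (HRn n) as (_ & _ & B3). apply Rabs_def2 in B1, B2. destruct B2 as [_ B2].
    apply Rmult_lt_compat_l with (r := a) in B2; [|lra].
    replace (a * - (e / (2 * a))) with (- (e / 2)) in B2 by (field; lra). lra. }
  assert (Hclose : Cmod (w - W) <= c * m).
  { apply (limC_le (F := eventually) _ w _ _ Hw). exists O. intros n _.
    destruct (Hy (phi n)) as (H1 & _ & _ & _ & H2). eapply Rle_trans; [exact H2|]. apply Rmult_le_compat_l; lra. }
  (* A limit on the axis has left the region. There the common value [p] is found to be
     [ell (Im w)], from the boundary estimates along the approximating points. *)
  destruct (Req_dec (Re w) 0) as [H0|H0].
  - exists w. apply Cmod_eps. intros e He. rewrite T_bd by auto.
    destruct (chainU_near_boundary HC) as (K1 & d & HK1 & Hd & B).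
    assert (HKK : 0 < e / 2 / (K + K1)) by (apply Rdiv_lt_0_compat; lra).
    destruct (pw_small (1 - k) _ ltac:(lra) HKK) as (d1 & Hd1 & P1).
    destruct (ell_cont (Im w) (e / 2) (half_pos _ He)) as (d2 & Hd2 & P2).
    assert (Him := limC_im _ _ Hw d2 Hd2).
    assert (Hdd : 0 < Rmin d d1) by (apply Rmin_pos; lra).
    destruct (filter_ex (F := eventually) _ (filter_and _ _ Him (Hre _ Hdd))) as (n & B1 & B2).
    rewrite <- RtoC_minus, Cmod_R in B1. fold (wn n) in B1. specialize (P2 _ B1).
    assert (M1 := Rmin_l d d1). assert (M2 := Rmin_r d d1).
    rewrite H0, Rminus_0_r in B2. apply Rabs_def2 in B2.
    destruct (HRn n) as (R1 & R2 & R3).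
    destruct (B (wn n) (un n) (HRn n)) as [B3 _]; [lra|]. rewrite Hpn in B3.
    assert (B4 := Hell (Re (wn n)) (Im (wn n)) ltac:(lra)).
    replace ((Re (wn n), Im (wn n)) : C) with (wn n) in B4 by (destruct (wn n); reflexivity).
    assert (X := P1 (Re (wn n)) ltac:(lra)).
    apply Rmult_lt_compat_l with (r := K + K1) in X; [|lra].
    replace ((K + K1) * (e / 2 / (K + K1))) with (e / 2) in X by (field; lra).
    rewrite Cmod_sub_sym.
    generalize (Cmod_tri3 p (L (wn n)) (ell (Im w))) (Cmod_tri3 (L (wn n)) (ell (Im (wn n))) (ell (Im w))).
    lra.
  - assert (Hwp : 0 < Re w) by nra.
    assert (HRw : region a w (t1 - m)) by (repeat split; lra).
    assert (Ep : chainU w (t1 - m) = p).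
    { apply Cmod_eps. intros e He. destruct (chainU_cont HC w (t1 - m) HRw e He) as (d & Hd & A).
      destruct (filter_ex (F := eventually) _ (filter_and _ _ (Hw d Hd) (Hun d Hd))) as (n & B1 & B2).
      specialize (A (wn n) (un n) B1 B2). simpl in A. rewrite Hpn in A.
      rewrite Cmod_sub_sym. lra. }
    destruct (Req_dec (t1 - m) 0) as [Z0|Z0].
    + exists w. rewrite T_out by auto. rewrite <- Ep, Z0. symmetry. apply chainU_0.
    + destruct (Req_dec (Re w) (a * (t1 - m))) as [Z1|Z1].
      * exists (mir w). rewrite T_in by (simpl; lra). rewrite mir_mir. rewrite <- Ep. f_equal.
        simpl. rewrite Ropp_involutive, Z1. field. lra.
      * exfalso. destruct (chainU_step HC w (t1 - m) HRw) as (r & Hr & S).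
        set (gap := Re w - a * (t1 - m)). assert (Hgap : 0 < gap) by (unfold gap; lra).
        (* A step back that is allowed by [chainU_step], keeps the time nonnegative and uses at most
           half of the distance to the edge. It would contradict the choice of [m]. *)
        set (h := Rmin (r / 2) (Rmin (t1 - m) (gap / (2 * c)))).
        assert (Hh : 0 < h). { repeat apply Rmin_pos; try lra. apply Rdiv_lt_0_compat; lra. }
        assert (h1 : h <= r / 2) by apply Rmin_l.
        assert (h2 : h <= t1 - m) by (eapply Rle_trans; [apply Rmin_r|apply Rmin_l]).
        assert (h3 : c * h <= gap / 2).
        { apply Rle_trans with (c * (gap / (2 * c))).
          - apply Rmult_le_compat_l; [lra|]. eapply Rle_trans; [apply Rmin_r|apply Rmin_r].
          - right. field. lra. }
        destruct (S w (t1 - m) (t1 - m - h)) as (w' & Hw' & Hdr).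
        { replace (w - w)%C with (RtoC 0) by ring. now rewrite Cmod_0. }
        { rewrite Rminus_diag, Rabs_R0. auto. }
        { replace (t1 - m - h - (t1 - m)) with (- h) by ring. rewrite Rabs_Ropp, Rabs_pos_eq; lra. }
        apply drift_fast in Hdr; auto.
        replace (t1 - m - h - (t1 - m)) with (- h) in Hdr by ring.
        rewrite Rabs_Ropp, Rabs_pos_eq in Hdr by lra.
        assert (Hrw' : Re w - c * h <= Re w').
        { generalize (re_le_Cmod (w' - w)) (Rle_abs (- Re (w' - w))). rewrite Rabs_Ropp.
          replace (Re (w' - w)) with (Re w' - Re w) by (destruct w, w'; reflexivity). lra. }
        assert (G (m + h)).
        { split; [lra|]. exists w'. replace (t1 - (m + h)) with (t1 - m - h) by ring. split; [|split].
          - assert (0 <= a * (t1 - m)) by nra. assert (0 <= a * h) by nra.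
            unfold gap in *. repeat split; try lra.
          - congruence.
          - generalize (Cmod_tri3 w' w W). lra. }
        specialize (Hm1 _ H). lra.
Qed.

(** At a late time [chainU] is within 1 of W - 2 t s with derivative near 1, so the ball of radius 4
    about p + 2 t s contains a solution. [chainU_in_range] brings its value into the range of
    [T]. *)
Lemma T_surj p : exists Z, T Z = p.
Proof.
  destruct (chainU_far HC) as (R0 & HR0 & F).
  set (t := Rabs (Re p) + 4 + R0). generalize (Rle_abs (- Re p)) (Rabs_pos (Re p)). rewrite Rabs_Ropp. intros A1' A2'.
  assert (Ht : 0 <= t) by (unfold t; lra).
  set (W0 := (p + RtoC (2 * t) * s)%C).
  assert (Hat : t <= a * t) by nra.
  assert (EW : Re W0 = Re p + 2 * t * a) by (unfold W0; destruct p; simpl; ring).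
  assert (Hball : forall z, Cmod (z - W0) <= 4 -> a * t <= Re z /\ t + R0 <= Re z).
  { intros z Hz. generalize (re_le_Cmod (z - W0)) (Rle_abs (- Re (z - W0))). rewrite Rabs_Ropp.
    replace (Re (z - W0)) with (Re z - Re W0) by (destruct z, W0; reflexivity).
    intros. assert (Re p + 2 * t * a - 4 <= Re z) by lra. unfold t in *. split; nra. }
  destruct (solve_ball (fun W => chainU W t) W0 1 p 4 (1 / 2)) as (w & Hw & HE).
  - lra.
  - apply C1_nz.
  - intros z z' Hz Hz'. rewrite Cmod_1, Rmult_1_r.
    replace (1 * (z - z'))%C with (z - z')%C by ring.
    apply (chainU_far_inj (t + R0) t); [|now apply Hball|now apply Hball].
    intros X HX. now apply F.
  - destruct (F W0 t Ht) as [_ B].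
    { apply Hball. replace (W0 - W0)%C with (RtoC 0) by ring. rewrite Cmod_0. lra. }
    replace (W0 - RtoC (2 * t) * s)%C with p in B by (unfold W0; ring).
    rewrite Cmod_sub_sym, Cmod_1. lra.
  - destruct (Hball w Hw) as [B1 B2].
    destruct (chainU_in_range w t) as (Z & HZ); [repeat split; lra|].
    exists Z. simpl in HE. congruence.
Qed.

Lemma T_right B : exists X, forall Z, X < Re Z -> B < Re (T Z).
Proof.
  destruct (far_L HC) as (KL & HKL & X & HX & FL).
  exists (Rmax X (B + KL)). intros Z HZ.
  assert (M1 := Rmax_l X (B + KL)). assert (M2 := Rmax_r X (B + KL)).
  rewrite T_out by lra. specialize (FL Z ltac:(lra)).
  assert (He : exp (- (2) * Re Z) <= 1).
  { rewrite <- exp_0. left. apply exp_increasing. lra. }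
  generalize (re_le_Cmod (L Z - Z)) (Rle_abs (- Re (L Z - Z))). rewrite Rabs_Ropp.
  replace (Re (L Z - Z)) with (Re (L Z) - Re Z) by (destruct (L Z), Z; reflexivity).
  intros. assert (KL * exp (- (2) * Re Z) <= KL) by nra. lra.
Qed.

(** On the edge Re L is at most a t plus a constant and a ln |chainP| at most -2 a t plus a
    constant, while the argument contributes at most |b| pi. The sum is at most Re Z plus a
    constant. *)
Lemma T_left B : exists X, forall Z, Re Z < X -> Re (T Z) < B.
Proof.
  destruct (far_L HC) as (KL & HKL & X & HX & FL).
  destruct (far_q HC) as (Kq & HKq & X' & HX' & Fq).
  set (M := KL + a * ln (1 + Kq) + Rabs b * PI).
  exists (Rmin (- X) (Rmin (- X') (B - M))). intros Z HZ.
  assert (M1 := Rmin_l (- X) (Rmin (- X') (B - M))). assert (M2 := Rmin_r (- X) (Rmin (- X') (B - M))).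
  assert (M3 := Rmin_l (- X') (B - M)). assert (M4 := Rmin_r (- X') (B - M)).
  assert (HZ0 : Re Z < 0) by lra.
  assert (HR := region_in Z HZ0). assert (HS := chainP_slit HC _ _ HR). assert (HPn := slit_nz _ HS).
  rewrite T_in by auto. specialize (FL (mir Z) ltac:(simpl; lra)). specialize (Fq (mir Z) ltac:(simpl; lra)).
  simpl Re in FL, Fq. set (t := - Re Z / a) in *. set (W := mir Z) in *.
  assert (Eat : a * t = - Re Z) by (unfold t; field; lra).
  assert (Ht : 0 <= t) by apply HR.
  assert (He : exp (- (2) * - Re Z) <= 1).
  { rewrite <- exp_0. left. apply exp_increasing. lra. }
  assert (HLr : Re (L W) <= - Re Z + KL).
  { generalize (re_le_Cmod (L W - W)) (Rle_abs (Re (L W - W))).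
    replace (Re (L W - W)) with (Re (L W) - Re W) by (destruct (L W), W; reflexivity).
    change (Re W) with (- Re Z). intros. assert (KL * exp (- (2) * - Re Z) <= KL) by nra. lra. }
  assert (HPb : Cmod (chainP W t) <= (1 + Kq) * exp (- (2) * t)).
  { unfold chain_factor.
    replace (1 - (1 - exp (- (2) * t))%R * q W)%C with (exp (- (2) * t) + - ((1 - exp (- (2) * t))%R * (q W - 1)))%C
      by (rewrite RtoC_minus; ring).
    eapply Rle_trans; [apply Cmod_triangle|]. rewrite Cmod_opp, Cmod_mult, !Cmod_R.
    generalize (exp_pos (- (2) * t)). intros Hp.
    assert (H1 : exp (- (2) * t) <= 1).
    { rewrite <- exp_0. apply exp_le. lra. }
    rewrite !Rabs_pos_eq by lra.
    assert (H2 : exp (- (2) * - Re Z) <= exp (- (2) * t)).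
    { assert (t <= a * t) by nra. apply exp_le. lra. }
    generalize (Cmod_ge_0 (q W - 1)). intros.
    assert (Cmod (q W - 1) <= Kq * exp (- (2) * t)).
    { eapply Rle_trans; [exact Fq|]. apply Rmult_le_compat_l; lra. }
    nra. }
  assert (Hln : ln (Cmod (chainP W t)) <= ln (1 + Kq) - 2 * t).
  { replace (ln (1 + Kq) - 2 * t) with (ln ((1 + Kq) * exp (- (2) * t))).
    - apply ln_le; auto. now apply Cmod_pos.
    - rewrite ln_mult, ln_exp by (try apply exp_pos; lra). ring. }
  assert (Harg := Clog_Im (chainP W t)).
  assert (Hb : - (b * Im (Clog (chainP W t))) <= Rabs b * PI).
  { eapply Rle_trans; [apply Rle_abs|]. rewrite Rabs_Ropp, Rabs_mult.
    apply Rmult_le_compat_l; [apply Rabs_pos|lra]. }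
  unfold chain_log.
  assert (ER : Re (L W + s * Clog (chainP W t)) = Re (L W) + (a * ln (Cmod (chainP W t)) - b * Im (Clog (chainP W t))))
    by (destruct (L W); reflexivity).
  rewrite ER. assert (a * ln (Cmod (chainP W t)) <= a * (ln (1 + Kq) - 2 * t)) by (apply Rmult_le_compat_l; lra).
  unfold M in *. nra.
Qed.

End Extension.

(** The local information on [T] that survives a change of sign of Z or of T, hence a change of
    chart on the sphere. *)
Record plane_map (k : R) (T : C -> C) : Prop := PlaneMap {
  pm_cont : forall Z, ccont T Z;
  pm_qc : forall Z0, exists r K, 0 < r /\ 0 < K /\ forall Z, Cmod (Z - Z0) < r -> Re Z <> 0 ->
    exists al be, wd T Z al be /\ Cmod be <= k * Cmod al /\ Cmod al <= K * pw (Rabs (Re Z)) (- k)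
}.

Lemma core_extension a b k L q E : core a b k L q E ->
  exists T, plane_map k T /\ (forall Z n, T (Z + turn n)%C = (T Z + turn n)%C) /\ (forall Z, 0 < Re Z -> T Z = L Z) /\
    (forall Z Z', T Z = T Z' -> Z = Z') /\ (forall p, exists Z, T Z = p) /\
    (forall B, exists X, forall Z, X < Re Z -> B < Re (T Z)) /\
    (forall B, exists X, forall Z, Re Z < X -> Re (T Z) < B).
Proof.
  intros HC. destruct (boundary_limit HC) as (K & ell & HK & Hell).
  exists (extension a b L q ell). split; [split|split; [|split; [|split; [|split; [|split]]]]].
  - intros; now apply (T_cont HC HK Hell).
  - intros; now apply (T_qc_local HC).
  - intros; now apply (T_turn HC HK Hell).
  - intros; now apply (T_out).
  - intros Z Z' HE. now apply (T_inj HC HK Hell).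
  - intros; now apply (T_surj HC HK Hell).
  - intros; now apply (T_right HC).
  - intros; now apply (T_left HC).
Qed.

(** * Absolute continuity on lines *)

(** The odd extension of x^p. It increases on the whole line and so can majorise across a singular
    point. *)
Definition opw (x p : R) : R :=
  if Rlt_dec 0 x then pw x p else if Rlt_dec x 0 then - pw (- x) p else 0.

Lemma opw_pos x p : 0 < x -> opw x p = pw x p.
Proof. intros H. unfold opw. destruct (Rlt_dec 0 x); [auto|lra]. Qed.

Lemma opw_neg x p : x < 0 -> opw x p = - pw (- x) p.
Proof.
  intros H. unfold opw. destruct (Rlt_dec 0 x); [lra|]. destruct (Rlt_dec x 0); [auto|lra].
Qed.

Lemma opw_0 p : opw 0 p = 0.
Proof. unfold opw. destruct (Rlt_dec 0 0); [lra|]. destruct (Rlt_dec 0 0); [lra|auto]. Qed.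

Lemma opw_mono x y p : 0 < p -> x <= y -> opw x p <= opw y p.
Proof.
  intros Hp H. destruct (Rtotal_order x 0) as [Hx|[Hx|Hx]], (Rtotal_order y 0) as [Hy|[Hy|Hy]]; try lra;
    subst; rewrite ?opw_0, ?(opw_neg x), ?(opw_pos x), ?(opw_neg y), ?(opw_pos y) by auto;
    try lra.
  - apply Ropp_le_contravar, pw_mono; lra.
  - generalize (pw_pos (- x) p). lra.
  - generalize (pw_pos (- x) p) (pw_pos y p). lra.
  - generalize (pw_pos y p). lra.
  - apply pw_mono; lra.
Qed.

Lemma opw_deriv x p : x <> 0 -> derivable_pt_lim (fun x => opw x p) x (p * pw (Rabs x) (p - 1)).
Proof.
  intros Hx. apply is_derive_Reals. destruct (Rtotal_order x 0) as [H|[H|H]]; [|lra|].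
  - rewrite Rabs_left by auto.
    apply (is_derive_ext_loc (fun x => - pw (- x) p)).
    + exists (mkposreal (- x) ltac:(lra)). intros y Hy. apply Rabs_def2 in Hy. simpl in Hy.
      unfold minus, plus, opp in Hy; simpl in Hy. symmetry. apply opw_neg. lra.
    + unfold pw. auto_derive; [lra|].
      replace ((p - 1) * ln (- x)) with (p * ln (- x) + - ln (- x)) by ring.
      rewrite exp_plus, exp_Ropp, exp_ln by lra. field. lra.
  - rewrite Rabs_pos_eq by lra.
    apply (is_derive_ext_loc (fun x => pw x p)).
    + exists (mkposreal x H). intros y Hy. apply Rabs_def2 in Hy. simpl in Hy.
      unfold minus, plus, opp in Hy; simpl in Hy. symmetry. apply opw_pos. lra.
    + apply is_derive_Reals. now apply pw_deriv.
Qed.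

Lemma opw_cont x p : 0 < p -> continuity_pt (fun x => opw x p) x.
Proof.
  intros Hp. destruct (Req_dec x 0) as [->|H].
  - intros e He. destruct (pw_small p e Hp He) as (d & Hd & A). exists d. split; auto.
    intros y [_ Hy]. change (Rabs (y - 0) < d) in Hy. change (Rabs (opw y p - opw 0 p) < e).
    rewrite opw_0, Rminus_0_r in *.
    destruct (Rtotal_order y 0) as [H|[H|H]].
    + rewrite opw_neg, Rabs_Ropp, Rabs_pos_eq by (auto; left; apply pw_pos).
      rewrite Rabs_left in Hy by auto. apply A. lra.
    + subst. rewrite opw_0, Rabs_R0. auto.
    + rewrite opw_pos, Rabs_pos_eq by (auto; left; apply pw_pos).
      rewrite Rabs_pos_eq in Hy by lra. apply A. lra.
  - apply derivable_continuous_pt. eexists. now apply opw_deriv.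
Qed.

Lemma opw_shift_deriv x c p : x <> c ->
  derivable_pt_lim (fun x => opw (x - c) p) x (p * pw (Rabs (x - c)) (p - 1)).
Proof.
  intros H. rewrite <- (Rmult_1_r (p * pw _ _)).
  apply (derivable_pt_lim_comp (fun x => x - c) (fun x => opw x p)).
  - apply is_derive_Reals. auto_derive; auto.
  - apply opw_deriv. lra.
Qed.

Lemma opw_shift_cont x c p : 0 < p -> continuity_pt (fun x => opw (x - c) p) x.
Proof.
  intros H. apply (continuity_pt_comp (fun x => x - c) (fun x => opw x p)).
  - apply derivable_continuous_pt. exists 1. apply is_derive_Reals. auto_derive; auto.
  - now apply opw_cont.
Qed.

Lemma deriv_nonpos_le_except (phi : R -> R) c s t :
  s <= t ->
  (forall x, s <= x <= t -> continuity_pt phi x) ->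
  (forall x, s < x < t -> x <> c -> exists l, derivable_pt_lim phi x l /\ l <= 0) ->
  phi t <= phi s.
Proof.
  intros Hst Hc Hd. destruct (Rle_dec c s) as [H1|H1].
  { apply deriv_nonpos_le; auto. intros x Hx. apply Hd; lra. }
  destruct (Rle_dec t c) as [H2|H2].
  { apply deriv_nonpos_le; auto. intros x Hx. apply Hd; lra. }
  apply Rle_trans with (phi c).
  - apply deriv_nonpos_le; [lra| |]; intros x Hx; [apply Hc|apply Hd]; lra.
  - apply deriv_nonpos_le; [lra| |]; intros x Hx; [apply Hc|apply Hd]; lra.
Qed.

(* Trading exponents makes the total variation of a singular power, up to a Lipschitz term, as small
   as desired, since [x^(p-1) <= Lip + e x^(p/2-1)]. *)
Lemma opw_split p e : 0 < p <= 1 -> 0 < e -> exists Lip, 0 < Lip /\ forall c x y, x <= y ->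
  opw (y - c) p - opw (x - c) p <= Lip * (y - x) + e * (opw (y - c) (p / 2) - opw (x - c) (p / 2)).
Proof.
  (* At distance u < d from the singular point the derivative p u^(p - 1) is absorbed by e (p/2)
     u^(p/2 - 1); at greater distance it is at most Lip. *)
  intros Hp He. destruct (pw_small (p / 2) (e / 2)) as (d & Hd & A); try lra.
  exists (p * pw (d / 2) (p - 1)). split. { apply Rmult_lt_0_compat; [lra|apply pw_pos]. }
  intros c x y Hxy. set (Lip := p * pw (d / 2) (p - 1)).
  assert (H : opw (y - c) p + - (Lip * y) + - (e * opw (y - c) (p / 2)) <= opw (x - c) p + - (Lip * x) + - (e * opw (x - c) (p / 2))); [|lra].
  apply (deriv_nonpos_le_except (fun y => opw (y - c) p + - (Lip * y) + - (e * opw (y - c) (p / 2))) c x y Hxy).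
  - intros z _. repeat apply continuity_pt_plus.
    + apply opw_shift_cont. lra.
    + apply continuity_pt_opp. apply derivable_continuous_pt. eexists. apply derivable_pt_lim_linear.
    + apply continuity_pt_opp. apply (continuity_pt_scal (fun y => opw (y - c) (p / 2)) e). apply opw_shift_cont. lra.
  - intros z _ Hz. eexists. split.
    + repeat apply derivable_pt_lim_plus.
      * now apply opw_shift_deriv.
      * apply derivable_pt_lim_opp, derivable_pt_lim_linear.
      * apply derivable_pt_lim_opp. apply (derivable_pt_lim_scal (fun y => opw (y - c) (p / 2))). now apply opw_shift_deriv.
    + set (u := Rabs (z - c)). assert (Hu : 0 < u) by (apply Rabs_pos_lt; lra).
      assert (E : pw u (p - 1) = pw u (p / 2) * pw u (p / 2 - 1)).
      { unfold pw. rewrite <- exp_plus. f_equal. field. }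
      generalize (pw_pos u (p / 2)) (pw_pos u (p / 2 - 1)) (pw_pos u (p - 1)). intros P1 P2 P3.
      destruct (Rlt_le_dec u d) as [Hud|Hud].
      * assert (B := A u ltac:(lra)).
        assert (0 < Lip) by (apply Rmult_lt_0_compat; [lra|apply pw_pos]).
        assert (p * pw u (p - 1) <= e * (p / 2 * pw u (p / 2 - 1))); [|lra].
        rewrite E. assert (pw u (p / 2) * pw u (p / 2 - 1) <= e / 2 * pw u (p / 2 - 1)) by (apply Rmult_le_compat_r; lra).
        nra.
      * assert (B := pw_anti (d / 2) u (1 - p) ltac:(lra) ltac:(lra)).
        replace (- (1 - p)) with (p - 1) in B by ring.
        assert (p * pw u (p - 1) <= Lip) by (apply Rmult_le_compat_l; lra).
        assert (0 <= e * (p / 2 * pw u (p / 2 - 1))) by (repeat apply Rmult_le_pos; lra). lra.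
Qed.

Definition incr_sum (m : R -> R) (l : list (R * R)) : R :=
  fold_right (fun st acc => (m (snd st) - m (fst st)) + acc) 0 l.

Lemma incr_sum_telescope (m : R -> R) l : (forall x y, x <= y -> m x <= m y) ->
  forall A B, Defs.intervals_in A B l -> A <= B /\ incr_sum m l <= m B - m A.
Proof.
  intros Hm. induction l as [|[x y] l IH]; simpl; intros A B H.
  - split; auto. generalize (Hm A B H). lra.
  - destruct H as (H1 & H2 & H3). destruct (IH _ _ H3) as [H4 H5].
    split; [lra|]. generalize (Hm _ _ H1). lra.
Qed.

Lemma incr_sum_le (m m' : R -> R) (n : R -> R) l : forall A B, Defs.intervals_in A B l ->
  (forall x y, A <= x -> x <= y -> y <= B -> m y - m x <= (m' y - m' x) + (n y - n x)) ->
  incr_sum m l <= incr_sum m' l + incr_sum n l.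
Proof.
  induction l as [|[x y] l IH]; simpl; intros A B H Hm; [lra|].
  destruct H as (H1 & H2 & H3).
  assert (HyB : y <= B).
  { clear - H3. revert y H3. induction l as [|[u w] l IH]; simpl; intros y H; auto.
    destruct H as (H1 & H2 & H3). specialize (IH _ H3). lra. }
  assert (I := IH _ _ H3 (fun x' y' a1 a2 a3 => Hm x' y' ltac:(lra) a2 a3)).
  generalize (Hm x y H1 H2 HyB). lra.
Qed.

Lemma incr_sum_linear K l : incr_sum (fun x => K * x) l = K * Defs.total_length l.
Proof. induction l as [|[x y] l IH]; simpl; [ring|]. rewrite IH. ring. Qed.

Lemma incr_sum_scal K m l : incr_sum (fun x => K * m x) l = K * incr_sum m l.
Proof. induction l as [|[x y] l IH]; simpl; [ring|]. rewrite IH. ring. Qed.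

(** Absolute continuity of an increasing function. It passes to every curve whose increments are
    dominated by those of [m], which takes the place of integrating the derivative. *)
Definition ac_incr (m : R -> R) (x1 x2 : R) : Prop :=
  forall eps, 0 < eps -> exists del, 0 < del /\ forall l, Defs.intervals_in x1 x2 l ->
    Defs.total_length l < del -> incr_sum m l < eps.

(** By [opw_split] the sum of increments is at most Lip times the total length plus e' times the
    total rise of a half power, which is bounded on the interval. *)
Lemma ac_incr_opw c p x1 x2 : 0 < p <= 1 -> ac_incr (fun x => opw (x - c) p) x1 x2.
Proof.
  intros Hp e He. set (V := opw (x2 - c) (p / 2) - opw (x1 - c) (p / 2)).
  set (e' := e / (2 * (Rabs V + 1))). generalize (Rabs_pos V) (Rle_abs V); intros HV1 HV2.
  assert (He' : 0 < e') by (apply Rdiv_lt_0_compat; lra).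
  destruct (opw_split p e' Hp He') as (Lip & HLip & A).
  exists (e / (2 * Lip)). split; [apply Rdiv_lt_0_compat; lra|]. intros l Hl Ht.
  assert (B := incr_sum_le (fun x => opw (x - c) p) (fun x => Lip * x) (fun x => e' * opw (x - c) (p / 2)) l _ _ Hl).
  rewrite incr_sum_linear, incr_sum_scal in B.
  eapply Rle_lt_trans; [apply B|].
  - intros x y _ Hxy _. generalize (A c x y Hxy). lra.
  - assert (I : incr_sum (fun x => opw (x - c) (p / 2)) l <= V).
    { apply (incr_sum_telescope (fun x => opw (x - c) (p / 2))); auto. intros x y Hxy. apply opw_mono; lra. }
    apply Rmult_lt_compat_l with (r := Lip) in Ht; auto.
    replace (Lip * (e / (2 * Lip))) with (e / 2) in Ht by (field; lra).
    assert (e' * incr_sum (fun x => opw (x - c) (p / 2)) l <= e' * (Rabs V + 1)) by (apply Rmult_le_compat_l; lra).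
    replace (e' * (Rabs V + 1)) with (e / 2) in H by (unfold e'; field; lra). lra.
Qed.

Lemma ac_incr_plus m n x1 x2 : ac_incr m x1 x2 -> ac_incr n x1 x2 -> ac_incr (fun x => m x + n x) x1 x2.
Proof.
  intros H1 H2 e He. destruct (H1 _ (half_pos _ He)) as (d & Hd & A).
  destruct (H2 _ (half_pos _ He)) as (d' & Hd' & A').
  exists (Rmin d d'). split; [now apply Rmin_pos|]. intros l Hl Ht.
  assert (M1 := Rmin_l d d'). assert (M2 := Rmin_r d d').
  specialize (A l Hl ltac:(lra)). specialize (A' l Hl ltac:(lra)).
  assert (B := incr_sum_le (fun x => m x + n x) m n l _ _ Hl).
  eapply Rle_lt_trans; [apply B; intros; lra|]. lra.
Qed.

Lemma ac_incr_id x1 x2 : ac_incr (fun x => x) x1 x2.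
Proof.
  intros e He. exists e. split; auto.
Qed.

Lemma abs_cont_majorant (u : R -> C) (m : R -> R) K x1 x2 : 0 < K -> ac_incr m x1 x2 ->
  (forall s t, x1 <= s -> s <= t -> t <= x2 -> Cmod (u t - u s) <= K * (m t - m s)) ->
  Defs.abs_cont u x1 x2.
Proof.
  intros HK Hm Hu e He. destruct (Hm (e / K)) as (d & Hd & A); [now apply Rdiv_lt_0_compat|].
  exists d. split; auto. intros l Hl Ht. specialize (A l Hl Ht).
  assert (B : Defs.variation u l <= K * incr_sum m l).
  { clear A Ht. revert Hl. assert (H0 : x1 <= x1) by lra. revert H0. generalize x1 at 2 3.
    induction l as [|[x y] l IH]; simpl; intros A HA H; [lra|].
    destruct H as (H1 & H2 & H3).
    assert (HyB : y <= x2).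
    { clear - H3. revert y H3. induction l as [|[u w] l IH]; simpl; intros y H; auto.
      destruct H as (H1 & H2 & H3). specialize (IH _ H3). lra. }
    specialize (IH y ltac:(lra) H3).
    assert (D := Hu x y ltac:(lra) H2 HyB).
    change (Defs.Cnorm (Defs.Csub (u y) (u x))) with (Cmod (u y - u x)). lra. }
  apply Rmult_lt_compat_l with (r := K) in A; auto.
  replace (K * (e / K)) with e in A by (field; lra). lra.
Qed.

(** Compactness through a supremum. When an interval crosses from the part already treated into a
    local neighbourhood, the two constants are added. *)
Lemma majorant_global (u : R -> C) (m : R -> R) x1 x2 : x1 <= x2 ->
  (forall x y, x <= y -> m x <= m y) ->
  (forall x, x1 <= x <= x2 -> exists r K, 0 < r /\ 0 < K /\ forall s t, x - r < s -> s <= t -> t < x + r ->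
     Cmod (u t - u s) <= K * (m t - m s)) ->
  exists K, 0 < K /\ forall s t, x1 <= s -> s <= t -> t <= x2 -> Cmod (u t - u s) <= K * (m t - m s).
Proof.
  intros H12 Hm Hloc.
  set (G := fun z => x1 <= z <= x2 /\ exists K, 0 < K /\ forall s t, x1 <= s -> s <= t -> t <= z -> Cmod (u t - u s) <= K * (m t - m s)).
  assert (G0 : G x1).
  { split; [lra|]. exists 1. split; [lra|]. intros s t H1 H2 H3. assert (s = t) by lra. subst.
    replace (u t - u t)%C with (RtoC 0) by ring. rewrite Cmod_0. lra. }
  destruct (completeness G) as (z & Hz1 & Hz2).
  { exists x2. intros y [Hy _]. lra. }
  { exists x1. exact G0. }
  assert (Hz : x1 <= z <= x2).
  { split; [now apply Hz1|]. apply Hz2. intros y [Hy _]. lra. }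
  destruct (Hloc z Hz) as (r & K' & Hr & HK' & B).
  assert (exists y, z - r < y <= z /\ G y) as (y & Hy & _ & K & HK & A).
  { apply NNPP. intros N. assert (Ub : is_upper_bound G (z - r)).
    { intros y Gy. apply Rnot_lt_le. intros Hy. apply N. exists y. split; auto. }
    specialize (Hz2 _ Ub). lra. }
  set (z' := Rmin x2 (z + r / 2)).
  assert (Hz' : z' <= x2 /\ z' <= z + r / 2) by (split; [apply Rmin_l|apply Rmin_r]).
  assert (Gz : G z').
  { split. { split; [apply Rmin_glb; lra|lra]. }
    exists (K + K'). split; [lra|]. intros s t H1 H2 H3.
    assert (Mst := Hm s t H2).
    destruct (Rle_dec t y) as [Hty|Hty].
    - generalize (A s t H1 H2 Hty). nra.
    - destruct (Rle_dec y s) as [Hys|Hys].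
      + generalize (B s t ltac:(lra) H2 ltac:(lra)). nra.
      + generalize (A s y H1 ltac:(lra) ltac:(lra)) (B y t ltac:(lra) ltac:(lra) ltac:(lra)).
        assert (M1 := Hm s y ltac:(lra)). assert (M2 := Hm y t ltac:(lra)).
        generalize (Cmod_tri3 (u t) (u y) (u s)). nra. }
  assert (z' <= z) by now apply Hz1.
  assert (z' = x2). { unfold z', Rmin in *. destruct (Rle_dec x2 (z + r / 2)); lra. }
  rewrite <- H0. destruct Gz as (_ & K2 & HK2 & A2). exists K2. split; auto.
Qed.

Lemma ln_lower y : 0 < y <= 2 -> Rabs (y - 1) / 2 <= Rabs (ln y).
Proof.
  intros Hy. assert (H1 : forall x, 0 < x -> ln x <= x - 1).
  { intros x Hx. generalize (exp_ineq1_le (ln x)). rewrite exp_ln by auto. lra. }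
  destruct (Rle_dec 1 y) as [H|H].
  - assert (B := H1 (/ y) ltac:(apply Rinv_0_lt_compat; lra)). rewrite ln_Rinv in B by lra.
    rewrite Rabs_pos_eq by lra.
    assert (E : (y - 1) / 2 <= 1 - / y).
    { apply Rmult_le_reg_r with y; [lra|]. replace ((1 - / y) * y) with (y - 1) by (field; lra). nra. }
    generalize (Rle_abs (ln y)). lra.
  - assert (B := H1 y ltac:(lra)). rewrite Rabs_left by lra. rewrite Rabs_left by lra. lra.
Qed.

(** [plane_map] seen through w = exp Z, where |Re Z| = |ln |w|| and the axis becomes the unit
    circle. *)
Record local_qc (k : R) (f : C -> C) : Prop := LocalQc {
  lq_cont : forall w : C, w <> 0 -> ccont f w;
  lq_deriv : forall w0 : C, w0 <> 0 -> exists r K, 0 < r /\ 0 < K /\ forall w, Cmod (w - w0) < r -> Cmod w <> 1 ->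
    exists al be, wd f w al be /\ Cmod be <= k * Cmod al /\ Cmod al <= K * pw (Rabs (ln (Cmod w))) (- k)
}.

Lemma pw_mult x y p : 0 < x -> 0 < y -> pw (x * y) p = pw x p * pw y p.
Proof. intros. unfold pw. rewrite ln_mult, <- exp_plus by auto. f_equal. ring. Qed.

Lemma rcont_line (f : C -> C) (p e : C) t : Cmod e = 1 -> ccont f (p + RtoC t * e) -> rcont (fun t => f (p + RtoC t * e)%C) t.
Proof.
  intros He Hf eps Hp. destruct (Hf eps Hp) as (d & Hd & A). exists d. split; auto.
  intros t' Ht. apply A. replace (p + RtoC t' * e - (p + RtoC t * e))%C with (RtoC (t' - t) * e)%C
    by (rewrite RtoC_minus; ring).
  rewrite Cmod_mult, He, Cmod_R. lra.
Qed.

(** The line has distance |y0| from the origin, with foot at t = 0, and meets the circle at t = +-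
    sqrt(1 - y0^2), transversally because y0^2 <> 1. So |ln |w|| is at least a multiple of the
    distance to the crossing, and the derivative bound integrates to a power 1 - k. If |y0| > 1,
    [sqrt] returns 0 and the two powers only enlarge the majorant. *)
Lemma line_majorant k f (p e : C) y0 x : 0 <= k < 1 -> local_qc k f -> Cmod e = 1 -> y0 <> 0 -> y0 ^ 2 <> 1 ->
  (forall t, Cmod (p + RtoC t * e) ^ 2 = t ^ 2 + y0 ^ 2) ->
  exists r K, 0 < r /\ 0 < K /\ forall s t, x - r < s -> s <= t -> t < x + r ->
    Cmod (f (p + RtoC t * e)%C - f (p + RtoC s * e)%C) <=
      K * ((t + (opw (t - sqrt (1 - y0 ^ 2)) (1 - k) + opw (t - - sqrt (1 - y0 ^ 2)) (1 - k))) -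
           (s + (opw (s - sqrt (1 - y0 ^ 2)) (1 - k) + opw (s - - sqrt (1 - y0 ^ 2)) (1 - k)))).
Proof.
  intros Hk Hf He Hy Hy1 Hmod. set (c := sqrt (1 - y0 ^ 2)).
  set (l := fun t : R => (p + RtoC t * e)%C).
  assert (Hnz : forall t, 0 < Cmod (l t)).
  { intros t. assert (E := Hmod t). fold (l t) in E. generalize (Cmod_ge_0 (l t)). intros.
    destruct (Req_dec (Cmod (l t)) 0) as [Z|Z]; [|lra]. rewrite Z in E.
    assert (0 < y0 ^ 2) by (simpl; nra). nra. }
  assert (Hl0 : l x <> 0) by (intros Z; generalize (Hnz x); rewrite Z, Cmod_0; lra).
  destruct (lq_deriv k f Hf (l x) Hl0) as (r0 & K0 & Hr0 & HK0 & D).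
  assert (Hdist : forall t, Cmod (l t - l x) = Rabs (t - x)).
  { intros t. unfold l. replace (p + RtoC t * e - (p + RtoC x * e))%C with (RtoC (t - x) * e)%C by (rewrite RtoC_minus; ring).
    rewrite Cmod_mult, He, Cmod_R. ring. }
  assert (Rd : forall t, Rabs (t - x) < r0 -> Cmod (l t) <> 1 -> exists v, rd (fun t => f (l t)) t v /\
    Cmod v <= 2 * K0 * pw (Rabs (ln (Cmod (l t)))) (- k)).
  { intros t Ht Hne. destruct (D (l t)) as (al & be & Hw & Hb & Hal); [rewrite Hdist; auto|auto|].
    eexists. split; [apply rd_of_wd; exact Hw|].
    eapply Rle_trans; [apply Cmod_triangle|]. rewrite !Cmod_mult, Cmod_conj, He.
    generalize (Cmod_ge_0 al). intros. nra. }
  assert (Rc : forall t, rcont (fun t => f (l t)) t).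
  { intros t. apply rcont_line; auto. apply (lq_cont k f Hf). intros Z. generalize (Hnz t). unfold l. rewrite Z, Cmod_0. lra. }
  assert (Hp1 : 0 < 1 - k) by lra.
  assert (Mc : forall d s t, s <= t -> 0 <= opw (t - d) (1 - k) - opw (s - d) (1 - k)).
  { intros d s t Hst. assert (M := opw_mono (s - d) (t - d) (1 - k) Hp1 ltac:(lra)). lra. }
  assert (Eln : forall t, ln (Cmod (l t)) = / 2 * ln (t ^ 2 + y0 ^ 2)).
  { intros t. rewrite <- Hmod. fold (l t). simpl. rewrite Rmult_1_r, ln_mult by auto. field. }
  assert (Hx2 : 0 < x ^ 2 + y0 ^ 2) by (assert (0 < y0 ^ 2) by (simpl; nra); assert (0 <= x ^ 2) by (simpl; nra); lra).
  destruct (Req_dec (x ^ 2 + y0 ^ 2) 1) as [E1|E1].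
  - assert (Hx : x ^ 2 = 1 - y0 ^ 2) by lra.
    assert (Hxn : x <> 0) by (intros Z; subst; simpl in Hx; lra).
    assert (Hxc : x = c \/ x = - c).
    { assert (Ec : c = Rabs x). { unfold c. rewrite <- Hx. replace (x ^ 2) with (Rsqr x) by (unfold Rsqr; ring). apply sqrt_Rsqr_abs. }
      rewrite Ec. destruct (Rle_dec 0 x); [left; now rewrite Rabs_pos_eq|right; rewrite Rabs_left by lra; ring]. }
    assert (Hax : 0 < Rabs x) by now apply Rabs_pos_lt.
    (* The second bound keeps |t + x| between |x| and 3 |x|; the third keeps t^2 + y0^2 within 1 of
       1, where [ln_lower] applies. *)
    set (r := Rmin r0 (Rmin (Rabs x) (/ (3 * Rabs x)))).
    assert (Hr : 0 < r). { repeat apply Rmin_pos; auto. apply Rinv_0_lt_compat. lra. }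
    assert (R1 : r <= r0) by apply Rmin_l.
    assert (R2 : r <= Rabs x) by (eapply Rle_trans; [apply Rmin_r|apply Rmin_l]).
    assert (R3 : r <= / (3 * Rabs x)) by (eapply Rle_trans; [apply Rmin_r|apply Rmin_r]).
    assert (Low : forall t, Rabs (t - x) < r -> t <> x -> Cmod (l t) <> 1 /\ Rabs x / 4 * Rabs (t - x) <= Rabs (ln (Cmod (l t)))).
    { intros t Ht Hne.
      assert (Es : t ^ 2 + y0 ^ 2 - 1 = (t - x) * (t + x)) by (simpl in *; nra).
      assert (Htx : Rabs x <= Rabs (t + x) <= 3 * Rabs x).
      { replace (t + x) with ((t - x) + 2 * x) by ring.
        generalize (Rabs_triang (t - x) (2 * x)) (Rabs_triang (t - x + 2 * x) (- (t - x))).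
        replace (t - x + 2 * x + - (t - x)) with (2 * x) by ring.
        rewrite Rabs_Ropp, Rabs_mult, (Rabs_pos_eq 2) by lra. lra. }
      assert (Hpos : 0 < Rabs (t - x)) by (apply Rabs_pos_lt; lra).
      assert (Hab : Rabs (t ^ 2 + y0 ^ 2 - 1) = Rabs (t - x) * Rabs (t + x)) by (rewrite Es; apply Rabs_mult).
      assert (Hle1 : Rabs (t ^ 2 + y0 ^ 2 - 1) <= 1).
      { rewrite Hab. apply Rle_trans with (/ (3 * Rabs x) * (3 * Rabs x)).
        - apply Rmult_le_compat; lra.
        - right. field. lra. }
      assert (Ht2 : 0 < t ^ 2 + y0 ^ 2) by (assert (0 < y0 ^ 2) by (simpl; nra); assert (0 <= t ^ 2) by (simpl; nra); lra).
      split.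
      - intros Z. assert (E2 := Hmod t). fold (l t) in E2. rewrite Z in E2.
        assert (Rabs (t ^ 2 + y0 ^ 2 - 1) = 0) by (rewrite <- E2; replace (1 ^ 2 - 1) with 0 by ring; apply Rabs_R0).
        rewrite Hab in H. nra.
      - rewrite Eln, Rabs_mult, (Rabs_pos_eq (/ 2)) by lra.
        assert (B := ln_lower (t ^ 2 + y0 ^ 2)). generalize (Rle_abs (t ^ 2 + y0 ^ 2 - 1)). intros.
        specialize (B ltac:(lra)). rewrite Hab in B. nra. }
    set (K := 2 * K0 * pw (Rabs x / 4) (- k) / (1 - k)).
    assert (HK : 0 < K).
    { apply Rdiv_lt_0_compat; [|lra]. repeat apply Rmult_lt_0_compat; try lra. apply pw_pos. }
    exists r, K. split; auto. split; auto.
    (* The majorant has infinite derivative at [x], so each side of the crossing is treated apart,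
       with [x] at most an end point. *)
    assert (Main : forall s t, x - r < s -> s <= t -> t < x + r -> (t <= x \/ x <= s) ->
      Cmod (f (l t) - f (l s)) <= K * opw (t - x) (1 - k) - K * opw (s - x) (1 - k)).
    { intros s t H1 H2 H3 H4.
      apply (mvt_maj (fun t => f (l t)) (fun t => K * opw (t - x) (1 - k))); auto.
      - intros z Hz. split; auto. apply (continuity_pt_scal (fun t => opw (t - x) (1 - k))). now apply opw_shift_cont.
      - intros z Hz. assert (Hzr : Rabs (z - x) < r) by (apply Rabs_def1; lra).
        assert (Hzx : z <> x) by (destruct H4; lra).
        destruct (Low z Hzr Hzx) as [L1 L2]. destruct (Rd z ltac:(lra) L1) as (v & Hv & Hb).
        exists v, (K * ((1 - k) * pw (Rabs (z - x)) (1 - k - 1))). split; auto. split.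
        + apply (derivable_pt_lim_scal (fun t => opw (t - x) (1 - k))). now apply opw_shift_deriv.
        + eapply Rle_trans; [exact Hb|].
          assert (Hzp : 0 < Rabs (z - x)) by (apply Rabs_pos_lt; lra).
          replace (1 - k - 1) with (- k) by ring.
          replace (K * ((1 - k) * pw (Rabs (z - x)) (- k))) with (2 * K0 * (pw (Rabs x / 4) (- k) * pw (Rabs (z - x)) (- k)))
            by (unfold K; field; lra).
          rewrite <- pw_mult by lra. apply Rmult_le_compat_l; [lra|]. apply pw_anti; [lra|]. split; auto.
          apply Rmult_lt_0_compat; lra. }
    intros s t H1 H2 H3. fold (l t) (l s).
    assert (Sum : Cmod (f (l t) - f (l s)) <= K * (opw (t - x) (1 - k) - opw (s - x) (1 - k))).
    { destruct (Rle_dec t x) as [A|A]; [generalize (Main s t H1 H2 H3 (or_introl A)); lra|].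
      destruct (Rle_dec x s) as [B|B]; [generalize (Main s t H1 H2 H3 (or_intror B)); lra|].
      assert (M1 := Main s x H1 ltac:(lra) ltac:(lra) (or_introl (Rle_refl x))).
      assert (M2 := Main x t ltac:(lra) ltac:(lra) H3 (or_intror (Rle_refl x))).
      generalize (Cmod_tri3 (f (l t)) (f (l x)) (f (l s))). lra. }
    eapply Rle_trans; [exact Sum|]. apply Rmult_le_compat_l; [lra|].
    assert (P1 := Mc c s t H2). assert (P2 := Mc (- c) s t H2).
    destruct Hxc as [-> | ->]; lra.
  (* Away from the circle [f] is Lipschitz along the line, and the linear term of the majorant
     suffices. *)
  - assert (Hln : ln (Cmod (l x)) <> 0).
    { rewrite Eln. intros Z. assert (Z' : ln (x ^ 2 + y0 ^ 2) = 0) by lra.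
      rewrite <- ln_1 in Z'. apply ln_inv in Z'; lra. }
    set (d := Rabs (ln (Cmod (l x)))). assert (Hd : 0 < d) by now apply Rabs_pos_lt.
    assert (Hc : exists r1, 0 < r1 /\ forall t, Rabs (t - x) < r1 -> d / 2 < Rabs (ln (Cmod (l t)))).
    { assert (Cn : limC (nb (l x)) (fun w => RtoC (ln (Cmod w))) (RtoC (ln (Cmod (l x))))).
      { apply (limC_real Cmod _ ln); [apply limC_Cmod, ccont_id|].
        apply derivable_continuous_pt. eexists. apply derivable_pt_lim_ln. apply Hnz. }
      destruct (Cn (d / 2) (half_pos _ Hd)) as (r1 & Hr1 & A). exists r1. split; auto.
      intros t Ht. assert (B := A (l t)). rewrite Hdist in B. specialize (B Ht).
      rewrite <- RtoC_minus, Cmod_R in B. unfold d in *.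
      generalize (Rabs_triang (ln (Cmod (l t))) (ln (Cmod (l x)) - ln (Cmod (l t)))).
      replace (ln (Cmod (l t)) + (ln (Cmod (l x)) - ln (Cmod (l t)))) with (ln (Cmod (l x))) by ring.
      rewrite (Rabs_minus_sym (ln (Cmod (l x)))). lra. }
    destruct Hc as (r1 & Hr1 & Hlow).
    exists (Rmin r0 r1), (2 * K0 * pw (d / 2) (- k)). split; [now apply Rmin_pos|].
    assert (M1 := Rmin_l r0 r1). assert (M2 := Rmin_r r0 r1).
    assert (HK : 0 < 2 * K0 * pw (d / 2) (- k)) by (repeat apply Rmult_lt_0_compat; try lra; apply pw_pos).
    split; auto. intros s t H1 H2 H3. fold (l t) (l s).
    set (K := 2 * K0 * pw (d / 2) (- k)) in *.
    assert (Main : Cmod (f (l t) - f (l s)) <= K * t - K * s).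
    { apply (mvt_maj (fun t => f (l t)) (fun t => K * t)); auto.
      - intros z Hz. split; auto. apply derivable_continuous_pt. eexists. apply derivable_pt_lim_linear.
      - intros z Hz. assert (Hzr : Rabs (z - x) < Rmin r0 r1) by (apply Rabs_def1; lra).
        assert (Lo := Hlow z ltac:(lra)).
        destruct (Rd z) as (v & Hv & Hb); [lra| |].
        { intros Z. rewrite Z, ln_1, Rabs_R0 in Lo. lra. }
        exists v, K. split; auto. split; [apply derivable_pt_lim_linear|].
        eapply Rle_trans; [exact Hb|]. unfold K. apply Rmult_le_compat_l; [lra|]. apply pw_anti; lra. }
    eapply Rle_trans; [exact Main|]. replace (K * t - K * s) with (K * (t - s)) by ring.
    apply Rmult_le_compat_l; [lra|]. assert (P1 := Mc c s t H2). assert (P2 := Mc (- c) s t H2). lra.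
Qed.

Lemma line_abs_cont k f (p e : C) y0 x1 x2 (u : R -> C) : 0 <= k < 1 -> local_qc k f -> Cmod e = 1 -> y0 <> 0 -> y0 ^ 2 <> 1 ->
  (forall t, Cmod (p + RtoC t * e) ^ 2 = t ^ 2 + y0 ^ 2) ->
  (forall t, u t = f (p + RtoC t * e)%C) -> x1 <= x2 -> Defs.abs_cont u x1 x2.
Proof.
  intros Hk Hf He Hy Hy1 Hmod Hu H12.
  set (c := sqrt (1 - y0 ^ 2)).
  set (m := fun t => t + (opw (t - c) (1 - k) + opw (t - - c) (1 - k))).
  destruct (majorant_global u m x1 x2 H12) as (K & HK & A).
  - intros x y Hxy. unfold m.
    assert (M1 := opw_mono (x - c) (y - c) (1 - k) ltac:(lra) ltac:(lra)).
    assert (M2 := opw_mono (x - - c) (y - - c) (1 - k) ltac:(lra) ltac:(lra)). lra.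
  - intros x _. destruct (line_majorant k f p e y0 x Hk Hf He Hy Hy1 Hmod) as (r & K & Hr & HK & B).
    exists r, K. split; auto. split; auto. intros s t H1 H2 H3. rewrite !Hu. now apply B.
  - apply (abs_cont_majorant u m K); auto. unfold m.
    apply ac_incr_plus; [apply ac_incr_id|]. apply ac_incr_plus; apply ac_incr_opw; lra.
Qed.

(** * Null sets *)

Lemma null2_subset (A B : C -> Prop) : (forall p, A p -> B p) -> Defs.null2 B -> Defs.null2 A.
Proof.
  intros H HB e He. destruct (HB e He) as (Q & H1 & H2 & H3). exists Q. repeat split; auto; apply H1.
Qed.

Definition area (r : (R * R) * (R * R)) : R :=
  (snd (fst r) - fst (fst r)) * (snd (snd r) - fst (snd r)).

Lemma sum_interleave (f g : nat -> R) M :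
  sum_f_R0 (fun n => if Nat.even n then f (Nat.div2 n) else g (Nat.div2 n)) (2 * M + 1)
  = sum_f_R0 f M + sum_f_R0 g M.
Proof.
  induction M as [|M IH]; [simpl; ring|].
  replace (2 * S M + 1)%nat with (S (S (2 * M + 1))) by lia.
  rewrite !tech5, IH.
  assert (E1 : Nat.even (S (2 * M + 1)) = true) by (apply Nat.even_spec; exists (S M); lia).
  assert (E2 : Nat.even (S (S (2 * M + 1))) = false).
  { rewrite <- Nat.negb_odd. replace (Nat.odd (S (S (2 * M + 1)))) with true; auto.
    symmetry. apply Nat.odd_spec. exists (S M). lia. }
  assert (D1 : Nat.div2 (S (2 * M + 1)) = S M).
  { replace (S (2 * M + 1)) with (2 * S M)%nat by lia. apply Nat.div2_double. }
  assert (D2 : Nat.div2 (S (S (2 * M + 1))) = S M).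
  { replace (S (S (2 * M + 1))) with (S (2 * S M))%nat by lia. apply Nat.div2_succ_double. }
  rewrite E1, E2, D1, D2. simpl. ring.
Qed.

Lemma sum_nonneg_mono (f : nat -> R) n m : (forall i, 0 <= f i) -> (n <= m)%nat -> sum_f_R0 f n <= sum_f_R0 f m.
Proof.
  intros Hf H. induction H as [|m H IH]; [lra|]. rewrite tech5. generalize (Hf (S m)). lra.
Qed.

Lemma null2_union (A B : C -> Prop) : Defs.null2 A -> Defs.null2 B -> Defs.null2 (fun p => A p \/ B p).
Proof.
  intros HA HB e He.
  destruct (HA _ (half_pos _ He)) as (Q & Q1 & Q2 & Q3).
  destruct (HB _ (half_pos _ He)) as (P & P1 & P2 & P3).
  set (S := fun n => if Nat.even n then Q (Nat.div2 n) else P (Nat.div2 n)).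
  assert (S1 : forall n, fst (fst (S n)) <= snd (fst (S n)) /\ fst (snd (S n)) <= snd (snd (S n))).
  { intros n. unfold S. destruct (Nat.even n); auto. }
  exists S. split; [exact S1|]. split.
  - intros p [Hp|Hp].
    + destruct (Q2 p Hp) as (n & Hn). exists (2 * n)%nat. unfold S.
      rewrite Nat.even_mul, Nat.div2_double. exact Hn.
    + destruct (P2 p Hp) as (n & Hn). exists (Datatypes.S (2 * n)). unfold S.
      rewrite Nat.even_succ, <- Nat.negb_even, Nat.even_mul, Nat.div2_succ_double. exact Hn.
  - intros N. change (sum_f_R0 (fun n => area (S n)) N < e).
    eapply Rle_lt_trans; [apply (sum_nonneg_mono _ N (2 * N + 1))|].
    + intros i. apply Rmult_le_pos; destruct (S1 i); lra.
    + lia.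
    + rewrite (sum_eq _ (fun n => if Nat.even n then area (Q (Nat.div2 n)) else area (P (Nat.div2 n))))
        by (intros i _; unfold S; destruct (Nat.even i); auto).
      rewrite (sum_interleave (fun n => area (Q n)) (fun n => area (P n))).
      specialize (Q3 N). specialize (P3 N). unfold area. lra.
Qed.

Lemma null2_reflect (A : C -> Prop) : Defs.null2 A -> Defs.null2 (fun p => A (fst p, - snd p)).
Proof.
  intros HA e He. destruct (HA e He) as (Q & Q1 & Q2 & Q3).
  exists (fun n => (fst (Q n), (- snd (snd (Q n)), - fst (snd (Q n))))). split; [|split].
  - intros n. destruct (Q1 n). simpl. lra.
  - intros p Hp. destruct (Q2 _ Hp) as (n & Hn). exists n. simpl in *. lra.
  - intros N. eapply Rle_lt_trans; [|apply (Q3 N)]. right. apply sum_eq. intros i _. simpl. ring.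
Qed.

(** The rectangles spanned by N equal steps have width 1/N and heights that telescope, so the total
    area is at most (g (A + 1) - g A) / N. *)
Lemma null2_graph A (g : R -> R) : (forall x y, A <= x -> x <= y -> y <= A + 1 -> g x <= g y) ->
  Defs.null2 (fun p => A <= fst p <= A + 1 /\ snd p = g (fst p)).
Proof.
  intros Hg e He. set (V := g (A + 1) - g A).
  assert (HV : 0 <= V) by (unfold V; generalize (Hg A (A + 1)); lra).
  destruct (INR_unbounded ((V + 1) / e)) as (N0 & HN0). set (N := S N0).
  assert (HN : (V + 1) / e < INR N) by (unfold N; rewrite S_INR; lra).
  assert (HNp : 0 < INR N) by (eapply Rlt_trans; [|exact HN]; apply Rdiv_lt_0_compat; lra).
  (* Truncating at N makes all later rectangles degenerate, as an infinite sequence of them is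
     required. *)
  clearbody N. set (t := fun i : nat => A + INR (min i N) / INR N).
  assert (t0 : t O = A) by (unfold t; simpl; field; lra).
  assert (tN : forall i, (N <= i)%nat -> t i = A + 1).
  { intros i Hi. unfold t. rewrite Nat.min_r by auto. field. lra. }
  assert (tm : forall i, t i <= t (S i) /\ t (S i) - t i <= / INR N).
  { intros i. unfold t. destruct (Nat.le_gt_cases N i) as [H|H].
    - rewrite !Nat.min_r by lia. assert (0 < / INR N) by now apply Rinv_0_lt_compat. lra.
    - rewrite !Nat.min_l, S_INR by lia.
      assert (0 < / INR N) by now apply Rinv_0_lt_compat.
      replace ((INR i + 1) / INR N) with (INR i / INR N + / INR N) by (field; lra). lra. }
  assert (tr : forall i, A <= t i <= A + 1).
  { intros i. unfold t. assert (0 <= INR (min i N) / INR N <= 1); [|lra].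
    assert (INR (min i N) <= INR N) by (apply le_INR; lia).
    split; [apply Rmult_le_pos; [apply pos_INR|left; now apply Rinv_0_lt_compat]|].
    apply Rmult_le_reg_r with (INR N); auto. unfold Rdiv. rewrite Rmult_assoc, Rinv_l; lra. }
  assert (gm : forall i, g (t i) <= g (t (S i))).
  { intros i. destruct (tm i). apply Hg; auto; apply tr. }
  exists (fun i => ((t i, t (S i)), (g (t i), g (t (S i))))). split; [|split].
  - intros i. simpl. split; [apply tm|apply gm].
  - intros [x y] [Hx Hy]. simpl in *. subst y.
    assert (F : forall n, x <= t n -> exists i, t i <= x <= t (S i)).
    { induction n as [|n IH]; intros H.
      - exists O. rewrite t0 in *. split; [lra|]. generalize (tm O). rewrite t0. lra.
      - destruct (Rle_dec x (t n)); auto. exists n. lra. }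
    destruct (F N) as (i & Hi); [rewrite tN; auto; lra|].
    exists i. split; auto. split; apply Hg; try apply tr; try lra.
  - intros M. simpl.
    assert (B : forall M, sum_f_R0 (fun n => (t (S n) - t n) * (g (t (S n)) - g (t n))) M <= / INR N * (g (t (S M)) - g A)).
    { induction M0 as [|m IH].
      - simpl sum_f_R0. destruct (tm O). assert (G := gm O). rewrite t0 in *.
        apply Rmult_le_compat_r; lra.
      - rewrite tech5. destruct (tm (S m)). assert (G := gm (S m)).
        assert ((t (S (S m)) - t (S m)) * (g (t (S (S m))) - g (t (S m))) <= / INR N * (g (t (S (S m))) - g (t (S m))))
          by (apply Rmult_le_compat_r; lra). lra. }
    eapply Rle_lt_trans; [apply B|].
    assert (Hgt : g (t (S M)) - g A <= V) by (unfold V; generalize (Hg (t (S M)) (A + 1)) (tr (S M)); lra).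
    assert (0 < / INR N) by now apply Rinv_0_lt_compat.
    apply Rle_lt_trans with (/ INR N * V); [apply Rmult_le_compat_l; lra|].
    apply Rmult_lt_reg_l with (INR N); auto. rewrite <- Rmult_assoc, Rinv_r, Rmult_1_l by lra.
    apply Rmult_lt_compat_r with (r := e) in HN; auto.
    replace ((V + 1) / e * e) with (V + 1) in HN by (field; lra). lra.
Qed.

Lemma null2_point (p0 : C) : Defs.null2 (fun p => p = p0).
Proof.
  intros e He. exists (fun _ => ((fst p0, fst p0), (snd p0, snd p0))). split; [|split].
  - intros _. simpl. lra.
  - intros p ->. exists O. simpl. lra.
  - intros N. rewrite (sum_eq _ (fun _ => 0)) by (intros; simpl; ring).
    rewrite sum_cte. lra.
Qed.

(** The upper left and lower right quarter arcs are increasing graphs over intervals of length 1;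
    reflection gives the other two. The origin is added because [local_qc] is silent there. *)
Lemma null2_circle : Defs.null2 (fun p : C => Cmod p = 1 \/ p = 0).
Proof.
  apply (null2_union (fun p => Cmod p = 1) (fun p => p = 0)); [|apply null2_point].
  assert (H1 : Defs.null2 (fun p => -1 <= fst p <= -1 + 1 /\ snd p = sqrt (1 - fst p ^ 2))).
  { apply (null2_graph (-1) (fun x => sqrt (1 - x ^ 2))). intros x y Hx Hxy Hy. apply sqrt_le_1_alt. simpl. nra. }
  assert (H2 : Defs.null2 (fun p => 0 <= fst p <= 0 + 1 /\ snd p = - sqrt (1 - fst p ^ 2))).
  { apply (null2_graph 0 (fun x => - sqrt (1 - x ^ 2))). intros x y Hx Hxy Hy. apply Ropp_le_contravar, sqrt_le_1_alt. simpl. nra. }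
  apply (null2_subset _ _ ltac:(intros p Hp; exact Hp)).
  eapply null2_subset; [|exact (null2_union _ _ (null2_union _ _ H1 H2) (null2_union _ _ (null2_reflect _ H1) (null2_reflect _ H2)))].
  intros [x y] Hp. simpl.
  assert (E : x ^ 2 + y ^ 2 = 1) by (generalize (Cmod_sq (x, y)); rewrite Hp; simpl; lra).
  assert (Hy2 : 1 - x ^ 2 = Rsqr y) by (unfold Rsqr; lra).
  assert (Hx : -1 <= x <= 1) by (simpl in E; nra).
  replace (1 - x * (x * 1)) with (Rsqr y) by (unfold Rsqr in *; simpl in *; lra).
  rewrite sqrt_Rsqr_abs.
  destruct (Rle_dec 0 y) as [Hy|Hy]; [rewrite Rabs_pos_eq by auto|rewrite Rabs_left by lra];
    destruct (Rle_dec 0 x); [right; right|left; left|left; right|right; left]; split; lra.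
Qed.

Lemma null1_lines (P : R -> Prop) : (forall y, P y -> y = 0 \/ y ^ 2 = 1) -> Defs.null1 P.
Proof.
  intros H e He.
  exists (fun n => match n with O => (0, 0) | 1%nat => (1, 1) | _ => (-1, -1) end). split; [|split].
  - intros [|[|n]]; simpl; lra.
  - intros y Hy. destruct (H y Hy) as [->|E].
    + exists O. simpl. lra.
    + assert (y = 1 \/ y = -1) as [->| ->].
      { assert ((y - 1) * (y + 1) = 0) by (simpl in E; lra). apply Rmult_integral in H0. lra. }
      * exists 1%nat. simpl. lra.
      * exists 2%nat. simpl. lra.
  - intros N. rewrite (sum_eq _ (fun _ => 0)) by (intros [|[|i]] _; simpl; ring).
    rewrite sum_cte. lra.
Qed.

(** * Planar quasiconformality *)

Lemma limit_quotient_zero (f : C -> C) (p e : C) al be (g : R -> C) :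
  wd f p al be -> (forall h, g h = f (p + RtoC h * e)%C) ->
  forall eps, 0 < eps -> exists delta, 0 < delta /\ forall h, 0 < Rabs h < delta ->
    Cmod (RtoC (/ h) * (g h - f p) - (al * e + be * Cconj e)) < eps.
Proof.
  intros Hw Hg eps He.
  assert (R : rd (fun t => f (p + RtoC t * e)%C) 0 (al * e + be * Cconj e)%C).
  { apply rd_of_wd. now replace (p + RtoC 0 * e)%C with p by ring. }
  destruct (R _ (half_pos _ He)) as (d & Hd & A). exists d. split; auto. intros h [Hh1 Hh2].
  specialize (A h Hh2). simpl in A. rewrite Rplus_0_l, <- Hg in A.
  replace (p + RtoC 0 * e)%C with p in A by ring.
  assert (Hn : RtoC h <> 0). { intros Z. apply RtoC_inj in Z. subst. rewrite Rabs_R0 in Hh1. lra. }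
  assert (Hn' : h <> 0) by (intros Z; subst; rewrite Rabs_R0 in Hh1; lra).
  replace (RtoC (/ h) * (g h - f p) - (al * e + be * Cconj e))%C
    with ((g h - f p - (al * e + be * Cconj e) * RtoC h) / RtoC h)%C by (rewrite RtoC_inv by auto; field; auto).
  rewrite Cmod_div, Cmod_R by auto.
  apply Rmult_lt_reg_r with (Rabs h); auto. unfold Rdiv. rewrite Rmult_assoc, Rinv_l, Rmult_1_r by lra. nra.
Qed.

Lemma Cscale_eq (r : R) (z : C) : Defs.Cscale r z = (RtoC r * z)%C.
Proof. destruct z. unfold Defs.Cscale. apply C_ext; simpl; ring. Qed.

Lemma dilat_ok_of_wd k l f (p : C) al be : k <= l -> wd f p al be -> Cmod be <= k * Cmod al -> Defs.dilat_ok l f p.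
Proof.
  intros Hkl Hw Hb. exists (al * 1 + be * Cconj 1)%C, (al * Ci + be * Cconj Ci)%C. split; [|split].
  - intros eps He.
    destruct (limit_quotient_zero f p 1 al be (fun h => f ((fst p + h, snd p) : C)) Hw) with (eps := eps) as (d & Hd & A); auto.
    { intros h. f_equal. destruct p. apply C_ext; simpl; ring. }
    exists d. split; auto. intros h Hh. specialize (A h Hh). rewrite Cscale_eq. exact A.
  - intros eps He.
    destruct (limit_quotient_zero f p Ci al be (fun h => f ((fst p, snd p + h) : C)) Hw) with (eps := eps) as (d & Hd & A); auto.
    { intros h. f_equal. destruct p. apply C_ext; simpl; ring. }
    exists d. split; auto. intros h Hh. specialize (A h Hh). rewrite Cscale_eq. exact A.
  - assert (E1 : Defs.dzbar (al * 1 + be * Cconj 1)%C (al * Ci + be * Cconj Ci)%C = be).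
    { unfold Defs.dzbar. rewrite Cscale_eq. destruct al, be; apply C_ext; simpl; field. }
    assert (E2 : Defs.dz (al * 1 + be * Cconj 1)%C (al * Ci + be * Cconj Ci)%C = al).
    { unfold Defs.dz. rewrite Cscale_eq. destruct al, be; apply C_ext; simpl; field. }
    rewrite E1, E2. change (Cmod be <= l * Cmod al).
    eapply Rle_trans; [exact Hb|]. apply Rmult_le_compat_r; auto using Cmod_ge_0.
Qed.

(** The exceptional lines are those through the origin and those tangent to the unit circle; the
    exceptional points are the circle and the origin. *)
Lemma planar_qc_of_local k l f G : 0 <= k < 1 -> k <= l -> local_qc k f -> Defs.planar_qc l G f.
Proof.
  intros Hk Hkl Hf. split.
  - intros x1 x2 y1 y2 Hx Hy _. split; apply null1_lines; intros y [_ N].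
    + apply NNPP. intros M. apply not_or_and in M. destruct M as [M1 M2]. apply N.
      apply (line_abs_cont k f (0, y) 1 y); auto using Cmod_1; try lra.
      * intros t. rewrite Cmod_sq. simpl. ring.
      * intros t. f_equal. apply C_ext; simpl; ring.
    + apply NNPP. intros M. apply not_or_and in M. destruct M as [M1 M2]. apply N.
      apply (line_abs_cont k f (y, 0) Ci y); auto using Cmod_Ci; try lra.
      * intros t. rewrite Cmod_sq. simpl. ring.
      * intros t. f_equal. apply C_ext; simpl; ring.
  - eapply null2_subset; [|exact null2_circle]. intros p [_ N].
    apply NNPP. intros M. apply not_or_and in M. destruct M as [M1 M2]. apply N.
    destruct (lq_deriv k f Hf p M2) as (r & K & Hr & HK & D).
    destruct (D p) as (al & be & Hw & Hb & _); auto.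
    { replace (p - p)%C with (RtoC 0) by ring. now rewrite Cmod_0. }
    eapply dilat_ok_of_wd; eauto.
Qed.

Lemma local_log (w0 : C) Z0 : cexp Z0 = w0 -> exists zeta : C -> C, zeta w0 = Z0 /\
  nb w0 (fun w => w <> 0 /\ cexp (zeta w) = w /\ wd zeta w (/ w)%C 0).
Proof.
  intros H0. assert (Hw0 : w0 <> 0) by (rewrite <- H0; apply cexp_nz).
  exists (fun w => Z0 + Clog (w / w0))%C.
  assert (E1 : (w0 / w0)%C = 1%C) by (field; auto).
  split.
  - rewrite E1, Clog_1. ring.
  - assert (Cq : ccont (fun w => w / w0)%C w0).
    { apply (limC_div (fun w => w)); [apply ccont_id|apply limC_const|auto]. }
    assert (S : nb w0 (fun w => slit (w / w0))).
    { unfold ccont in Cq. rewrite E1 in Cq. destruct (nb_slit 1 slit_1) as (d & Hd & A).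
      generalize (Cq d Hd). apply filter_imp. intros w Hw. now apply A. }
    generalize S. apply filter_imp. intros w Hw.
    assert (Hwn : w <> 0).
    { intros Z. subst w. apply (slit_nz _ Hw). field. auto. }
    split; auto. split.
    + rewrite cexp_plus, H0, Clog_exp by auto. field. auto.
    + assert (D1 : wd (fun w => w / w0)%C w (/ w0 * 1)%C (/ w0 * 0)%C).
      { eapply wd_ext; [|exact (wd_scal (/ w0)%C (fun z => z) w _ _ (wd_id w))].
        apply filter_forall. intros z. unfold Cdiv. ring. }
      eapply wd_eq; [| |apply (wd_plus _ _ _ _ _ _ _ (wd_const Z0 w) (wd_Clogf _ _ _ _ D1 Hw))].
      * field. auto.
      * field. auto.
Qed.

(** Near w0 the map [f] is [T] between a local logarithm and the exponential. Both are conformal, so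
    the ratio of the two derivatives keeps its modulus, and their sizes change by the locally
    bounded factor |f(w)| / |w|. *)
Lemma local_qc_of_plane k T f : plane_map k T -> (forall Z, f (cexp Z) = cexp (T Z)) -> local_qc k f.
Proof.
  intros HT Hf.
  assert (Cont : forall w : C, w <> 0 -> ccont f w).
  { intros w Hw. destruct (cexp_surj w Hw) as (Z0 & HZ0).
    destruct (local_log w Z0 HZ0) as (zeta & Hz & HN).
    apply (ccont_ext (fun w => cexp (T (zeta w)))).
    - generalize HN. apply filter_imp. intros z (_ & H & _). rewrite <- Hf. now rewrite H.
    - apply (limC_comp (fun w => T (zeta w)) cexp); [|eapply wd_ccont; apply wd_cexp].
      apply (limC_comp zeta T); [|apply (pm_cont k T HT)].
      destruct (nb_self _ _ HN) as (_ & _ & D). eapply wd_ccont. exact D. }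
  split; auto. intros w0 Hw0. destruct (cexp_surj w0 Hw0) as (Z0 & HZ0).
  destruct (local_log w0 Z0 HZ0) as (zeta & Hz & HN).
  destruct (pm_qc k T HT Z0) as (r & K & Hr & HK & D).
  assert (Hzc : ccont zeta w0).
  { destruct (nb_self _ _ HN) as (_ & _ & D0). eapply wd_ccont. exact D0. }
  assert (Hw0p : 0 < Cmod w0) by now apply Cmod_pos.
  assert (Near : nb w0 (fun w => Cmod (zeta w - Z0) < r)).
  { generalize (Hzc r Hr). now rewrite Hz. }
  destruct (filter_and _ _ (nb_open _ _ HN) (filter_and _ _ HN (filter_and _ _ Near (filter_and _ _
    (limC_bounded _ _ (Cont w0 Hw0)) (limC_away _ _ (ccont_id w0) Hw0)))))
    as (d & Hd & A).
  set (B := (Cmod (f w0) + 1) / (Cmod w0 / 2)).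
  assert (HB : 0 < B) by (apply Rdiv_lt_0_compat; generalize (Cmod_ge_0 (f w0)); lra).
  exists d, (B * K). split; auto. split; [now apply Rmult_lt_0_compat|].
  intros w Hw Hw1. destruct (A w Hw) as (Ho & (Hwn & Hcw & Dz) & Hzr & Hfb & Hwb).
  assert (Hln : ln (Cmod w) = Re (zeta w)).
  { rewrite <- Hcw at 1. now rewrite Cmod_cexp, ln_exp. }
  assert (Hre : Re (zeta w) <> 0).
  { intros Z. apply Hw1. rewrite <- Hcw, Cmod_cexp, Z. apply exp_0. }
  destruct (D (zeta w) Hzr Hre) as (al & be & Hwd & Hbe & Hal).
  assert (Hfw : f w = cexp (T (zeta w))) by (rewrite <- Hf; now rewrite Hcw).
  exists (f w * (al / w))%C, (f w * (be * Cconj (/ w)))%C.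
  assert (HC : Cmod (/ w) = / Cmod w) by now apply Cmod_inv.
  assert (Hwp : 0 < Cmod w) by now apply Cmod_pos.
  split; [|split].
  - eapply wd_ext; [|eapply wd_eq; [| |apply (wd_cexpf _ _ _ _ (wd_comp zeta T w _ _ _ _ Dz Hwd))]].
    + generalize Ho. apply filter_imp. intros z (_ & H & _). rewrite <- Hf. now rewrite H.
    + cbv beta. rewrite <- Hfw. replace (Cconj 0) with (RtoC 0) by (apply C_ext; simpl; ring). unfold Cdiv. ring.
    + cbv beta. rewrite <- Hfw. ring.
  - unfold Cdiv. rewrite !Cmod_mult, Cmod_conj, !HC.
    assert (0 <= Cmod (f w) * / Cmod w).
    { apply Rmult_le_pos; [apply Cmod_ge_0|]. left. now apply Rinv_0_lt_compat. }
    nra.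
  - rewrite Hln, Cmod_mult, Cmod_div by auto. rewrite Rmult_assoc.
    assert (Cmod (f w) / Cmod w <= B).
    { unfold B. apply Rmult_le_compat; auto using Cmod_ge_0.
      - left. now apply Rinv_0_lt_compat.
      - lra.
      - apply Rinv_le_contravar; lra. }
    replace (Cmod (f w) * (Cmod al / Cmod w)) with (Cmod (f w) / Cmod w * Cmod al) by (field; lra).
    apply Rmult_le_compat; auto using Cmod_ge_0.
    apply Rmult_le_pos; [apply Cmod_ge_0|]. left. now apply Rinv_0_lt_compat.
Qed.

(** The chart 1/z in logarithmic coordinates; the flags are those of [chart] and [chart_inv]. *)
Definition flip (i : bool) (Z : C) : C := if i then (- Z)%C else Z.

Lemma plane_map_flip k T i j : plane_map k T -> plane_map k (fun Z => flip j (T (flip i Z))).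
Proof.
  intros HT.
  assert (Fc : forall i Z, ccont (flip i) Z).
  { intros [|] Z; [apply limC_opp|]; apply ccont_id. }
  assert (Fw : forall i f p al be, wd f p al be -> wd (fun z => flip i (f z)) p (flip i al) (flip i be)).
  { intros [|] f p al be H; simpl; auto. now apply wd_opp. }
  assert (Fm : forall i z, Cmod (flip i z) = Cmod z) by (intros [|] z; simpl; auto using Cmod_opp).
  assert (Ff : forall i z, flip i (flip i z) = z) by (intros [|] z; simpl; auto; ring).
  split.
  - intros Z. apply (limC_comp (fun Z => T (flip i Z)) (flip j)); [|apply Fc].
    apply (limC_comp (flip i) T); [apply Fc|apply (pm_cont k T HT)].
  - intros Z0. destruct (pm_qc k T HT (flip i Z0)) as (r & K & Hr & HK & D).
    exists r, K. split; auto. split; auto. intros Z HZ HZ0.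
    assert (Hd : Cmod (flip i Z - flip i Z0) < r).
    { replace (flip i Z - flip i Z0)%C with (flip i (Z - Z0)) by (destruct i; simpl; ring). now rewrite Fm. }
    assert (Hre : Rabs (Re (flip i Z)) = Rabs (Re Z)) by (destruct i; simpl; auto; apply Rabs_Ropp).
    assert (Hr0 : Re (flip i Z) <> 0) by (destruct i; auto; intros X; apply HZ0; change (- Re Z = 0) in X; lra).
    destruct (D _ Hd Hr0) as (al & be & Hw & Hb & Ha). rewrite Hre in Ha.
    exists (flip j (flip i al)), (flip j (flip i be)). rewrite !Fm. split; auto.
    apply Fw. destruct i; simpl in *; auto.
    eapply wd_eq; [| |apply (wd_comp (fun z => - z)%C T Z _ _ _ _ (wd_opp _ _ _ _ (wd_id Z)) Hw)].
    + replace (Cconj (- 0)) with (RtoC 0) by (apply C_ext; simpl; ring). ring.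
    + replace (Cconj (- (1))) with (- (1))%C by (apply C_ext; simpl; ring). ring.
Qed.

(** * The Riemann sphere *)

Definition hgt (z : C) : R := sqrt (1 + Cmod z ^ 2).

Lemma hgt_bounds z : 1 <= hgt z /\ Cmod z <= hgt z <= 1 + Cmod z.
Proof.
  generalize (Cmod_ge_0 z). intros H. unfold hgt. split; [|split].
  - rewrite <- sqrt_1 at 1. apply sqrt_le_1_alt. nra.
  - rewrite <- (sqrt_pow2 (Cmod z)) at 1 by auto. apply sqrt_le_1_alt. lra.
  - rewrite <- (sqrt_pow2 (1 + Cmod z)) by lra. apply sqrt_le_1_alt. nra.
Qed.

Lemma hgt_lip z w : hgt w <= hgt z + Cmod (w - z).
Proof.
  destruct (hgt_bounds z) as (H1 & H2 & H3). generalize (Cmod_ge_0 (w - z)) (Cmod_ge_0 w) (Cmod_ge_0 z). intros.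
  unfold hgt at 1. rewrite <- (sqrt_pow2 (hgt z + Cmod (w - z))) by lra. apply sqrt_le_1_alt.
  assert (E : hgt z ^ 2 = 1 + Cmod z ^ 2) by (unfold hgt; apply pow2_sqrt; nra).
  assert (T : Cmod w <= Cmod z + Cmod (w - z)) by (generalize (Cmod_rev w z); lra).
  assert (Cmod w ^ 2 <= (Cmod z + Cmod (w - z)) ^ 2) by (apply pow_incr; lra).
  nra.
Qed.

Lemma chordal_finite (z w : C) : Defs.chordal (Some z) (Some w) = 2 * Cmod (z - w) / (hgt z * hgt w).
Proof.
  change (Defs.chordal (Some z) (Some w)) with (2 * Cmod (z - w) / sqrt ((1 + Cmod z ^ 2) * (1 + Cmod w ^ 2))).
  unfold hgt. rewrite sqrt_mult; auto; generalize (pow2_ge_0 (Cmod z)) (pow2_ge_0 (Cmod w)); lra.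
Qed.

Lemma chordal_infty (z : C) : Defs.chordal None (Some z) = 2 / hgt z.
Proof. reflexivity. Qed.

Lemma chordal_finite_le z w : Defs.chordal (Some z) (Some w) <= 2 * Cmod (w - z).
Proof.
  rewrite chordal_finite, Cmod_sub_sym. destruct (hgt_bounds z) as (H1 & _). destruct (hgt_bounds w) as (H2 & _).
  generalize (Cmod_ge_0 (w - z)). intros.
  apply Rmult_le_reg_r with (hgt z * hgt w); [nra|].
  unfold Rdiv. rewrite Rmult_assoc, Rinv_l, Rmult_1_r by nra.
  assert (1 <= hgt z * hgt w) by nra. nra.
Qed.

Lemma chordal_near_finite z eps : 0 < eps -> exists d, 0 < d /\ forall q, Defs.chordal (Some z) q < d ->
  exists w : C, q = Some w /\ Cmod (w - z) < eps.
Proof.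
  intros He. destruct (hgt_bounds z) as (H1 & _). set (A := hgt z) in *.
  (* The first bound excludes infinity, at chordal distance 2/A. For a finite point at distance d it
     also absorbs the d in hgt w <= A + d, leaving d < eps by the second. *)
  exists (Rmin (/ A) (eps / A ^ 2)).
  assert (HA2 : 0 < A ^ 2) by nra.
  assert (M1 := Rmin_l (/ A) (eps / A ^ 2)). assert (M2 := Rmin_r (/ A) (eps / A ^ 2)).
  split. { apply Rmin_pos; [apply Rinv_0_lt_compat; lra|now apply Rdiv_lt_0_compat]. }
  intros [w|] Hq.
  - exists w. split; auto. rewrite chordal_finite, Cmod_sub_sym in Hq. fold A in Hq.
    set (d := Cmod (w - z)) in *. assert (Hd : 0 <= d) by apply Cmod_ge_0.
    assert (HB := hgt_lip z w). fold A d in HB. destruct (hgt_bounds w) as (HB1 & _).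
    set (B := hgt w) in *. set (del := Rmin (/ A) (eps / A ^ 2)) in *.
    assert (Hx : 2 * d < del * (A * B)).
    { apply Rmult_lt_compat_r with (r := A * B) in Hq; [|nra].
      unfold Rdiv in Hq. rewrite Rmult_assoc, Rinv_l, Rmult_1_r in Hq by nra. exact Hq. }
    assert (D1 : del * A <= 1).
    { apply Rmult_le_compat_r with (r := A) in M1; [|lra]. rewrite Rinv_l in M1 by lra. exact M1. }
    assert (D2 : del * A ^ 2 <= eps).
    { apply Rmult_le_compat_r with (r := A ^ 2) in M2; [|lra].
      replace (eps / A ^ 2 * A ^ 2) with eps in M2 by (field; lra). exact M2. }
    assert (Hdel : 0 < del) by (apply Rmin_pos; [apply Rinv_0_lt_compat; lra|now apply Rdiv_lt_0_compat]).
    assert (del * A * B <= del * A * (A + d)) by (apply Rmult_le_compat_l; nra).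
    nra.
  - exfalso. change (Defs.chordal (Some z) None) with (2 / A) in Hq.
    assert (0 < / A) by (apply Rinv_0_lt_compat; lra). unfold Rdiv in Hq. lra.
Qed.

Lemma chordal_near_infty M : exists d, 0 < d /\ forall q, Defs.chordal None q < d ->
  forall w : C, q = Some w -> M < Cmod w.
Proof.
  exists (2 / (Rabs M + 1)). generalize (Rabs_pos M) (Rle_abs M). intros. split; [apply Rdiv_lt_0_compat; lra|].
  intros q Hq w ->. rewrite chordal_infty in Hq. destruct (hgt_bounds w) as (H1 & _ & H3).
  assert (Hi : / hgt w < / (Rabs M + 1)) by (unfold Rdiv in Hq; lra).
  assert (Rabs M + 1 < hgt w); [|lra].
  apply Rnot_le_lt. intros L. apply Rinv_le_contravar in L; lra.
Qed.

Lemma chordal_infty_small eps : 0 < eps -> exists M, forall w : C, M < Cmod w -> Defs.chordal None (Some w) < eps.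
Proof.
  intros He. exists (2 / eps). intros w Hw. rewrite chordal_infty. destruct (hgt_bounds w) as (H1 & H2 & _).
  apply Rmult_lt_reg_r with (hgt w); [lra|]. unfold Rdiv. rewrite Rmult_assoc, Rinv_l, Rmult_1_r by lra.
  assert (2 < eps * Cmod w).
  { apply Rmult_lt_compat_l with (r := eps) in Hw; auto. replace (eps * (2 / eps)) with 2 in Hw by (field; lra). exact Hw. }
  nra.
Qed.

(** The sphere is Hausdorff, in a form that uses only neighbourhoods and not the triangle inequality
    for [chordal]. *)
Lemma chordal_separated p p' : (forall e, 0 < e -> exists q, Defs.chordal p q < e /\ Defs.chordal p' q < e) -> p = p'.
Proof.
  assert (Mixed : forall z : C, (forall e, 0 < e -> exists q, Defs.chordal (Some z) q < e /\ Defs.chordal None q < e) -> False).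
  { intros z H. destruct (chordal_near_finite z 1 Rlt_0_1) as (d & Hd & A).
    destruct (chordal_near_infty (Cmod z + 1)) as (d' & Hd' & A').
    destruct (H (Rmin d d')) as (q & H1 & H2); [now apply Rmin_pos|].
    assert (M1 := Rmin_l d d'). assert (M2 := Rmin_r d d').
    destruct (A q (Rlt_le_trans _ _ _ H1 M1)) as (w & -> & Hw).
    assert (B := A' (Some w) (Rlt_le_trans _ _ _ H2 M2) w eq_refl).
    generalize (Cmod_rev w z). lra. }
  intros H. destruct p as [z|], p' as [z'|]; auto.
  - f_equal. apply Cmod_eps. intros e He.
    destruct (chordal_near_finite z (e / 2) (half_pos _ He)) as (d & Hd & A).
    destruct (chordal_near_finite z' (e / 2) (half_pos _ He)) as (d' & Hd' & A').
    destruct (H (Rmin d d')) as (q & H1 & H2); [now apply Rmin_pos|].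
    assert (M1 := Rmin_l d d'). assert (M2 := Rmin_r d d').
    destruct (A q (Rlt_le_trans _ _ _ H1 M1)) as (w & E & Hw).
    destruct (A' q (Rlt_le_trans _ _ _ H2 M2)) as (w' & E' & Hw').
    rewrite E in E'. injection E' as <-. generalize (Cmod_tri3 z w z'). rewrite (Cmod_sub_sym z w). lra.
  - exfalso. now apply (Mixed z).
  - exfalso. apply (Mixed z'). intros e He. destruct (H e He) as (q & H1 & H2). eauto.
Qed.

(** Compactness: either the sequence is finite and bounded from some index on, or infinity is a
    cluster point. *)
Lemma sphere_cluster (x : nat -> Defs.sphere) : exists p, forall e N, 0 < e ->
  exists n, (N <= n)%nat /\ Defs.chordal p (x n) < e.
Proof.
  destruct (classic (exists M N, forall n, (N <= n)%nat -> exists w : C, x n = Some w /\ Cmod w <= M)) as [(M & N0 & H)|H].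
  - assert (H' : forall n, exists w : C, x (N0 + n)%nat = Some w /\ Cmod w <= M) by (intros; apply H; lia).
    destruct (choice _ H') as (w & Hw).
    destruct (bw w M) as (phi & z & Hphi & Hz); [apply Hw|].
    exists (Some z). intros e N He. destruct (Hz (e / 2) (half_pos _ He)) as (N1 & HN1).
    exists (N0 + phi (N + N1))%nat. split; [generalize (Hphi (N + N1)%nat); lia|].
    rewrite (proj1 (Hw _)). eapply Rle_lt_trans; [apply chordal_finite_le|].
    specialize (HN1 (N + N1)%nat ltac:(lia)). lra.
  - exists None. intros e N He. destruct (chordal_infty_small e He) as (M & HM).
    apply NNPP. intros Hn. apply H. exists M, N. intros n Hle.
    destruct (x n) as [w|] eqn:E.
    + exists w. split; auto. apply Rnot_lt_le. intros L. apply Hn. exists n. split; auto. rewrite E. auto.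
    + exfalso. apply Hn. exists n. split; auto. rewrite E. simpl. exact He.
Qed.

(** A continuous bijection of a compact Hausdorff space. If the inverse failed to be continuous at
    p, the preimages of a sequence tending to p would cluster at some x with F x = p, although they
    stay away from H p. *)
Lemma sphere_homeo_of_bijection (F : Defs.sphere -> Defs.sphere) :
  Defs.sphere_continuous F -> (forall p q, F p = F q -> p = q) -> (forall q, exists p, F p = q) ->
  Defs.sphere_homeo F.
Proof.
  intros HF Hinj Hsurj. destruct (choice _ Hsurj) as (H & HH).
  exists H. split; [|split; [|split]]; auto.
  intros p eps He. apply NNPP. intros N.
  assert (Hn : forall n : nat, exists q, Defs.chordal p q < / (INR n + 1) /\ ~ Defs.chordal (H p) (H q) < eps).
  { intros n. apply NNPP. intros N'. apply N. exists (/ (INR n + 1)). split.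
    - apply Rinv_0_lt_compat. generalize (pos_INR n). lra.
    - intros q Hq. apply NNPP. intros N2. apply N'. exists q. auto. }
  destruct (choice _ Hn) as (q & Hq).
  destruct (sphere_cluster (fun n => H (q n))) as (x & Hx).
  assert (Ex : F x = p).
  { apply chordal_separated. intros e He'. destruct (HF x e He') as (d & Hd & A).
    destruct (inv_INR_small e He') as (N1 & HN1).
    destruct (Hx d N1 Hd) as (n & Hn1 & Hn2). exists (q n). split.
    - rewrite <- (HH (q n)). auto.
    - eapply Rlt_trans; [apply Hq|]. auto. }
  destruct (Hx eps O He) as (n & _ & Hn2). apply (proj2 (Hq n)).
  replace (H p) with x; auto. apply Hinj. now rewrite HH.
Qed.

Lemma sphere_extension k l T : 0 <= k < 1 -> k <= l -> plane_map k T ->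
  (forall Z n, T (Z + turn n)%C = (T Z + turn n)%C) ->
  (forall Z Z', T Z = T Z' -> Z = Z') -> (forall p, exists Z, T Z = p) ->
  (forall B, exists X, forall Z, X < Re Z -> B < Re (T Z)) ->
  (forall B, exists X, forall Z, Re Z < X -> Re (T Z) < B) ->
  exists F, Defs.qc_sphere l F /\ F None = None /\ forall Z, F (Some (cexp Z)) = Some (cexp (T Z)).
Proof.
  intros Hk Hkl HT Hturn Hinj Hsurj Hright Hleft.
  (* Any choice of logarithms will do: [T] commutes with the periods, so exp(T Z) depends on exp Z
     only. *)
  assert (Hlog : forall z : C, exists Z, z <> 0 -> cexp Z = z).
  { intros z. destruct (classic (z = 0)) as [E|N].
    - exists 0. intros; contradiction.
    - destruct (cexp_surj z N) as (Z & HZ). exists Z. auto. }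
  destruct (choice _ Hlog) as (lg & Hlg).
  set (f := fun z : C => if Defs.C_eq_dec z (RtoC 0) then RtoC 0 else cexp (T (lg z))).
  assert (f0 : f 0 = 0).
  { unfold f. destruct (Defs.C_eq_dec (RtoC 0) (RtoC 0)); auto. contradiction. }
  assert (fexp : forall Z, f (cexp Z) = cexp (T Z)).
  { intros Z. unfold f. destruct (Defs.C_eq_dec (cexp Z) (RtoC 0)) as [E|N]; [now apply cexp_nz in E|].
    destruct (cexp_inj_mod _ _ (Hlg _ N)) as (n & ->).
    rewrite Hturn, cexp_plus, cexp_period. ring. }
  assert (Hloc := local_qc_of_plane k T f HT fexp).
  assert (fcont : forall z, ccont f z).
  { intros z. destruct (classic (z = 0)) as [->|N]; [|now apply (lq_cont k f Hloc)].
    intros e He. destruct (Hleft (ln e)) as (X & HX). exists (exp X). split; [apply exp_pos|].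
    intros z Hz. rewrite f0. replace (z - 0)%C with z in Hz by ring. replace (f z - 0)%C with (f z) by ring.
    destruct (classic (z = 0)) as [->|N]; [rewrite f0, Cmod_0; auto|].
    destruct (cexp_surj z N) as (Z & <-). rewrite fexp, Cmod_cexp in *.
    rewrite <- (exp_ln e) by auto. apply exp_increasing. apply HX. now apply exp_lt_inv. }
  set (F := fun p : Defs.sphere => match p with Some z => Some (f z) | None => None end).
  assert (Fcont : Defs.sphere_continuous F).
  { intros [z|] e He.
    - destruct (fcont z (e / 2) (half_pos _ He)) as (d & Hd & A).
      destruct (chordal_near_finite z d Hd) as (d' & Hd' & A'). exists d'. split; auto.
      intros q Hq. destruct (A' q Hq) as (w & -> & Hw).
      eapply Rle_lt_trans; [apply chordal_finite_le|]. specialize (A w Hw). lra.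
    - destruct (chordal_infty_small e He) as (M & HM).
      destruct (Hright (ln (Rabs M + 1))) as (X & HX).
      destruct (chordal_near_infty (exp X)) as (d & Hd & A). exists d. split; auto.
      intros [w|] Hq; [|exact He]. specialize (A _ Hq w eq_refl). apply HM.
      assert (Hw : w <> RtoC 0). { intros Z; subst. rewrite Cmod_0 in A. generalize (exp_pos X). lra. }
      destruct (cexp_surj w Hw) as (Z & <-). rewrite fexp, Cmod_cexp in *.
      apply exp_lt_inv in A. specialize (HX Z A). apply exp_increasing in HX.
      rewrite exp_ln in HX by (generalize (Rabs_pos M); lra). generalize (Rle_abs M). lra. }
  assert (Finj : forall p q, F p = F q -> p = q).
  { intros [z|] [w|] H; simpl in H; try discriminate; auto. injection H as H. f_equal.
    destruct (classic (z = RtoC 0)) as [->|Nz], (classic (w = RtoC 0)) as [->|Nw]; auto.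
    - destruct (cexp_surj w Nw) as (W & <-). rewrite f0, fexp in H. symmetry in H. now apply cexp_nz in H.
    - destruct (cexp_surj z Nz) as (Z & <-). rewrite f0, fexp in H. now apply cexp_nz in H.
    - destruct (cexp_surj w Nw) as (W & <-). destruct (cexp_surj z Nz) as (Z & <-). rewrite !fexp in H.
      destruct (cexp_inj_mod _ _ H) as (n & E). rewrite <- Hturn in E. apply Hinj in E. subst Z.
      rewrite cexp_plus, cexp_period. apply Cmult_1_r. }
  assert (Fsurj : forall q, exists p, F p = q).
  { intros [w|]; [|exists None; auto]. destruct (classic (w = RtoC 0)) as [->|Nw].
    - exists (Some (RtoC 0)). simpl. now rewrite f0.
    - destruct (cexp_surj w Nw) as (W & <-). destruct (Hsurj W) as (Z & <-).
      exists (Some (cexp Z)). simpl. now rewrite fexp. }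
  exists F. split; [split|split].
  - now apply sphere_homeo_of_bijection.
  - intros i j. apply (planar_qc_of_local k); auto.
    apply (local_qc_of_plane k (fun Z => flip j (T (flip i Z)))); [now apply plane_map_flip|].
    (* Away from the origin of the chart, inversion is a sign change of the logarithm, so the
       representation in charts [i] and [j] is again an exponential of a [plane_map]. *)
    intros Z. unfold Defs.loc_fun.
    assert (E1 : Defs.chart_inv i (cexp Z) = Some (cexp (flip i Z))).
    { unfold Defs.chart_inv, flip. destruct i; auto.
      destruct (Defs.C_eq_dec (cexp Z) Defs.Czero) as [E|N]; [now apply cexp_nz in E|].
      f_equal. symmetry. apply cexp_opp. }
    rewrite E1. unfold F. rewrite fexp.
    destruct j; [|reflexivity]. unfold Defs.chart.
    destruct (Defs.C_eq_dec (cexp (T (flip i Z))) Defs.Czero) as [E|N]; [now apply cexp_nz in E|].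
    symmetry. apply cexp_opp.
  - reflexivity.
  - intros Z. unfold F. now rewrite fexp.
Qed.

(** * The logarithm of the given function *)

Lemma wd_of_cderiv f (z l : C) : Defs.has_cderiv f z l -> wd f z l 0.
Proof.
  intros H eps He. destruct (H eps He) as (d & Hd & A). exists d. split; auto.
  intros h Hh. replace (h - 0)%C with h in Hh by ring.
  destruct (classic (h = 0)) as [->|N].
  - rewrite Cplus_0_r. replace (f z - f z - (l * 0 + 0 * Cconj 0))%C with (RtoC 0) by ring.
    rewrite Cmod_0. lra.
  - assert (Hp := Cmod_pos h N).
    assert (B : Cmod ((f (z + h)%C - f z) / h - l) < eps) by (apply A; split; [exact Hp|exact Hh]).
    replace (f (z + h)%C - f z - (l * h + 0 * Cconj h))%C with (((f (z + h)%C - f z) / h - l) * h)%C by (field; auto).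
    rewrite Cmod_mult. nra.
Qed.

Lemma rd_of_re_im (u : R -> C) t v :
  derivable_pt_lim (fun t => Re (u t)) t (Re v) -> derivable_pt_lim (fun t => Im (u t)) t (Im v) -> rd u t v.
Proof.
  intros H1 H2 e He. destruct (H1 _ (half_pos _ He)) as (d1 & A1). destruct (H2 _ (half_pos _ He)) as (d2 & A2).
  exists (Rmin d1 d2). split; [apply Rmin_pos; apply cond_pos|]. intros h Hh.
  destruct (Req_dec h 0) as [->|N].
  - rewrite Rplus_0_r. replace (u t - u t - v * RtoC 0)%C with (RtoC 0) by ring. rewrite Cmod_0, Rabs_R0. lra.
  - assert (B1 := A1 h N (Rlt_le_trans _ _ _ Hh (Rmin_l d1 d2))).
    assert (B2 := A2 h N (Rlt_le_trans _ _ _ Hh (Rmin_r d1 d2))).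
    assert (Hp : 0 < Rabs h) by now apply Rabs_pos_lt.
    assert (Key : forall x y w, Rabs ((x - y) / h - w) < e / 2 -> Rabs (x - y - w * h) <= e / 2 * Rabs h).
    { intros x y w B. replace (x - y - w * h) with (((x - y) / h - w) * h) by (field; auto). rewrite Rabs_mult. nra. }
    apply Key in B1. apply Key in B2.
    eapply Rle_trans; [apply Cmod_le_re_im|].
    replace (Re (u (t + h)%R - u t - v * h)) with (Re (u (t + h)) - Re (u t) - Re v * h)
      by (destruct (u (t + h)), (u t), v; simpl; ring).
    replace (Im (u (t + h)%R - u t - v * h)) with (Im (u (t + h)) - Im (u t) - Im v * h)
      by (destruct (u (t + h)), (u t), v; simpl; ring).
    lra.
Qed.

Lemma real_primitive (h : R -> R) X0 : 0 < X0 -> (forall x, 0 < x -> continuity_pt h x) ->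
  forall x, 0 < x -> derivable_pt_lim (fun x => RInt h X0 x) x (h x).
Proof.
  intros HX Hh x Hx. apply is_derive_Reals.
  assert (Hc : forall y, 0 < y -> continuous h y) by (intros; now apply continuity_pt_filterlim, Hh).
  apply is_derive_RInt with (a := X0); [|now apply Hc].
  exists (mkposreal x Hx). intros y Hy. apply Rabs_def2 in Hy. simpl in Hy. unfold minus, plus, opp in Hy; simpl in Hy.
  apply (RInt_correct (V := R_CompleteNormedModule)), (ex_RInt_continuous (V := R_CompleteNormedModule) h).
  intros z Hz. apply Hc.
  assert (0 < Rmin X0 y) by (apply Rmin_pos; lra). lra.
Qed.

Lemma primitive (h : R -> C) X0 (c0 : C) : 0 < X0 -> (forall x, 0 < x -> rcont h x) ->
  exists A : R -> C, A X0 = c0 /\ forall x, 0 < x -> rd A x (h x).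
Proof.
  intros HX Hh.
  exists (fun x => (Re c0 + RInt (fun x => Re (h x)) X0 x, Im c0 + RInt (fun x => Im (h x)) X0 x)). split.
  - rewrite !RInt_point. apply C_ext; simpl; unfold zero; simpl; ring.
  - intros x Hx. apply rd_of_re_im.
    + rewrite <- (Rplus_0_l (Re (h x))). apply (derivable_pt_lim_plus (fun _ => Re c0) (fun x => RInt (fun x => Re (h x)) X0 x)); [apply derivable_pt_lim_const|].
      apply (real_primitive (fun x => Re (h x))); auto. intros y Hy.
      assert (B := rcont_re h y 1 (Hh y Hy)). intros e He. destruct (B e He) as (d & Hd & D). exists d. split; auto.
      intros z Hz. specialize (D z Hz). simpl in *.
      replace (1 * fst (h z) - 0 * snd (h z)) with (fst (h z)) in D by ring.
      replace (1 * fst (h y) - 0 * snd (h y)) with (fst (h y)) in D by ring. exact D.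
    + rewrite <- (Rplus_0_l (Im (h x))). apply (derivable_pt_lim_plus (fun _ => Im c0) (fun x => RInt (fun x => Im (h x)) X0 x)); [apply derivable_pt_lim_const|].
      apply (real_primitive (fun x => Im (h x))); auto. intros y Hy.
      assert (B := rcont_re h y (- Ci) (Hh y Hy)). intros e He. destruct (B e He) as (d & Hd & D). exists d. split; auto.
      intros z Hz. specialize (D z Hz). simpl in *.
      replace (- 0 * fst (h z) - - (1) * snd (h z)) with (snd (h z)) in D by ring.
      replace (- 0 * fst (h y) - - (1) * snd (h y)) with (snd (h y)) in D by ring. exact D.
Qed.

Lemma rd_const_eq (u : R -> C) s t : (forall x, Rmin s t <= x <= Rmax s t -> rd u x 0) -> u t = u s.
Proof.
  intros H. apply Cmod_eq0_sub. assert (B := rd_lip u 0 0 s t).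
  replace (u t - u s - 0 * RtoC (t - s))%C with (u t - u s)%C in B by ring.
  apply Rle_antisym; [|apply Cmod_ge_0]. rewrite Rmult_0_l in B. apply B.
  intros x Hx. exists 0. split; auto. replace (0 - 0)%C with (RtoC 0) by ring. rewrite Cmod_0. lra.
Qed.

Lemma rd_minus u w t al be : rd u t al -> rd w t be -> rd (fun t => u t - w t)%C t (al - be)%C.
Proof.
  intros H1 H2 e He. destruct (H1 _ (half_pos _ He)) as (d1 & Hd1 & A1). destruct (H2 _ (half_pos _ He)) as (d2 & Hd2 & A2).
  exists (Rmin d1 d2). split; [now apply Rmin_pos|]. intros h Hh.
  assert (B1 := A1 h (Rlt_le_trans _ _ _ Hh (Rmin_l d1 d2))).
  assert (B2 := A2 h (Rlt_le_trans _ _ _ Hh (Rmin_r d1 d2))).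
  replace (u (t + h)%R - w (t + h)%R - (u t - w t) - (al - be) * h)%C
    with ((u (t + h)%R - u t - al * h) + - (w (t + h)%R - w t - be * h))%C by ring.
  eapply Rle_trans; [apply Cmod_triangle|]. rewrite Cmod_opp. lra.
Qed.

Lemma wd_of_rd_Re (u : R -> C) t al : rd u t al -> wd (fun z => u (Re z)) (RtoC t) (al / 2)%C (al / 2)%C.
Proof.
  intros H e He. destruct (H e He) as (d & Hd & A). exists d. split; auto.
  intros h Hh. replace (h - 0)%C with h in Hh by ring.
  assert (Hr := re_le_Cmod h). specialize (A (Re h) ltac:(lra)).
  replace (Re (RtoC t + h)) with (t + Re h) by (destruct h; reflexivity).
  change (Re (RtoC t)) with t.
  replace (al / 2 * h + al / 2 * Cconj h)%C with (al * RtoC (Re h))%C.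
  - eapply Rle_trans; [exact A|]. apply Rmult_le_compat_l; lra.
  - destruct al, h; apply C_ext; simpl; field.
Qed.

Lemma rd_mult u w t al be : rd u t al -> rd w t be -> rd (fun t => u t * w t)%C t (al * w t + u t * be)%C.
Proof.
  intros H1 H2.
  assert (M := wd_mult _ _ _ _ _ _ _ (wd_of_rd_Re _ _ _ H1) (wd_of_rd_Re _ _ _ H2)).
  apply (rd_of_wd_Re (fun t => u t * w t)%C) in M.
  eapply (eq_ind _ (rd (fun t => (u t * w t)%C) t) M).
  change (Re (RtoC t)) with t. destruct al, be, (u t), (w t); apply C_ext; simpl; field.
Qed.

Lemma rd_cexp u t al : rd u t al -> rd (fun t => cexp (u t)) t (cexp (u t) * al)%C.
Proof.
  intros H. assert (M := wd_cexpf _ _ _ _ (wd_of_rd_Re _ _ _ H)).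
  apply (rd_of_wd_Re (fun t => cexp (u t))) in M.
  eapply (eq_ind _ (rd (fun t => cexp (u t)) t) M).
  change (Re (RtoC t)) with t. destruct al, (cexp (u t)); apply C_ext; simpl; field.
Qed.

Lemma rd_ray f x th al : wd f ((x, th) : C) al 0 -> rd (fun x => f ((x, th) : C)) x al.
Proof.
  intros H. assert (E : forall y, ((0, th) + RtoC y)%C = ((y, th) : C)) by (intros; apply C_ext; simpl; ring).
  rewrite <- E in H. apply rd_horizontal in H. intros e He. destruct (H e He) as (d & Hd & A). exists d. split; auto.
  intros h Hh. specialize (A h Hh). rewrite !E in A. exact A.
Qed.

(** Uniformity in x follows from compactness: counterexamples with th' tending to th would cluster
    at a point of the segment, against the continuity of [q] there. *)
Lemma tube_continuity (q : C -> C) x1 x2 th e : (forall W, x1 <= Re W <= x2 -> ccont q W) -> 0 < e ->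
  exists d, 0 < d /\ forall x th', x1 <= x <= x2 -> Rabs (th' - th) < d -> Cmod (q (x, th') - q (x, th)) < e.
Proof.
  intros Hq He. apply NNPP. intros N.
  assert (Sq : forall n : nat, exists y : R * R, x1 <= fst y <= x2 /\ Rabs (snd y - th) < / (INR n + 1) /\
     e <= Cmod (q (fst y, snd y) - q (fst y, th))).
  { intros n. apply NNPP. intros N'. apply N. exists (/ (INR n + 1)). split.
    - apply Rinv_0_lt_compat. generalize (pos_INR n). lra.
    - intros x th' Hx Hth. apply Rnot_le_lt. intros L. apply N'. exists (x, th'). auto. }
  destruct (choice _ Sq) as (y & Hy).
  destruct (bw_real (fun n => fst (y n)) (Rabs x1 + Rabs x2)) as (phi & x & Hphi & Hx).
  { intros n. destruct (Hy n) as (H1 & _).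
    generalize (Rle_abs x2) (Rle_abs (- x1)) (Rabs_pos x1) (Rabs_pos x2). rewrite Rabs_Ropp. intros. apply Rabs_le. lra. }
  assert (HX : x1 <= x <= x2).
  { split; apply le_epsilon; intros e' He'; destruct (inv_INR_small e' He') as (N0 & HN);
      assert (B := Hx N0); specialize (HN N0 (le_n _)); apply Rabs_def2 in B; destruct (Hy (phi N0)) as (H1 & _); lra. }
  destruct (Hq (x, th) HX (e / 2) (half_pos _ He)) as (d & Hd & A).
  destruct (inv_INR_small (d / 2) (half_pos _ Hd)) as (n & Hn). specialize (Hn n (le_n _)).
  destruct (Hy (phi n)) as (H1 & H2 & H3). assert (B := Hx n).
  assert (Hm : / (INR (phi n) + 1) <= / (INR n + 1)).
  { apply Rinv_le_contravar; [generalize (pos_INR n); lra|]. generalize (le_INR _ _ (Hphi n)). lra. }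
  assert (C1 : Cmod (q (fst (y (phi n)), snd (y (phi n))) - q (x, th)) < e / 2).
  { apply A. eapply Rle_lt_trans; [apply Cmod_le_re_im|]. simpl. unfold Rminus in *. lra. }
  assert (C2 : Cmod (q (fst (y (phi n)), th) - q (x, th)) < e / 2).
  { apply A. eapply Rle_lt_trans; [apply Cmod_le_re_im|]. simpl. rewrite Rplus_opp_r, Rabs_R0. unfold Rminus in *. lra. }
  generalize (Cmod_tri3 (q (fst (y (phi n)), snd (y (phi n)))) (q (x, th)) (q (fst (y (phi n)), th))).
  rewrite (Cmod_sub_sym (q (x, th))). lra.
Qed.

(* A logarithm given near infinity is continued to the whole half-plane by integrating
   the logarithmic derivative along horizontal rays. *)
Lemma log_lift (G q L0 : C -> C) X0 : 0 < X0 ->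
  (forall W, 0 < Re W -> wd G W (q W * G W)%C 0) -> (forall W, 0 < Re W -> ccont q W) ->
  (forall W, X0 <= Re W -> nb W (fun W => cexp (L0 W) = G W) /\ ccont L0 W) ->
  exists L, (forall W, 0 < Re W -> cexp (L W) = G W /\ wd L W (q W) 0) /\
            (forall W, X0 <= Re W -> L W = L0 W).
Proof.
  intros HX HG Hq HL0.
  assert (D0 : forall W, X0 <= Re W -> wd L0 W (q W) 0).
  { intros W HW. destruct (HL0 W HW) as [H1 H2]. assert (HWp : 0 < Re W) by lra.
    assert (HGn : G W <> 0). { rewrite <- (nb_self _ _ H1). apply cexp_nz. }
    eapply wd_eq; [| |apply (wd_lift_exp L0 G W _ _ H2 H1 (HG W HWp))]; field; auto. }
  assert (Hray : forall th : R, exists A : R -> C, A X0 = L0 (X0, th) /\ forall x, 0 < x -> rd A x (q (x, th))).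
  { intros th. apply (primitive (fun x => q (x, th)) X0); auto. intros x Hx e He.
    destruct (Hq (x, th) Hx e He) as (d & Hd & A). exists d. split; auto. intros t Ht. apply A.
    eapply Rle_lt_trans; [apply Cmod_le_re_im|]. simpl. rewrite Rplus_opp_r, Rabs_R0. unfold Rminus in *. lra. }
  destruct (choice _ Hray) as (A & HA).
  set (L := fun W : C => A (Im W) (Re W)).
  assert (LX : forall th, L (X0, th) = L0 (X0, th)) by (intros; apply (HA th)).
  assert (LR : forall x th, 0 < x -> rd (fun x => L (x, th)) x (q (x, th))) by (intros x th; apply (HA th)).
  assert (Lfar : forall W, X0 <= Re W -> L W = L0 W).
  { intros [x th] Hx. simpl in Hx.
    assert (E := rd_const_eq (fun x => L (x, th) - L0 (x, th))%C X0 x). simpl in E.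
    assert (E' : (L (x, th) - L0 (x, th))%C = (L (X0, th) - L0 (X0, th))%C).
    { apply E. intros y Hy. rewrite Rmin_left, Rmax_right in Hy by auto.
      replace (RtoC 0) with (q (y, th) - q (y, th))%C by ring.
      apply rd_minus; [apply LR; lra|]. apply rd_ray, D0. simpl. lra. }
    rewrite LX in E'. replace (L0 (X0, th) - L0 (X0, th))%C with (RtoC 0) in E' by ring.
    replace (L (x, th)) with ((L (x, th) - L0 (x, th)) + L0 (x, th))%C by ring. rewrite E'. ring. }
  assert (Lexp : forall W, 0 < Re W -> cexp (L W) = G W).
  { intros [x th] Hx. simpl in Hx.
    (* On a ray G exp(-L) has derivative 0, and at X0 it equals 1. *)
    assert (W0 : forall y, 0 < y -> rd (fun y => G (y, th) * cexp (- L (y, th)))%C y 0).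
    { intros y Hy.
      assert (Ex : rd (fun t => cexp (- L (t, th))) y (cexp (- L (y, th)) * (RtoC (- (1)) * q (y, th)))%C).
      { apply rd_cexp. assert (B := rd_scal (RtoC (- (1))) _ _ _ (LR y th Hy)). intros e He.
        destruct (B e He) as (d & Hd & D). exists d. split; auto. intros h Hh. specialize (D h Hh).
        eapply Rle_trans; [right|exact D]. f_equal. rewrite RtoC_opp. ring. }
      assert (Gd : rd (fun t => G (t, th)) y (q (y, th) * G (y, th))%C) by (apply rd_ray, HG; exact Hy).
      eapply (eq_ind _ (rd _ y) (rd_mult _ _ _ _ _ Gd Ex)). rewrite RtoC_opp. ring. }
    assert (E := rd_const_eq _ X0 x (fun y Hy => W0 y ltac:(generalize (Rmin_pos X0 x HX Hx); lra))).
    simpl in E. rewrite LX in E.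
    rewrite <- (nb_self _ _ (proj1 (HL0 (X0, th) (Rle_refl X0)))) in E. rewrite <- cexp_plus in E.
    replace (L0 (X0, th) + - L0 (X0, th))%C with (RtoC 0) in E by ring. rewrite cexp_0, cexp_opp in E.
    assert (Hn := cexp_nz (L (x, th))).
    replace (G (x, th)) with (G (x, th) * / cexp (L (x, th)) * cexp (L (x, th)))%C by (field; auto).
    rewrite E. ring. }
  exists L. split; auto. intros W HW. split; auto.
  assert (HGn : G W <> 0). { rewrite <- (Lexp W HW). apply cexp_nz. }
  (* By [wd_lift_exp] continuity suffices, since L is a logarithm of the differentiable [G]. Only
     continuity across the rays is in doubt. *)
  assert (Hcont : ccont L W); cycle 1.
  { assert (HN : nb W (fun W => cexp (L W) = G W)).
    { generalize (nb_re_gt W 0 HW). apply filter_imp. exact Lexp. }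
    eapply wd_eq; [| |exact (wd_lift_exp L G W _ _ Hcont HN (HG W HW))]; field; auto. }
  (* The difference is split in three: along one ray near x0 ([S1]), between the two rays from X0 to
     x0 by uniform closeness of [q] ([S2]), and at X0, where [L] is the given [L0] ([S3]). *)
  intros e He. destruct W as [x0 th0]. simpl in HW.
  set (X1 := X0 + x0). set (lo := Rmin X0 (x0 / 2)).
  assert (Hlo : 0 < lo) by (apply Rmin_pos; lra).
  assert (Hlo1 : lo <= X0) by apply Rmin_l. assert (Hlo2 : lo <= x0 / 2) by apply Rmin_r.
  assert (Hqs : forall W, lo <= Re W <= X1 -> ccont q W) by (intros; apply Hq; lra).
  set (e1 := e / 4 / (X0 + x0 + 1)). assert (He1 : 0 < e1) by (unfold e1; repeat apply Rdiv_lt_0_compat; lra).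
  destruct (tube_continuity q lo X1 th0 e1 Hqs He1) as (d1 & Hd1 & T1).
  destruct (HL0 (X0, th0) (Rle_refl X0)) as [_ Lc].
  destruct (Lc (e / 4)) as (d2 & Hd2 & T2); [lra|].
  destruct (Hq (x0, th0) HW 1 Rlt_0_1) as (d3 & Hd3 & T3).
  set (M := Cmod (q (x0, th0)) + 1). generalize (Cmod_ge_0 (q (x0, th0))); intros HM.
  set (d := Rmin (Rmin d1 d2) (Rmin (d3 / 2) (Rmin (x0 / 2) (e / 4 / M)))).
  assert (Hd : 0 < d). { unfold d, M. repeat apply Rmin_pos; try lra. apply Rdiv_lt_0_compat; lra. }
  assert (N1 : d <= d1) by (eapply Rle_trans; [apply Rmin_l|apply Rmin_l]).
  assert (N2 : d <= d2) by (eapply Rle_trans; [apply Rmin_l|apply Rmin_r]).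
  assert (N3 : d <= d3 / 2) by (eapply Rle_trans; [apply Rmin_r|apply Rmin_l]).
  assert (N4 : d <= x0 / 2) by (eapply Rle_trans; [apply Rmin_r|eapply Rle_trans; [apply Rmin_r|apply Rmin_l]]).
  assert (N5 : d <= e / 4 / M) by (eapply Rle_trans; [apply Rmin_r|eapply Rle_trans; [apply Rmin_r|apply Rmin_r]]).
  exists d. split; auto. intros [x th] Hz.
  assert (Hx : Rabs (x - x0) < d) by (eapply Rle_lt_trans; [apply (re_le_Cmod ((x, th) - (x0, th0))%C)|exact Hz]).
  assert (Hth : Rabs (th - th0) < d) by (eapply Rle_lt_trans; [apply (im_le_Cmod ((x, th) - (x0, th0))%C)|exact Hz]).
  assert (S1 : Cmod (L (x, th) - L (x0, th)) <= e / 4).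
  { assert (B := rd_lip (fun x => L (x, th)) 0 M x0 x). cbv beta in B.
    replace (L (x, th) - L (x0, th) - 0 * RtoC (x - x0))%C with (L (x, th) - L (x0, th))%C in B by ring.
    eapply Rle_trans; [apply B|].
    - intros y Hy. assert (Hyx : Rabs (y - x0) < d).
      { apply Rabs_def2 in Hx. unfold Rmin, Rmax in Hy. apply Rabs_def1; destruct (Rle_dec x0 x); lra. }
      assert (Hy0 : 0 < y) by (apply Rabs_def2 in Hyx; lra).
      exists (q (y, th)). split; [now apply LR|]. replace (q (y, th) - 0)%C with (q (y, th)) by ring.
      assert (Q : Cmod (q (y, th) - q (x0, th0)) < 1).
      { apply T3. eapply Rle_lt_trans; [apply Cmod_le_re_im|]. simpl. unfold Rminus in *. lra. }
      generalize (Cmod_rev (q (y, th)) (q (x0, th0))). unfold M. lra.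
    - apply Rle_trans with (M * (e / 4 / M)); [apply Rmult_le_compat_l; unfold M in *; lra|].
      right. field. unfold M. lra. }
  assert (S2 : Cmod ((L (x0, th) - L (x0, th0)) - (L (X0, th) - L (X0, th0))) <= e / 4).
  { assert (B := rd_lip (fun x => L (x, th) - L (x, th0))%C 0 e1 X0 x0). simpl in B.
    replace (L (x0, th) - L (x0, th0) - (L (X0, th) - L (X0, th0)) - 0 * RtoC (x0 - X0))%C
      with ((L (x0, th) - L (x0, th0)) - (L (X0, th) - L (X0, th0)))%C in B by ring.
    eapply Rle_trans; [apply B|].
    - intros y Hy. assert (Hyr : lo <= y <= X1).
      { unfold Rmin, Rmax in Hy. unfold X1. destruct (Rle_dec X0 x0); lra. }
      exists (q (y, th) - q (y, th0))%C. split; [apply rd_minus; apply LR; lra|].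
      replace (q (y, th) - q (y, th0) - 0)%C with (q (y, th) - q (y, th0))%C by ring.
      left. apply T1; auto. lra.
    - apply Rle_trans with (e1 * (X0 + x0 + 1)).
      + apply Rmult_le_compat_l; [lra|]. apply Rabs_le. lra.
      + right. unfold e1. field. lra. }
  assert (S3 : Cmod (L (X0, th) - L (X0, th0)) < e / 4).
  { rewrite !LX. apply T2. eapply Rle_lt_trans; [apply Cmod_le_re_im|]. simpl.
    rewrite Rplus_opp_r, Rabs_R0. unfold Rminus in *. lra. }
  replace (L (x, th) - L (x0, th0))%C with ((L (x, th) - L (x0, th)) +
    (((L (x0, th) - L (x0, th0)) - (L (X0, th) - L (X0, th0))) + (L (X0, th) - L (X0, th0))))%C by ring.
  eapply Rle_lt_trans; [apply Cmod_triangle|].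
  eapply Rle_lt_trans; [apply Rplus_le_compat_l, Cmod_triangle|]. lra.
Qed.

Lemma Cmod_cexp_gt W : 0 < Re W -> 1 < Cmod (cexp W).
Proof. intros H. rewrite Cmod_cexp, <- exp_0. now apply exp_increasing. Qed.

Lemma core_of_function a b k (g g1 g2 phi : C -> C) (l : C) :
  1 <= a -> 0 <= k < 1 -> Rabs b <= k * Cmod (cpl a b) ->
  wd phi 0 l 0 -> phi 0 = 0 ->
  (forall z, 1 < Cmod z -> g z = (z + phi (/ z))%C) ->
  (forall z, 1 < Cmod z -> wd g z (g1 z) 0) ->
  (forall z, 1 < Cmod z -> wd g1 z (g2 z) 0) ->
  (forall z, 1 < Cmod z -> g z <> 0 /\ g1 z <> 0) ->
  (forall z, 1 < Cmod z ->
     Cmod (Ci * b + ((1 - Cmod z ^ 2) * a)%R *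
       ((1 - cpl a b) * (1 - z * g1 z / g z) - cpl a b * (z * g2 z / g1 z)))
     <= a * k * Cmod (cpl a b) - Rabs b * (a - 1)) ->
  exists L q E, core a b k L q E /\ forall W, 0 < Re W -> cexp (L W) = g (cexp W).
Proof.
  intros Ha Hk Hb Hphi Hphi0 Hg Hg1 Hg2 Hnz HE.
  set (s := cpl a b) in *.
  assert (Hs : s <> 0). { intros X. apply (f_equal Re) in X. simpl in X. lra. }
  set (q := fun W => (cexp W * g1 (cexp W) / g (cexp W))%C).
  set (E := fun W => ((1 - s) * (1 - q W) - s * (cexp W * g2 (cexp W) / g1 (cexp W)))%C).
  assert (HG : forall W, 0 < Re W -> wd (fun W => g (cexp W)) W (q W * g (cexp W))%C 0).
  { intros W HW. assert (H1 := Cmod_cexp_gt W HW). destruct (Hnz _ H1).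
    eapply wd_eq; [| |apply (wd_comp_hol cexp g W _ _ _ (wd_cexp W) (Hg1 _ H1))].
    - unfold q. field. auto.
    - ring. }
  (* With w = exp W and derivatives in W, q'/q = 1 + w g''/g' - q; eliminating g'' by the definition
     of [E] gives this equation. *)
  assert (Hq : forall W, 0 < Re W -> wd q W (q W * (1 - E W - q W) / s)%C 0).
  { intros W HW. assert (H1 := Cmod_cexp_gt W HW). destruct (Hnz _ H1) as [N1 N2].
    assert (D1 := wd_comp_hol cexp g1 W _ _ _ (wd_cexp W) (Hg2 _ H1)).
    assert (D2 := wd_invf _ _ _ _ (HG W HW) N1).
    eapply wd_eq; [| |exact (wd_mult _ _ _ _ _ _ _ (wd_mult _ _ _ _ _ _ _ (wd_cexp W) D1) D2)].
    - unfold E, q. field. auto.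
    - cbv beta. field. auto. }
  assert (Eper : forall W n, cexp (W + turn n) = cexp W).
  { intros W n. rewrite cexp_plus, cexp_period. ring. }
  assert (Qper : forall W n, q (W + turn n)%C = q W) by (intros W n; unfold q; now rewrite Eper).
  destruct (wd_bo _ _ _ _ Hphi) as (K & HK & (d & Hd & Bphi)).
  destruct Clog_near_1 as (r & Hr & Hlog).
  set (L0 := fun W => (W + Clog (g (cexp W) / cexp W))%C).
  (* The expansion has no constant term: phi(u) = O(u) makes g(w)/w - 1 = phi(1/w)/w of order
     |w|^(-2), which is the rate in [core_infty]. *)
  assert (Far : far (fun W => 0 < Re W /\ Cmod (g (cexp W) / cexp W - 1) <= K * exp (- (2) * Re W) /\
     K * exp (- (2) * Re W) < r)).
  { assert (Hd2 : 0 < (d / 2) ^ 2) by (apply pow_lt; lra).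
    assert (Hr2 : 0 < r / 2 / K) by (apply Rdiv_lt_0_compat; lra).
    generalize (filter_and _ _ (far_gt 0) (filter_and _ _ (far_exp _ Hd2) (far_exp _ Hr2))).
    apply filter_imp. intros W (H1 & H2 & H3).
    assert (Hw := cexp_nz W). assert (H1' := Cmod_cexp_gt W H1).
    assert (Ee : exp (- (2) * Re W) = exp (- Re W) * exp (- Re W)) by (rewrite <- exp_plus; f_equal; ring).
    assert (Eu : Cmod (/ cexp W) = exp (- Re W)) by (rewrite Cmod_inv, Cmod_cexp, exp_Ropp; auto).
    assert (Hu : exp (- Re W) < d).
    { rewrite Ee in H2. generalize (exp_pos (- Re W)). intros.
      apply Rnot_le_lt. intros L. simpl in H2. nra. }
    split; [auto|]. split.
    - rewrite Hg by auto.
      replace ((cexp W + phi (/ cexp W)) / cexp W - 1)%C with (phi (/ cexp W) * / cexp W)%C by (field; auto).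
      rewrite Cmod_mult, Eu, Ee, <- Rmult_assoc. apply Rmult_le_compat_r; [left; apply exp_pos|].
      assert (B := Bphi (/ cexp W)%C). rewrite Hphi0 in B.
      replace (0 + / cexp W)%C with (/ cexp W)%C in B by ring.
      replace (/ cexp W - 0)%C with (/ cexp W)%C in B by ring.
      replace (phi (/ cexp W) - 0)%C with (phi (/ cexp W))%C in B by ring.
      rewrite Eu in B. now apply B.
    - apply Rmult_le_compat_l with (r := K) in H3; [|lra].
      replace (K * (r / 2 / K)) with (r / 2) in H3 by (field; lra). lra. }
  destruct Far as (X & HX & Far).
  assert (L0ok : forall W, X <= Re W -> slit (g (cexp W) / cexp W) /\ Cmod (L0 W - W) <= 2 * K * exp (- (2) * Re W)).
  { intros W HW. destruct (Far W HW) as (_ & B1 & B2).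
    destruct (Hlog (g (cexp W) / cexp W)%C) as [S1 S2]; [lra|]. split; auto.
    unfold L0. replace (W + Clog (g (cexp W) / cexp W) - W)%C with (Clog (g (cexp W) / cexp W)) by ring. lra. }
  assert (L0exp : forall W, X <= Re W -> cexp (L0 W) = g (cexp W)).
  { intros W HW. destruct (L0ok W HW) as [S _]. unfold L0. rewrite cexp_plus, Clog_exp by auto.
    field. apply cexp_nz. }
  (* The margin 1 makes [L0] a logarithm on a neighbourhood of every point with Re W >= X + 1. *)
  destruct (log_lift (fun W => g (cexp W)) q L0 (X + 1)) as (L & HL1 & HL2).
  - lra.
  - exact HG.
  - intros W HW. eapply wd_ccont. now apply Hq.
  - intros W HW. split.
    + generalize (nb_re_gt W X ltac:(lra)). apply filter_imp. intros z Hz. apply L0exp. lra.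
    + unfold L0. apply limC_plus; [apply ccont_id|].
      apply (limC_comp (fun W => g (cexp W) / cexp W)%C Clog).
      * apply limC_div; [|eapply wd_ccont; apply wd_cexp|apply cexp_nz].
        exact (wd_ccont _ _ _ _ (HG W ltac:(lra))).
      * apply ccont_Clog. apply L0ok. lra.
  - exists L, q, E. split; [|intros; now apply HL1].
    constructor; auto.
    + intros W HW. now apply HL1.
    + intros W HW. destruct (Hnz _ (Cmod_cexp_gt W HW)). unfold q, Cdiv.
      repeat apply Cmult_nz; auto using cexp_nz, Cinv_nz.
    + intros W HW. assert (B := HE _ (Cmod_cexp_gt W HW)).
      rewrite Cmod_cexp in B. replace (exp (Re W) ^ 2) with (exp (2 * Re W)) in B.
      * replace (a * (1 - exp (2 * Re W))%R * E W)%C with (((1 - exp (2 * Re W)) * a)%R * E W)%C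
          by (rewrite RtoC_mult; ring). exact B.
      * simpl. rewrite Rmult_1_r, <- exp_plus. f_equal. ring.
    + intros W n HW. split; auto. destruct W as [x th]. simpl in HW.
      set (th' := th + 2 * PI * IZR n).
      assert (Et : forall y, ((y, th) + turn n)%C = ((y, th') : C)) by (intros; unfold th'; apply C_ext; simpl; ring).
      (* As [q] is periodic, the difference of L on two rays that are a period apart is constant;
         near infinity it is read off from [L0]. *)
      assert (C0 := rd_const_eq (fun y => L (y, th') - L (y, th))%C (X + 1) x). cbv beta in C0.
      rewrite Et. replace (L (x, th')) with ((L (x, th') - L (x, th)) + L (x, th))%C by ring.
      rewrite C0.
      * rewrite !HL2 by (simpl; lra). rewrite <- Et. unfold L0. rewrite Eper. ring.
      * intros y Hy. assert (Hy0 : 0 < y). { assert (0 < Rmin (X + 1) x) by (apply Rmin_pos; lra). lra. }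
        replace (RtoC 0) with (q (y, th') - q (y, th))%C by (rewrite <- Et, Qper; ring).
        apply rd_minus; apply rd_ray, HL1; exact Hy0.
    + exists (X + 1), (2 * K). split; [lra|]. intros W HW. rewrite HL2 by auto. apply L0ok. lra.
Qed.

(** * The dilatation and the theorem *)

Lemma dilatation_bound a b k : 1 <= a -> 0 <= k < 1 ->
  k <= (2 * k * a + (1 - k ^ 2) * Rabs b) / ((1 + k ^ 2) * a + (1 - k ^ 2) * Cmod (a, b)).
Proof.
  intros Ha Hk. assert (Hs : Cmod (a, b) <= a + Rabs b).
  { eapply Rle_trans; [apply Cmod_le_re_im|]. simpl. rewrite (Rabs_pos_eq a) by lra. lra. }
  generalize (Rabs_pos b) (Cmod_ge_0 (a, b)). intros.
  assert (Hk2 : 0 < 1 - k ^ 2) by (simpl; nra).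
  assert (Hden : 0 < (1 + k ^ 2) * a + (1 - k ^ 2) * Cmod (a, b)) by (simpl in *; nra).
  apply Rmult_le_reg_r with ((1 + k ^ 2) * a + (1 - k ^ 2) * Cmod (a, b)); auto.
  unfold Rdiv. rewrite Rmult_assoc, Rinv_l, Rmult_1_r by lra.
  (* Once the denominator is cleared, this is the difference of the two sides. It is nonnegative by
     |s| <= a + |b| and k < 1. *)
  assert (0 <= (1 - k ^ 2) * (k * a + Rabs b - k * Cmod (a, b))) by (apply Rmult_le_pos; nra).
  simpl in *. nra.
Qed.

Require Import Defs.

Theorem theorem3 (a b k : R) (g g1 g2 : Cplx -> Cplx) :
  1 <= a -> 0 <= k -> k < 1 ->
  Rabs b / Cnorm (a, b) <= k ->
  (* g(ζ) = ζ + φ(1/ζ) with φ holomorphic at 0, φ(0) = 0, i.e. g(ζ) = ζ + d/ζ + ... *)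
  (exists phi : Cplx -> Cplx,
      (forall w, Cnorm w < 1 -> exists l, has_cderiv phi w l) /\
      phi Czero = Czero /\
      (forall z, 1 < Cnorm z -> g z = Cadd z (phi (Cinv z)))) ->
  (* g1 = g', g2 = g'' on D* *)
  (forall z, 1 < Cnorm z -> has_cderiv g z (g1 z)) ->
  (forall z, 1 < Cnorm z -> has_cderiv g1 z (g2 z)) ->
  (* the expression is defined (finite) on D* \ {∞} *)
  (forall z, 1 < Cnorm z -> g z <> Czero /\ g1 z <> Czero) ->
  (forall z, 1 < Cnorm z ->
     Cnorm (Cadd (Cmul Ci (RtoC b))
              (Cscale ((1 - Cnorm z ^ 2) * a)
                 (Csub (Cmul (Csub Cone (a, b)) (Csub Cone (Cdiv (Cmul z (g1 z)) (g z))))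
                       (Cmul (a, b) (Cdiv (Cmul z (g2 z)) (g1 z))))))
     <= a * k * Cnorm (a, b) - Rabs b * (a - 1)) ->
  exists F : sphere -> sphere,
    qc_sphere ((2 * k * a + (1 - k ^ 2) * Rabs b) /
               ((1 + k ^ 2) * a + (1 - k ^ 2) * Cnorm (a, b))) F /\
    F None = None /\
    (forall z, 1 < Cnorm z -> F (Some z) = Some (g z)).
Proof.
  intros Ha Hk0 Hk1 Hb (phi & Hphi & Hphi0 & Hg) Hg1 Hg2 Hnz HE.
  assert (Hk : 0 <= k < 1) by lra.
  assert (Hs : 0 < Cnorm (a, b)).
  { apply (Cmod_pos (a, b)). intros X. apply (f_equal fst) in X. simpl in X. lra. }
  assert (Hb' : Rabs b <= k * Cmod (cpl a b)).
  { apply Rmult_le_compat_r with (r := Cnorm (a, b)) in Hb; [|lra].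
    unfold Rdiv in Hb. rewrite Rmult_assoc, Rinv_l, Rmult_1_r in Hb by lra. exact Hb. }
  destruct (Hphi Czero) as (l & Hl).
  { change (Cmod 0 < 1). rewrite Cmod_0. lra. }
  destruct (core_of_function a b k g g1 g2 phi l) as (L & q & E & HC & HL); auto.
  - exact (wd_of_cderiv _ _ _ Hl).
  - intros z Hz. exact (wd_of_cderiv _ _ _ (Hg1 z Hz)).
  - intros z Hz. exact (wd_of_cderiv _ _ _ (Hg2 z Hz)).
  - intros z Hz. assert (B := HE z Hz). rewrite Cscale_eq in B. exact B.
  - destruct (core_extension a b k L q E HC) as (T & HT & Hturn & Hout & Hinj & Hsurj & Hright & Hleft).
    destruct (sphere_extension k _ T Hk (dilatation_bound a b k Ha Hk) HT Hturn Hinj Hsurj Hright Hleft)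
      as (F & HF & HF0 & HFe).
    exists F. split; [exact HF|]. split; [exact HF0|].
    intros z Hz. assert (Hzn : z <> Czero).
    { intros X. rewrite X in Hz. change (1 < Cmod 0) in Hz. rewrite Cmod_0 in Hz. lra. }
    destruct (cexp_surj z Hzn) as (Z & <-).
    assert (HZ : 0 < Re Z).
    { change (1 < Cmod (cexp Z)) in Hz. rewrite Cmod_cexp, <- exp_0 in Hz. now apply exp_lt_inv. }
    rewrite HFe, Hout, HL; auto.
Qed.
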